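(* There exist constants $\epsilon_0>0$ and $C>0$ such that for every $\epsilon\in(0,\epsilon_0)$ and every $v\in W^{1,2}(S;\mathbb{R}^2)$, $$\|v-\Pi_\epsilon(v)\|_{W^{1,2}(S)}\le \frac{C}{\epsilon}\,\|\mathrm{sym}(\bar\nabla_\epsilon v\,\bar R_0^T)\|_{L^2(S)}.$$
   Context: Let $\gamma:[0,1]\to\mathbb{R}^3$, $\gamma(s)=(0,\gamma_2(s),\gamma_3(s))$, be a simple planar curve of class $C^6$ parametrized by arclength. Set $\tau:=\dot\gamma$, $n:=(0,-\tau_3,\tau_2)$, and let $k:=\dot\tau\cdot n$ be the curvature, assumed not identically zero on $[0,1]$. Two-dimensional versions: $\bar\tau=(\tau_2,\tau_3)$, $\bar n=(-\tau_3,\tau_2)$, and $\bar R_0=(\bar\tau\,|\,\bar n)$. Let $S=(0,1)\times(-\tfrac12,\tfrac12)$ with coordinates $(s,t)$. For $\epsilon>0$ and $v\in W^{1,2}(S;\mathbb{R}^2)$ let $\bar\nabla_\epsilon v:=\big(\tfrac{1}{1-\epsilon t k}\partial_s v\,\big|\,\tfrac1\epsilon\partial_t v\big)$. Let $M_\epsilon:=\{v\in W^{1,2}(S;\mathbb{R}^2):\mathrm{sym}(\bar\nabla_\epsilon v\,\bar R_0^T)=0\}$ (a closed subspace of $W^{1,2}(S;\mathbb{R}^2)$), and let $\Pi_\epsilon:W^{1,2}(S;\mathbb{R}^2)\to M_\epsilon$ be the orthogonal projection with respect to the $W^{1,2}$ scalar product. *)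

(* Defs.v *)
From HB Require Import structures.
From mathcomp Require Import all_boot all_order all_algebra.
From mathcomp Require Import all_classical all_reals all_analysis.
Set Implicit Arguments. Unset Strict Implicit. Unset Printing Implicit Defensive.
Import Order.TTheory GRing.Theory Num.Theory.
Import numFieldNormedType.Exports.
Local Open Scope classical_set_scope.
Local Open Scope ring_scope.

Section Defs.
Variable R : realType.

Definition Sdom : set (R * R) :=
  [set x | (0 < x.1 < 1) /\ (- 2^-1 < x.2 < 2^-1)].

Definition mu2 := (@lebesgue_measure R \x @lebesgue_measure R)%E.

Definition dir (j : 'I_2) : R * R := if j == ord0 then (1, 0) else (0, 1).
Definition pderiv (j : 'I_2) (f : R * R -> R) : R * R -> R :=
  fun x => 'D_(dir j) f x.
Definition iter_pderiv (js : seq 'I_2) (f : R * R -> R) := foldr pderiv f js.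

Definition smooth2 (f : R * R -> R) :=
  forall js : seq 'I_2, continuous (iter_pderiv js f) /\
    forall (j : 'I_2) (x : R * R), derivable (iter_pderiv js f) x (dir j).

(* Test functions C_c^infinity(S): smooth with compact support inside S
   (equivalently, support inside a closed subrectangle of S). *)
Definition test_fun (f : R * R -> R) :=
  smooth2 f /\
  exists a b c d : R, (0 < a) /\ (a < b) /\ (b < 1) /\ (- 2^-1 < c) /\ (c < d) /\ (d < 2^-1) /\
    forall x, ~ ((a <= x.1 <= b) /\ (c <= x.2 <= d)) -> f x = 0.

Definition L2 (f : R * R -> R) :=
  measurable_fun Sdom f /\ mu2.-integrable Sdom (fun x => (f x ^+ 2)%:E).

Definition weak_pderiv (j : 'I_2) (f g : R * R -> R) :=
  forall phi, test_fun phi ->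
    Rintegral mu2 Sdom (fun x => f x * pderiv j phi x) =
    - Rintegral mu2 Sdom (fun x => g x * phi x).

Definition W12 (v : 'I_2 -> R * R -> R) (Dv : 'I_2 -> 'I_2 -> R * R -> R) :=
  (forall i, L2 (v i)) /\ (forall i j, L2 (Dv i j) /\ weak_pderiv j (v i) (Dv i j)).

Definition W12_inner (v : 'I_2 -> R * R -> R) (Dv : 'I_2 -> 'I_2 -> R * R -> R)
  (w : 'I_2 -> R * R -> R) (Dw : 'I_2 -> 'I_2 -> R * R -> R) : R :=
  Rintegral mu2 Sdom (fun x => \sum_(i < 2) v i x * w i x
                              + \sum_(i < 2) \sum_(j < 2) Dv i j x * Dw i j x).
Definition W12_norm v Dv := Num.sqrt (W12_inner v Dv v Dv).

Definition L2_norm_mx (A : R * R -> 'M[R]_2) : R :=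
  Num.sqrt (Rintegral mu2 Sdom (fun x => \sum_(i < 2) \sum_(j < 2) (A x i j) ^+ 2)).

Definition Ck (n : nat) (f : R -> R) :=
  (forall m, (m < n)%N -> forall x, derivable (derive1n m f) x 1) /\
  continuous (derive1n n f).

(* Curvature k = tau' . n with tau = (g2', g3'), n = (-g3', g2'). *)
Definition curvature (g2 g3 : R -> R) (s : R) : R :=
  derive1n 1 g2 s * derive1n 2 g3 s - derive1n 1 g3 s * derive1n 2 g2 s.

(* \bar R_0 = (\bar tau | \bar n). *)
Definition R0 (g2 g3 : R -> R) (s : R) : 'M[R]_2 :=
  \matrix_(i < 2, j < 2)
    if i == ord0 then (if j == ord0 then derive1n 1 g2 s else - derive1n 1 g3 s)
    else (if j == ord0 then derive1n 1 g3 s else derive1n 1 g2 s).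

Definition grad_eps (g2 g3 : R -> R) (eps : R) (Dv : 'I_2 -> 'I_2 -> R * R -> R)
  (x : R * R) : 'M[R]_2 :=
  \matrix_(i < 2, j < 2)
    if j == ord0 then Dv i j x / (1 - eps * x.2 * curvature g2 g3 x.1)
    else Dv i j x / eps.

Definition symmx (A : 'M[R]_2) : 'M[R]_2 := 2^-1 *: (A + A^T).

Definition strain g2 g3 eps Dv (x : R * R) : 'M[R]_2 :=
  symmx (grad_eps g2 g3 eps Dv x *m (R0 g2 g3 x.1)^T).

Definition in_M g2 g3 eps v Dv :=
  W12 v Dv /\ {ae mu2, forall x, Sdom x -> strain g2 g3 eps Dv x = 0}.

Definition is_proj g2 g3 eps v Dv p Dp :=
  in_M g2 g3 eps p Dp /\
  forall w Dw, in_M g2 g3 eps w Dw ->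
    W12_inner (fun i x => v i x - p i x) (fun i j x => Dv i j x - Dp i j x) w Dw = 0.

End Defs.

(* Main.v *)
Require Import Defs.
From HB Require Import structures.
From mathcomp Require Import all_boot all_order all_algebra.
From mathcomp Require Import all_classical all_reals all_analysis measurable_realfun.
From mathcomp Require Import ring lra zify.
Set Implicit Arguments. Unset Strict Implicit. Unset Printing Implicit Defensive.
Import Order.TTheory GRing.Theory Num.Theory.
Import numFieldNormedType.Exports.
Local Open Scope classical_set_scope.
Local Open Scope ring_scope.

(* Since [v - p] is orthogonal to the rigid fields, its norm is at most that of [v - w] for
   every rigid [w], so it suffices to exhibit one good [w].  In the moving frame (tau, n) the
   components (a, b) of v satisfy a planar Korn problem after rescaling t by eps: the strain
   controls [a_s - k b], [b_t / eps] and [a_t / eps + b_s + k a].  Sampling against products of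
   smooth B-spline-like bumps turns weak derivatives into exact finite differences, and the
   curvature terms, up to their t-derivatives, into functions of s alone, which discrete
   primitives remove.  For grid functions, [a + b] is almost additive along the diagonals, so a
   stable form of Cauchy's equation gives a nearby infinitesimal rigid motion; reflections and
   cutoffs then reduce Korn's inequality to zero boundary values.  The resulting bound on the
   oscillation of [a_t / eps] is uniform in the grid and passes to the limit by duality.
   Choosing the rotation in [w] so that the infinitesimal rotation omega of [v - w] has mean
   zero, one gets |omega| <= C (|strain| / eps + eps |omega|), and the last term is absorbed
   for small eps; Poincare's inequality gives the translation. *)

(** * Korn's inequality on a grid *)

(** The factor [1 / eps] of the theorem is the price of a fixed square. Korn's inequality is applied
    to the pair [(a / eps, b)], whose shear is [a_t / eps + b_s]; its first diagonal strain is then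
    [a_s / eps], so this component of the strain of v enters divided by [eps]. Only omega, the
    antisymmetric part of the scaled gradient in the frame, has to be estimated: together with the
    strain it determines all derivatives of v algebraically. Since omega is [- a_t / eps] up to the
    strain, the oscillation of [a_t / eps] is enough, and this quantity is blind to functions of s
    added to a or b. The obstacle is that the curvature terms [k b / eps] and [k a] are not small,
    whereas their t-derivatives are: [b_t] is [eps] times a strain component, and [a_t] is [eps]
    times strain minus omega, whence the term [eps |omega|] to be absorbed. To replace such a term
    by a function of s, its values on a line of constant t are wanted, which an [L^2] function does
    not have; on the grid the bottom row of samples takes their place. This is a main reason for
    proving Korn's inequality for grid functions. *)

Section DiscreteKorn.
Variable R : realFieldType.
Implicit Types (f g : nat -> R) (u w F G H : nat -> nat -> R).

Definition ds u i j := u i.+1 j - u i j.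
Definition dt u i j := u i j.+1 - u i j.
Definition shear u1 u2 i j := dt u1 i j + ds u2 i j.
Definition sq2 M N F := \sum_(i < M) \sum_(j < N) F i j ^+ 2.
(** Undivided differences and unweighted sums: Korn's inequality is invariant under scaling, so the
    mesh width is left out and enters only when samples are compared with norms. *)
Definition energy M N u1 u2 :=
  sq2 M N (ds u1) + sq2 M N (dt u2) + sq2 M N (shear u1 u2).

Lemma sq2_ge0 M N F : 0 <= sq2 M N F.
Proof. by do 2 (apply: sumr_ge0 => ? _); rewrite sqr_ge0. Qed.

Lemma energy_ge0 M N u1 u2 : 0 <= energy M N u1 u2.
Proof. by rewrite !addr_ge0 ?sq2_ge0. Qed.

Lemma eq_sq2 M N F G :
  (forall i j, (i < M)%N -> (j < N)%N -> F i j = G i j) -> sq2 M N F = sq2 M N G.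
Proof. by move=> h; apply: eq_bigr => i _; apply: eq_bigr => j _; rewrite h. Qed.

Lemma sq2_le3 M N F G1 G2 G3 a b c :
  (forall i j, (i < M)%N -> (j < N)%N ->
    F i j ^+ 2 <= a * G1 i j ^+ 2 + b * G2 i j ^+ 2 + c * G3 i j ^+ 2) ->
  sq2 M N F <= a * sq2 M N G1 + b * sq2 M N G2 + c * sq2 M N G3.
Proof.
move=> h; rewrite /sq2 !mulr_sumr -!big_split /=; apply: ler_sum => i _.
by rewrite !mulr_sumr -!big_split /=; apply: ler_sum => j _; exact: h.
Qed.

Lemma sq2C M N F : sq2 M N (fun i j => F j i) = sq2 N M F.
Proof. by rewrite /sq2 exchange_big. Qed.

Lemma energyC M N u1 u2 :
  energy M N (fun i j => u2 j i) (fun i j => u1 j i) = energy N M u1 u2.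
Proof.
rewrite /energy (sq2C _ _ (dt u2)) (sq2C _ _ (ds u1)).
rewrite [sq2 M N _](_ : _ = sq2 N M (shear u1 u2)); first by ring.
by rewrite -sq2C; apply: eq_sq2 => i j _ _; rewrite /shear /dt /ds addrC.
Qed.

(** Reflections read a row at places such as [2 * l] or [2 * l + 1]. Such a sum is charged to the
    sum over the whole row: each entry is met at most once, and places beyond the end of the row
    carry zeros. *)
Lemma sum_inj_le K M (s : nat -> nat) f :
  (forall j, 0 <= f j) ->
  (forall l l', (l < M)%N -> (l' < M)%N -> s l = s l' -> l = l') ->
  (forall l, (l < M)%N -> (K <= s l)%N -> f (s l) = 0) ->
  \sum_(l < M) f (s l) <= \sum_(j < K) f j.
Proof.
move=> f0 inj fK.
have -> : \sum_(l < M) f (s l) =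
    \sum_(l < M) \sum_(j < K) (s l == j)%:R * f j.
  apply: eq_bigr => l _; case: (leqP K (s l)) => [le|lt].
    rewrite fK //; apply/esym; rewrite big1 // => j _.
    by rewrite (_ : (s l == j) = false) ?mul0r //; apply/eqP => e; move: (ltn_ord j); rewrite -e ltnNge le.
  rewrite (bigD1 (Ordinal lt)) //= eqxx mul1r big1 ?addr0 // => j ne.
  rewrite (_ : (s l == j) = false) ?mul0r //; apply/eqP => e.
  by move/eqP: ne; apply; apply: val_inj.
rewrite exchange_big /=; apply: ler_sum => j _; rewrite -mulr_suml.
rewrite -[leRHS]mul1r; apply: ler_wpM2r => //.
case: (pickP (fun l : 'I_M => s l == j)) => [l /eqP el|none].
  rewrite (bigD1 l) //= el eqxx big1 ?addr0 // => l' ne.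
  rewrite (_ : (s l' == j) = false) //; apply/eqP => e; move/eqP: ne; apply.
  by apply: val_inj => /=; apply: inj => //; rewrite e.
by rewrite big1 // => l _; rewrite none.
Qed.

Lemma sum_flip M f :
  \sum_(j < M + M) f j = \sum_(l < M) f (M - l.+1)%N + \sum_(j < M) f (M + j)%N.
Proof.
rewrite big_split_ord /=; congr (_ + _).
by rewrite (reindex_inj rev_ord_inj).
Qed.

Section Extension.
Variables (M : nat) (u1 u2 : nat -> nat -> R).
Hypothesis v1 : forall i j, (M <= j.+1)%N -> u1 i j = 0.
Hypothesis v2 : forall i j, (M <= j.+1)%N -> u2 i j = 0.

(* Nitsche's reflection across the edge j = 0, placed at height M. The
   coefficients make every strain component of the extension a combination of
   values of the same strain component of (u1, u2); u2 is sampled on half-shifted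
   nodes, which is why its reflection involves two consecutive nodes. *)
Definition ext1 i J : R :=
  if (M <= J)%N then u1 i (J - M)%N
  else 3 * u1 i (M - J)%N - 2 * u1 i ((M - J).*2)%N.
Definition ext2 i J : R :=
  if (M <= J)%N then u2 i (J - M)%N
  else - 3 * u2 i (M - J).-1 + 2 * u2 i ((M - J).-1.*2)%N + 2 * u2 i ((M - J).-1.*2.+1)%N.

Lemma ext1_up i j : ext1 i (M + j)%N = u1 i j.
Proof. by rewrite /ext1 leq_addr addKn. Qed.
Lemma ext2_up i j : ext2 i (M + j)%N = u2 i j.
Proof. by rewrite /ext2 leq_addr addKn. Qed.

Lemma ext1_dn i l : (l <= M)%N -> ext1 i (M - l)%N = 3 * u1 i l - 2 * u1 i (l.*2)%N.
Proof.
move=> lM; rewrite /ext1; case: ltnP => h.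
  by rewrite (_ : (M - (M - l) = l)%N) //; lia.
have -> : l = 0%N by lia.
by rewrite subn0 subnn double0; ring.
Qed.
Lemma ext2_dn i l : (l < M)%N -> ext2 i (M - l.+1)%N =
  - 3 * u2 i l + 2 * u2 i (l.*2)%N + 2 * u2 i (l.*2.+1)%N.
Proof.
move=> lM; rewrite /ext2 ifF; last by lia.
by rewrite (_ : ((M - (M - l.+1)).-1 = l)%N) //; lia.
Qed.

Lemma ds_up (u e : nat -> nat -> R) i j : (forall i j, e i (M + j)%N = u i j) ->
  ds e i (M + j)%N = ds u i j.
Proof. by move=> h; rewrite /ds !h. Qed.
Lemma dt_up (u e : nat -> nat -> R) i j : (forall i j, e i (M + j)%N = u i j) ->
  dt e i (M + j)%N = dt u i j.
Proof. by move=> h; rewrite /dt -addnS !h. Qed.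

Lemma subSnS l : (l < M)%N -> ((M - l.+1).+1 = M - l)%N. Proof. by lia. Qed.

Lemma ds_ext1 i l : (l < M)%N ->
  ds ext1 i (M - l.+1)%N = 3 * ds u1 i l.+1 - 2 * ds u1 i (l.+1.*2)%N.
Proof. by move=> lM; rewrite /ds !ext1_dn //; ring. Qed.

Lemma shear_ext i l : (l < M)%N ->
  shear ext1 ext2 i (M - l.+1)%N =
  - 3 * shear u1 u2 i l + 2 * shear u1 u2 i (l.*2)%N + 2 * shear u1 u2 i (l.*2.+1)%N.
Proof.
move=> lM; rewrite /shear /dt /ds subSnS // !ext1_dn ?(ltnW lM) // !ext2_dn //.
by rewrite doubleS; ring.
Qed.

Lemma dt_ext2_0 i : (0 < M)%N -> dt ext2 i (M - 1)%N = - 2 * dt u2 i 0.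
Proof.
move=> M0; rewrite /dt subSnS // subn0 -[M in ext2 _ M]addn0 ext2_up ext2_dn // double0; ring.
Qed.

Lemma dt_ext2_S i l : (l.+1 < M)%N -> dt ext2 i (M - l.+2)%N =
  3 * dt u2 i l - 2 * dt u2 i (l.*2)%N - 4 * dt u2 i (l.*2.+1)%N - 2 * dt u2 i (l.*2.+2)%N.
Proof.
move=> lM; rewrite /dt subSnS // !ext2_dn ?(ltnW lM) // doubleS; ring.
Qed.

Lemma ext1_0 i : ext1 i 0 = 0.
Proof.
rewrite /ext1; case: ifP => h; first by rewrite v1 //; lia.
by rewrite !v1 ?mulr0 ?subr0 //; lia.
Qed.
(** The reason why the vanishing is assumed from [M - 1] on, one node early: the half-shifted
    reflection at [J = 0] reads [u2] at [M - 1] and above. *)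
Lemma ext2_0 i : ext2 i 0 = 0.
Proof.
rewrite /ext2; case: ifP => h; first by rewrite v2 //; lia.
by rewrite !v2 ?mulr0 ?addr0 //; lia.
Qed.

Lemma sum_sq_le (x : nat -> R) (s : nat -> nat) M' : (M' <= M)%N ->
  (forall j, (M <= j)%N -> x j = 0) ->
  injective s ->
  \sum_(l < M') x (s l) ^+ 2 <= \sum_(j < M) x j ^+ 2.
Proof.
move=> MM x0 inj; apply: (@sum_inj_le _ _ s (fun j => x j ^+ 2)) => //.
- by move=> j; rewrite sqr_ge0.
- by move=> l l' _ _; exact: inj.
- by move=> l _ h; rewrite x0 // expr0n.
Qed.

Lemma ext_energy_row1 i :
  \sum_(J < M + M) ds ext1 i J ^+ 2 <= 137 * \sum_(j < M) ds u1 i j ^+ 2.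
Proof.
have x0 j : (M <= j)%N -> ds u1 i j = 0 by move=> h; rewrite /ds !v1 ?subr0 //; lia.
rewrite (sum_flip _ (fun J => ds ext1 i J ^+ 2)).
under [X in _ + X]eq_bigr do rewrite (ds_up _ _ ext1_up).
set A := \sum_(j < M) _ ^+ 2; have A0 : 0 <= A by apply: sumr_ge0 => *; exact: sqr_ge0.
have a1 : \sum_(l < M) ds u1 i l.+1 ^+ 2 <= A by apply: (sum_sq_le (s := succn)) => // ? ? [].
have a2 : \sum_(l < M) ds u1 i (l.+1.*2)%N ^+ 2 <= A.
  by apply: (sum_sq_le (s := fun l => l.+1.*2)) => // ? ?; lia.
have : \sum_(l < M) ds ext1 i (M - l.+1)%N ^+ 2 <=
   18 * \sum_(l < M) ds u1 i l.+1 ^+ 2 + 8 * \sum_(l < M) ds u1 i (l.+1.*2)%N ^+ 2.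
  rewrite !mulr_sumr -big_split /=; apply: ler_sum => l _; rewrite ds_ext1 //.
  set x := ds _ _ _; set y := ds _ _ _; have := sqr_ge0 (3 * x + 2 * y); lra.
lra.
Qed.

Lemma ext_energy_row3 i :
  \sum_(J < M + M) shear ext1 ext2 i J ^+ 2 <= 137 * \sum_(j < M) shear u1 u2 i j ^+ 2.
Proof.
have x0 j : (M <= j)%N -> shear u1 u2 i j = 0.
  by move=> h; rewrite /shear /dt /ds !v1 ?v2 ?subr0 ?addr0 //; lia.
rewrite (sum_flip _ (fun J => shear ext1 ext2 i J ^+ 2)).
under [X in _ + X]eq_bigr do rewrite /shear (ds_up _ _ ext2_up) (dt_up _ _ ext1_up) -/(shear _ _ _ _).
set A := \sum_(j < M) _ ^+ 2; have A0 : 0 <= A by apply: sumr_ge0 => *; exact: sqr_ge0.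
have a1 : \sum_(l < M) shear u1 u2 i (l.*2)%N ^+ 2 <= A.
  by apply: (sum_sq_le (s := double)) => // ? ?; lia.
have a2 : \sum_(l < M) shear u1 u2 i (l.*2.+1)%N ^+ 2 <= A.
  by apply: (sum_sq_le (s := fun l => l.*2.+1)) => // ? ?; lia.
have : \sum_(l < M) shear ext1 ext2 i (M - l.+1)%N ^+ 2 <=
   27 * \sum_(l < M) shear u1 u2 i l ^+ 2 + 12 * \sum_(l < M) shear u1 u2 i (l.*2)%N ^+ 2
   + 12 * \sum_(l < M) shear u1 u2 i (l.*2.+1)%N ^+ 2.
  rewrite !mulr_sumr -!big_split /=; apply: ler_sum => l _; rewrite shear_ext //.
  set x := shear _ _ _ _; set y := shear _ _ _ _; set z := shear _ _ _ _.
  have := sqr_ge0 (3 * x + 2 * y); have := sqr_ge0 (3 * x + 2 * z).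
  have := sqr_ge0 (y - z); lra.
rewrite -/A; lra.
Qed.

(** This component fixes the constant 137: the coefficients 3, 2, 4, 2 of the reflected difference
    give [36 + 16 + 64 + 16], the difference across the edge gives 4, and the unreflected half gives
    1. *)
Lemma ext_energy_row2 i :
  \sum_(J < M + M) dt ext2 i J ^+ 2 <= 137 * \sum_(j < M) dt u2 i j ^+ 2.
Proof.
have x0 j : (M <= j)%N -> dt u2 i j = 0 by move=> h; rewrite /dt !v2 ?subr0 //; lia.
rewrite (sum_flip _ (fun J => dt ext2 i J ^+ 2)).
under [X in _ + X]eq_bigr do rewrite (dt_up _ _ ext2_up).
set A := \sum_(j < M) _ ^+ 2; have A0 : 0 <= A by apply: sumr_ge0 => *; exact: sqr_ge0.
suff : \sum_(l < M) dt ext2 i (M - l.+1)%N ^+ 2 <= 136 * A by lra.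
(* The length of the sum is decoupled from the reflection height [M], so that the term at the edge
   can be split off. *)
suff H M' : M = M' -> \sum_(l < M') dt ext2 i (M - l.+1)%N ^+ 2 <= 136 * A by exact: H.
case: M' => [|m] EM; first by rewrite big_ord0 mulr_ge0.
have mM : (m <= M)%N by lia.
rewrite big_ord_recl /= dt_ext2_0; last by rewrite EM.
have a0 : dt u2 i 0 ^+ 2 <= A.
  have := @sum_sq_le (fun j => dt u2 i j) id 1 _ x0 (fun _ _ e => e).
  by rewrite big_ord1; apply; rewrite EM.
have a1 : \sum_(l < m) dt u2 i l ^+ 2 <= A by apply: (sum_sq_le (s := id)).
have a2 : \sum_(l < m) dt u2 i (l.*2)%N ^+ 2 <= A.
  by apply: (sum_sq_le (s := double)) => // ? ?; lia.
have a3 : \sum_(l < m) dt u2 i (l.*2.+1)%N ^+ 2 <= A.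
  by apply: (sum_sq_le (s := fun l => l.*2.+1)) => // ? ?; lia.
have a4 : \sum_(l < m) dt u2 i (l.*2.+2)%N ^+ 2 <= A.
  by apply: (sum_sq_le (s := fun l => l.*2.+2)) => // ? ?; lia.
have : \sum_(l < m) dt ext2 i (M - (bump 0 l).+1)%N ^+ 2 <=
   36 * \sum_(l < m) dt u2 i l ^+ 2 + 16 * \sum_(l < m) dt u2 i (l.*2)%N ^+ 2
   + 64 * \sum_(l < m) dt u2 i (l.*2.+1)%N ^+ 2 + 16 * \sum_(l < m) dt u2 i (l.*2.+2)%N ^+ 2.
  rewrite !mulr_sumr -!big_split /=; apply: ler_sum => l _.
  rewrite /bump leq0n add1n dt_ext2_S; last by rewrite EM ltnS.
  set x := dt _ _ _; set y := dt _ _ _; set z := dt _ _ _; set t := dt _ _ _.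
  have := sqr_ge0 (3 * x + 2 * y); have := sqr_ge0 (3 * x + 4 * z).
  have := sqr_ge0 (3 * x + 2 * t).
  have := sqr_ge0 (2 * y - 4 * z); have := sqr_ge0 (2 * y - 2 * t); have := sqr_ge0 (4 * z - 2 * t); lra.
lra.
Qed.

Lemma ext_energy K : energy K (M + M) ext1 ext2 <= 137 * energy K M u1 u2.
Proof.
rewrite /energy !mulrDr /sq2 !mulr_sumr; do !apply: lerD; apply: ler_sum => i _.
- exact: ext_energy_row1.
- exact: ext_energy_row2.
- exact: ext_energy_row3.
Qed.

End Extension.

Lemma sum_shift M f : f M = f 0 -> \sum_(i < M) f i.+1 = \sum_(i < M) f i.
Proof.
move=> e; apply: (addrI (f 0)); rewrite -(big_ord_recl M (fun i => f i)).
by rewrite big_ord_recr /= e addrC.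
Qed.

(* Summing by parts twice turns [dt u1 * ds u2] into [ds u1 * dt u2]. *)
Lemma korn_zero_boundary M u1 u2 :
  (forall j, u1 0%N j = 0 /\ u1 M j = 0 /\ u2 0%N j = 0 /\ u2 M j = 0) ->
  (forall i, u1 i 0%N = 0 /\ u1 i M = 0 /\ u2 i 0%N = 0 /\ u2 i M = 0) ->
  sq2 M M (dt u1) <= energy M M u1 u2.
Proof.
move=> hi hj.
pose S F := \sum_(i < M) \sum_(j < M) F i j.
have shi F : (forall j, F M j = F 0%N j) -> S (fun i j => F i.+1 j) = S F.
  move=> e; rewrite /S exchange_big [RHS]exchange_big /=.
  by apply: eq_bigr => j _; rewrite (sum_shift (f := fun i => F i j)).
have shj F : (forall i, F i M = F i 0%N) -> S (fun i j => F i j.+1) = S F.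
  by move=> e; apply: eq_bigr => i _; rewrite (sum_shift (f := fun j => F i j)).
have SD F G : S (fun i j => F i j + G i j) = S F + S G.
  by rewrite /S -big_split; apply: eq_bigr => i _; rewrite -big_split.
have SZ a F : S (fun i j => a * F i j) = a * S F.
  by rewrite /S mulr_sumr; apply: eq_bigr => i _; rewrite mulr_sumr.
have eS F G : (forall i j, F i j = G i j) -> S F = S G.
  by move=> e; apply: eq_bigr => i _; apply: eq_bigr => j _.
(* Both products of differences expand into the corner products [A], [B], [C], [D], at indices that
   differ by shifts; the vanishing boundary values make the sums insensitive to these shifts. *)
have cross : S (fun i j => ds u2 i j * dt u1 i j) =
    S (fun i j => dt u2 i.+1 j * ds u1 i j.+1).
  pose A i j := u2 i j * u1 i j.
  pose B i j := u2 i.+1 j * u1 i j.+1.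
  pose C i j := u2 i.+1 j * u1 i j.
  pose D i j := u2 i j * u1 i j.+1.
  rewrite (eS _ (fun i j => (B i j + A i j) + -1 * (C i j + D i j))); last first.
    by move=> i j; rewrite /ds /dt /A /B /C /D; ring.
  rewrite [RHS](eS _ (fun i j => (B i j + A i.+1 j.+1) + -1 * (C i j.+1 + D i.+1 j))); last first.
    by move=> i j; rewrite /ds /dt /A /B /C /D; ring.
  rewrite !SD !SZ !SD.
  rewrite (shi (fun i j => A i j.+1)); last first.
    by move=> j; rewrite /A; case: (hi j.+1) => -> [-> _]; rewrite !mulr0.
  rewrite (shj A); last by move=> i; rewrite /A; case: (hj i) => -> [-> _]; rewrite !mulr0.
  rewrite (shj C); last by move=> i; rewrite /C; case: (hj i) => -> [-> _]; rewrite !mulr0.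
  rewrite (shi D) //.
  by move=> j; rewrite /D; case: (hi j.+1) => -> [-> _]; rewrite !mulr0.
have e1 : sq2 M M (ds u1) = S (fun i j => ds u1 i j.+1 ^+ 2).
  apply/esym/(shj (fun i j => ds u1 i j ^+ 2)) => i; rewrite /ds.
  by case: (hj i) => -> [-> _]; case: (hj i.+1) => -> [-> _].
have e2 : sq2 M M (dt u2) = S (fun i j => dt u2 i.+1 j ^+ 2).
  apply/esym/(shi (fun i j => dt u2 i j ^+ 2)) => j; rewrite /dt.
  by case: (hi j) => _ [_ [-> ->]]; case: (hi j.+1) => _ [_ [-> ->]].
have e3 : sq2 M M (shear u1 u2) =
    sq2 M M (dt u1) + (S (fun i j => ds u2 i j ^+ 2)
     + 2 * S (fun i j => ds u2 i j * dt u1 i j)).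
  have sqS F : sq2 M M F = S (fun i j => F i j ^+ 2) by [].
  by rewrite !sqS -SZ -!SD; apply: eS => i j; rewrite /shear; ring.
have S0 F : (forall i j, 0 <= F i j) -> 0 <= S F.
  by move=> h; apply: sumr_ge0 => i _; apply: sumr_ge0.
(* After the summation by parts, the energy exceeds [sq2 M M (dt u1)] by exactly this square plus
   the sum of [ds u2 i j ^+ 2]. *)
have p1 : 0 <= S (fun i j => (dt u2 i.+1 j + ds u1 i j.+1) ^+ 2).
  by apply: S0 => *; exact: sqr_ge0.
have p2 : 0 <= S (fun i j => ds u2 i j ^+ 2) by apply: S0 => *; exact: sqr_ge0.
rewrite (eS _ (fun i j => dt u2 i.+1 j ^+ 2 + (ds u1 i j.+1 ^+ 2
    + 2 * (dt u2 i.+1 j * ds u1 i j.+1)))) in p1; last by move=> i j; ring.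
rewrite SD SD SZ in p1.
rewrite /energy e1 e2 e3 cross; lra.
Qed.
End DiscreteKorn.

(** * Korn's inequality near a corner, by reflection and cutoff *)

Section DiscreteKornSquare.
Variable R : realFieldType.
Implicit Types (f g : nat -> R) (u w F G H : nat -> nat -> R).

Lemma ext1_row0 M u i J : (forall j, u i j = 0) -> ext1 M u i J = 0.
Proof. by move=> h; rewrite /ext1; case: ifP; rewrite !h // !mulr0 subr0. Qed.
Lemma ext2_row0 M u i J : (forall j, u i j = 0) -> ext2 M u i J = 0.
Proof. by move=> h; rewrite /ext2; case: ifP; rewrite !h // !mulr0 !addr0. Qed.

Lemma sq2_corner M F G : (forall i j, F (M + i)%N (M + j)%N = G i j) ->
  sq2 M M G <= sq2 (M + M) (M + M) F.
Proof.
move=> e; rewrite /sq2 big_split_ord /= addrC -[leLHS]addr0; apply: lerD.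
  apply: ler_sum => i _; rewrite big_split_ord /= addrC -[leLHS]addr0; apply: lerD.
    by apply: ler_sum => j _; rewrite e.
  by apply: sumr_ge0 => *; exact: sqr_ge0.
by do 2 (apply: sumr_ge0 => ? _); exact: sqr_ge0.
Qed.

(** Reflection across [j = 0] and then, with coordinates and components exchanged, across [i = 0]
    yields a field on the doubled square that vanishes on all four edges. Each reflection costs a
    factor 137. *)
Lemma korn_quarter M u1 u2 :
  (forall i j, (M <= i.+1)%N -> u1 i j = 0 /\ u2 i j = 0) ->
  (forall i j, (M <= j.+1)%N -> u1 i j = 0 /\ u2 i j = 0) ->
  sq2 M M (dt u1) <= 137 * (137 * energy M M u1 u2).
Proof.
move=> hi hj.
pose W1 := ext1 M u1; pose W2 := ext2 M u2.
have j1 i j : (M <= j.+1)%N -> u1 i j = 0 by move=> h; case: (hj i j h).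
have j2 i j : (M <= j.+1)%N -> u2 i j = 0 by move=> h; case: (hj i j h).
have W1i i j : (M <= i.+1)%N -> W1 i j = 0.
  by move=> h; apply: ext1_row0 => j'; case: (hi i j' h).
have W2i i j : (M <= i.+1)%N -> W2 i j = 0.
  by move=> h; apply: ext2_row0 => j'; case: (hi i j' h).
pose A1 i j := W2 j i; pose A2 i j := W1 j i.
have a1 i j : (M <= j.+1)%N -> A1 i j = 0 by exact: W2i.
have a2 i j : (M <= j.+1)%N -> A2 i j = 0 by exact: W1i.
pose Z1 := ext1 M A1; pose Z2 := ext2 M A2.
pose B1 i j := Z2 j i; pose B2 i j := Z1 j i.
have eW := ext_energy j1 j2 M.
have eZ := ext_energy a1 a2 (M + M).
have eA : energy (M + M) M A1 A2 = energy M (M + M) W1 W2 := energyC _ _ _ _.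
have eB : energy (M + M) (M + M) B1 B2 = energy (M + M) (M + M) Z1 Z2 := energyC _ _ _ _.
have M1 : (M <= M.+1)%N by [].
have W1MM i : W1 i (M + M)%N = 0 by rewrite /W1 ext1_up j1.
have W2MM i : W2 i (M + M)%N = 0 by rewrite /W2 ext2_up j2.
have k : sq2 (M + M) (M + M) (dt B1) <= energy (M + M) (M + M) B1 B2.
  apply: korn_zero_boundary => [j|i]; rewrite /B1 /B2 /Z1 /Z2.
    by rewrite (ext1_0 a1) (ext2_0 a2) ext1_up ext2_up a1 // a2.
  split; first by apply: ext2_row0 => j; exact: (ext1_0 j1).
  split; first by apply: ext2_row0 => j; exact: W1MM.
  split; first by apply: ext1_row0 => j; exact: (ext2_0 j2).
  by apply: ext1_row0 => j; exact: W2MM.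
have c : sq2 M M (dt u1) <= sq2 (M + M) (M + M) (dt B1).
  by apply: sq2_corner => i j; rewrite /dt /B1 /Z2 -addnS !ext2_up /A2 /W1 !ext1_up.
apply: (le_trans c); apply: (le_trans k); rewrite eB; apply: (le_trans eZ).
by rewrite eA ler_pM2l.
Qed.

(* Truncated subtraction makes this vanish from [2n - 1] on. *)
Definition cutoff n i : R := if (i <= n)%N then 1 else (2 * n - 1 - i)%:R / n%:R.

Lemma cutoff_bound n i : (0 < n)%N -> 0 <= cutoff n i <= 1.
Proof.
move=> n0; rewrite /cutoff; case: leqP => h; first by rewrite ler01 lexx.
have n0' : 0 < n%:R :> R by rewrite ltr0n.
by rewrite divr_ge0 ?ler0n //= ler_pdivrMr // mul1r ler_nat; lia.
Qed.

(** The slope is at most [1 / n] except at the kink [i = n], where the value falls from 1 to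
    [(n - 2) / n] for [n >= 2]; hence the 4. *)
Lemma cutoff_step n i : (0 < n)%N -> (cutoff n i.+1 - cutoff n i) ^+ 2 <= 4 / n%:R ^+ 2.
Proof.
move=> n0; have n0' : 0 < n%:R :> R by rewrite ltr0n.
suff h : exists a : R, -2 <= a <= 2 /\ cutoff n i.+1 - cutoff n i = a / n%:R.
  case: h => a [ha ->]; rewrite expr_div_n ler_pM2r ?invr_gt0 ?exprn_gt0 //.
  have : 0 <= (2 - a) * (2 + a) by apply: mulr_ge0; lra.
  lra.
have nn : n%:R / n%:R = 1 :> R by rewrite divff // gt_eqF.
rewrite /cutoff; case: (ltngtP i n) => h.
- by exists 0; rewrite subrr mul0r; split => //; lra.
- rewrite -mulrBl; eexists; split; last reflexivity.
  case: (leqP (2 * n - 1) i) => h'.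
    rewrite (_ : (2 * n - 1 - i.+1 = 0)%N); last by lia.
    rewrite (_ : (2 * n - 1 - i = 0)%N); last by lia.
    by lra.
  rewrite (_ : (2 * n - 1 - i = (2 * n - 1 - i.+1).+1)%N); last by lia.
  by rewrite -natr1; lra.
- rewrite -[X in _ - X]nn -mulrBl; eexists; split; last reflexivity.
  rewrite h; case: n n0 {n0' nn h} => // -[|n] _; first by rewrite /= (_ : (2 * 1 - 1 - 2 = 0)%N) //; lra.
  rewrite (_ : (2 * n.+2 - 1 - n.+3 = n)%N); last by lia.
  by rewrite -2!natr1; lra.
Qed.

Definition mass L u1 u2 : R := sq2 L L u1 + sq2 L L u2.

Lemma sq2_sub M N M' N' F : (M <= M')%N -> (N <= N')%N -> sq2 M N F <= sq2 M' N' F.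
Proof.
move=> hM hN; rewrite /sq2.
have sub K K' (f : nat -> R) : (K <= K')%N -> (forall i, 0 <= f i) ->
    \sum_(i < K) f i <= \sum_(i < K') f i.
  move=> h f0; apply: (@sum_inj_le _ _ _ id) => // l lK h'; exfalso; lia.
apply: (@le_trans _ _ (\sum_(i < M') \sum_(j < N) F i j ^+ 2)).
  by apply: (sub _ _ (fun i => \sum_(j < N) F i j ^+ 2)) => // i; apply: sumr_ge0 => *; exact: sqr_ge0.
by apply: ler_sum => i _; apply: (sub _ _ (fun j => F i j ^+ 2)) => // j; exact: sqr_ge0.
Qed.

Lemma sq2_shift M N F a b : sq2 M N (fun i j => F (i + a)%N (j + b)%N) <= sq2 (M + a) (N + b) F.
Proof.
rewrite /sq2; have sub K c (f : nat -> R) : (forall i, 0 <= f i) ->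
    \sum_(i < K) f (i + c)%N <= \sum_(i < K + c) f i.
  by move=> f0; apply: (@sum_inj_le _ _ _ (fun i => i + c)%N) => // l l'; lia.
apply: (@le_trans _ _ (\sum_(i < M + a) \sum_(j < N) F i (j + b)%N ^+ 2)).
  by apply: (sub _ _ (fun i => \sum_(j < N) F i (j + b)%N ^+ 2)) => // i; apply: sumr_ge0 => *; exact: sqr_ge0.
by apply: ler_sum => i _; apply: (sub _ _ (fun j => F i j ^+ 2)) => // j; exact: sqr_ge0.
Qed.

Definition chi n i j := cutoff n i * cutoff n j.

(** Multiplication by [chi], which is 1 on the inner square, creates the zero values at the two far
    edges. The commutator terms carry a squared difference of [chi], at most [4 / n ^ 2], and are
    paid by the mass. *)
Lemma korn_quadrant n u1 u2 : (1 < n)%N ->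
  sq2 n n (dt u1) <= 137 * (137 *
    (6 * energy (2 * n - 1) (2 * n - 1) u1 u2 + 48 / n%:R ^+ 2 * mass (2 * n) u1 u2)).
Proof.
move=> n1; have n0 := ltnW n1; have n0' : 0 < n%:R :> R by rewrite ltr0n.
pose w1 i j := chi n i j * u1 i j; pose w2 i j := chi n i j * u2 i j.
have cut0 i : (2 * n <= i.+1)%N -> cutoff n i = 0.
  move=> h; rewrite /cutoff ifF; last by lia.
  by rewrite (_ : (2 * n - 1 - i = 0)%N) ?mul0r //; lia.
have kq : sq2 (2 * n) (2 * n) (dt w1) <= 137 * (137 * energy (2 * n) (2 * n) w1 w2).
  by apply: korn_quarter => i j h; rewrite /w1 /w2 /chi (cut0 _ h) ?mulr0 !mul0r.
have low : sq2 n n (dt u1) <= sq2 (2 * n) (2 * n) (dt w1).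
  rewrite (@eq_sq2 _ _ _ _ (dt w1)); first by apply: sq2_sub; lia.
  move=> i j hi hj; rewrite /dt /w1 /chi /cutoff.
  by rewrite (ltnW hi) (ltnW hj) hj !mul1r.
apply: (le_trans low); apply: (le_trans kq); rewrite !ler_pM2l //.
have chi_b i j : chi n i j ^+ 2 <= 1.
  rewrite /chi exprMn; have /andP[a1 a2] := cutoff_bound i n0; have /andP[b1 b2] := cutoff_bound j n0.
  by rewrite -[leRHS]mulr1; apply: ler_pM; rewrite ?sqr_ge0 // expr_le1.
have dchi1 i j : (chi n i.+1 j - chi n i j) ^+ 2 <= 4 / n%:R ^+ 2.
  rewrite /chi -mulrBl exprMn -[leRHS]mulr1; have /andP[b1 b2] := cutoff_bound j n0.
  by apply: ler_pM; rewrite ?sqr_ge0 ?cutoff_step // expr_le1.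
have dchi2 i j : (chi n i j.+1 - chi n i j) ^+ 2 <= 4 / n%:R ^+ 2.
  rewrite /chi -mulrBr exprMn -[leRHS]mul1r; have /andP[b1 b2] := cutoff_bound i n0.
  by apply: ler_pM; rewrite ?sqr_ge0 ?cutoff_step // expr_le1.
set q := 4 / n%:R ^+ 2 in dchi1 dchi2.
have q0 : 0 <= q by rewrite divr_ge0 // sqr_ge0.
have -> : 48 / n%:R ^+ 2 = 12 * q by rewrite /q mulrA -natrM.
(* The cut-off differences vanish on the last row and column, so the energy is needed only up to
   [2 * n - 1]. This keeps the indices [2 * n - 2 - i] of the reflected versions within range. *)
have drop F : (forall i j, (2 * n <= i.+1)%N || (2 * n <= j.+1)%N -> F i j = 0) ->
    sq2 (2 * n) (2 * n) F = sq2 (2 * n - 1) (2 * n - 1) F.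
  move=> h; case: n n0 h {n1 n0' w1 w2 cut0 kq low chi_b dchi1 dchi2 q q0} => // m _ h.
  rewrite (_ : (2 * m.+1 = (2 * m.+1 - 1).+1)%N); last by lia.
  rewrite subSS subn0 /sq2 big_ord_recr /= [X in _ + X]big1 ?addr0; last first.
    by move=> j _; rewrite h ?expr0n //; apply/orP; left; lia.
  apply: eq_bigr => i _; rewrite big_ord_recr /= h ?expr0n ?addr0 //; apply/orP; right; lia.
have chi0 i j : (2 * n <= i.+1)%N || (2 * n <= j.+1)%N -> chi n i j = 0.
  by case/orP => h; rewrite /chi (cut0 _ h) ?mulr0 ?mul0r.
have chi3 i j : (2 * n <= i.+1)%N || (2 * n <= j.+1)%N ->
    [/\ chi n i j = 0, chi n i.+1 j = 0 & chi n i j.+1 = 0].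
  by case/orP => h; split; apply: chi0; rewrite ?h ?(leqW h) ?orbT.
have bound (x y z a b c : R) : a ^+ 2 <= 1 -> b ^+ 2 <= q -> c ^+ 2 <= q ->
    (a * x + b * y + c * z) ^+ 2 <= 3 * x ^+ 2 + (3 * q) * y ^+ 2 + (3 * q) * z ^+ 2.
  move=> ha hb hc.
  have : (a * x + b * y + c * z) ^+ 2 <= 3 * (a * x) ^+ 2 + 3 * (b * y) ^+ 2 + 3 * (c * z) ^+ 2.
    have := sqr_ge0 (a * x - b * y); have := sqr_ge0 (a * x - c * z); have := sqr_ge0 (b * y - c * z); lra.
  rewrite !exprMn.
  have := ler_wpM2r (sqr_ge0 x) ha; have := ler_wpM2r (sqr_ge0 y) hb; have := ler_wpM2r (sqr_ge0 z) hc.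
  lra.
have L1 : (2 * n - 1 <= 2 * n)%N by lia.
have L2 : (2 * n - 1 + 1 <= 2 * n)%N by lia.
have L3 : (2 * n - 1 + 0 <= 2 * n)%N by lia.
have m1 := sq2_sub u1 L1 L1.
have m2 := sq2_sub u2 L1 L1.
have m3 : sq2 (2 * n - 1) (2 * n - 1) (fun i j => u1 i j.+1) <= sq2 (2 * n) (2 * n) u1.
  apply: le_trans (sq2_sub u1 L3 L2); apply: le_trans (sq2_shift _ _ _ 0 1).
  by rewrite (@eq_sq2 _ _ _ _ (fun i j => u1 (i + 0)%N (j + 1)%N)) // => i j _ _; rewrite addn0 addn1.
have m4 : sq2 (2 * n - 1) (2 * n - 1) (fun i j => u2 i.+1 j) <= sq2 (2 * n) (2 * n) u2.
  apply: le_trans (sq2_sub u2 L2 L3); apply: le_trans (sq2_shift _ _ _ 1 0).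
  by rewrite (@eq_sq2 _ _ _ _ (fun i j => u2 (i + 1)%N (j + 0)%N)) // => i j _ _; rewrite addn0 addn1.
have e1 : sq2 (2 * n) (2 * n) (ds w1) <= 3 * sq2 (2 * n - 1) (2 * n - 1) (ds u1)
    + (3 * q) * sq2 (2 * n - 1) (2 * n - 1) u1 + (3 * q) * sq2 (2 * n - 1) (2 * n - 1) u1.
  rewrite drop; last by move=> i j /chi3[h1 h2 h3]; rewrite /ds /w1 h1 h2 !mul0r subr0.
  apply: sq2_le3 => i j _ _.
  have -> : ds w1 i j = chi n i.+1 j * ds u1 i j + (chi n i.+1 j - chi n i j) * u1 i j + 0 * u1 i j.
    by rewrite /ds /w1; ring.
  by apply: bound => //; rewrite expr0n.
have e2 : sq2 (2 * n) (2 * n) (dt w2) <= 3 * sq2 (2 * n - 1) (2 * n - 1) (dt u2)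
    + (3 * q) * sq2 (2 * n - 1) (2 * n - 1) u2 + (3 * q) * sq2 (2 * n - 1) (2 * n - 1) u2.
  rewrite drop; last by move=> i j /chi3[h1 h2 h3]; rewrite /dt /w2 h1 h3 !mul0r subr0.
  apply: sq2_le3 => i j _ _.
  have -> : dt w2 i j = chi n i j.+1 * dt u2 i j + (chi n i j.+1 - chi n i j) * u2 i j + 0 * u2 i j.
    by rewrite /dt /w2; ring.
  by apply: bound => //; rewrite expr0n.
have e3 : sq2 (2 * n) (2 * n) (shear w1 w2) <= 3 * sq2 (2 * n - 1) (2 * n - 1) (shear u1 u2)
    + (3 * q) * sq2 (2 * n - 1) (2 * n - 1) (fun i j => u1 i j.+1)
    + (3 * q) * sq2 (2 * n - 1) (2 * n - 1) (fun i j => u2 i.+1 j).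
  rewrite drop; last by move=> i j /chi3[h1 h2 h3]; rewrite /shear /dt /ds /w1 /w2 h1 h2 h3 !mul0r !subr0 addr0.
  apply: sq2_le3 => i j _ _.
  have -> : shear w1 w2 i j = chi n i j * shear u1 u2 i j
     + (chi n i j.+1 - chi n i j) * u1 i j.+1 + (chi n i.+1 j - chi n i j) * u2 i.+1 j.
    by rewrite /shear /dt /ds /w1 /w2; ring.
  exact: bound.
have qM x y : x <= y -> q * x <= q * y by move=> h; apply: ler_wpM2l.
have := qM _ _ m1; have := qM _ _ m2; have := qM _ _ m3; have := qM _ _ m4.
have := sq2_ge0 (2 * n - 1) (2 * n - 1) (ds u1).
have := sq2_ge0 (2 * n - 1) (2 * n - 1) (dt u2).
have := sq2_ge0 (2 * n - 1) (2 * n - 1) (shear u1 u2).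
have := mulr_ge0 q0 (sq2_ge0 (2 * n) (2 * n) u1).
have := mulr_ge0 q0 (sq2_ge0 (2 * n) (2 * n) u2).
rewrite /energy /mass; lra.
Qed.
End DiscreteKornSquare.

(** * Korn's inequality modulo rigid motions, and Poincare's inequality, on a grid *)

Section DiscreteKornMain.
Variable R : realFieldType.
Implicit Types (f g x y z p q : nat -> R) (u w F G H : nat -> nat -> R).

Lemma sq2_reindex_le M M' F (s s' : nat -> nat) :
  (forall i, (i < M)%N -> (s i < M')%N /\ (s' i < M')%N) ->
  (forall i i', (i < M)%N -> (i' < M)%N -> s i = s i' -> i = i') ->
  (forall i i', (i < M)%N -> (i' < M)%N -> s' i = s' i' -> i = i') ->
  sq2 M M (fun i j => F (s i) (s' j)) <= sq2 M' M' F.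
Proof.
move=> h inj inj'; apply: (@le_trans _ _ (\sum_(i < M') \sum_(j < M) F i (s' j) ^+ 2)).
  apply: (@sum_inj_le _ _ _ s (fun i => \sum_(j < M) F i (s' j) ^+ 2)) => // [i|l lM].
    by apply: sumr_ge0 => *; exact: sqr_ge0.
  by case: (h l lM) => a _; rewrite leqNgt a.
apply: ler_sum => i _; apply: (@sum_inj_le _ _ _ s' (fun j => F i j ^+ 2)) => // [j|l lM].
  exact: sqr_ge0.
by case: (h l lM) => _ a; rewrite leqNgt a.
Qed.

(** The other corners follow by reflecting coordinates. A component that points along the reflected
    coordinate changes sign and is read at [2 * n - 1 - i], the other one at [2 * n - i]: with this
    offset forward differences go to forward differences, and both terms of the shear land on the
    same cell with the same sign. *)
Lemma korn_quadrant_reflected n u1 u2 (b c : bool) : (1 < n)%N ->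
  sq2 n n (fun i j => dt u1 (if b then 2 * n - 1 - i else i)%N (if c then 2 * n - 1 - j else j)%N)
  <= 137 * (137 * (6 * energy (2 * n + 1) (2 * n + 1) u1 u2
       + 48 / n%:R ^+ 2 * mass (2 * n + 1) u1 u2)).
Proof.
move=> n1; have n0' : 0 < n%:R :> R by rewrite ltr0n ltnW.
pose r (b : bool) i := (if b then 2 * n - 1 - i else i)%N.
pose r1 (b : bool) i := (if b then 2 * n - i else i)%N.
pose r2 (b : bool) i := (if b then 2 * n - 2 - i else i)%N.
pose w1 i j := (-1) ^+ b * u1 (r b i) (r1 c j).
pose w2 i j := (-1) ^+ c * u2 (r1 b i) (r c j).
have rS a i : (i < 2 * n - 1)%N ->
    if a then r a i = (r2 a i).+1 /\ r a i.+1 = r2 a i else r a i = r2 a i /\ r a i.+1 = (r2 a i).+1.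
  by rewrite /r /r2; case: a => h; split => //; lia.
have r1S a i : (i < 2 * n - 1)%N ->
    if a then r1 a i = (r a i).+1 /\ r1 a i.+1 = r a i else r1 a i = r a i /\ r1 a i.+1 = (r a i).+1.
  by rewrite /r /r1; case: a => h; split => //; lia.
have sgn (a : bool) (X : R) : ((-1) ^+ a * X) ^+ 2 = X ^+ 2 by rewrite exprMn sqrr_sign mul1r.
have hds i j : (i < 2 * n - 1)%N -> (j < 2 * n - 1)%N -> ds w1 i j = ds u1 (r2 b i) (r1 c j).
  move=> hi hj; rewrite /ds /w1; have := rS b i hi; case: (b) => -[-> ->]; rewrite ?expr1 ?expr0; ring.
have hdt i j : (i < 2 * n - 1)%N -> (j < 2 * n - 1)%N -> dt w2 i j = dt u2 (r1 b i) (r2 c j).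
  move=> hi hj; rewrite /dt /w2; have := rS c j hj; case: (c) => -[-> ->]; rewrite ?expr1 ?expr0; ring.
have hdt1 i j : (i < 2 * n - 1)%N -> (j < 2 * n - 1)%N ->
    dt w1 i j = (-1) ^+ b * ((-1) ^+ c * dt u1 (r b i) (r c j)).
  move=> hi hj; rewrite /dt /w1; have := r1S c j hj; case: (c) => -[-> ->]; rewrite ?expr1 ?expr0; ring.
have hds2 i j : (i < 2 * n - 1)%N -> (j < 2 * n - 1)%N ->
    ds w2 i j = (-1) ^+ b * ((-1) ^+ c * ds u2 (r b i) (r c j)).
  move=> hi hj; rewrite /ds /w2; have := r1S b i hi; case: (b) => -[-> ->]; rewrite ?expr1 ?expr0; ring.
have := korn_quadrant w1 w2 n1.
rewrite [leLHS](_ : _ = sq2 n n (fun i j => dt u1 (r b i) (r c j))); last first.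
  apply: eq_bigr => i _; apply: eq_bigr => j _; rewrite hdt1 ?sgn //.
    by have := ltn_ord i; lia.
  by have := ltn_ord j; lia.
move=> k; apply: (le_trans k); rewrite !ler_pM2l //.
have rng b' i : (i < 2 * n - 1)%N -> [/\ (r b' i < 2 * n + 1)%N, (r1 b' i < 2 * n + 1)%N & (r2 b' i < 2 * n + 1)%N].
  by rewrite /r /r1 /r2; case: b' => h; split; lia.
have rng' b' i : (i < 2 * n)%N -> (r b' i < 2 * n + 1)%N /\ (r1 b' i < 2 * n + 1)%N.
  by rewrite /r /r1; case: b' => h; split; lia.
apply: lerD.
  rewrite ler_pM2l //; apply: lerD; first apply: lerD.
  - rewrite (eq_sq2 hds); apply: sq2_reindex_le.
    + by move=> i hi; case: (rng b i hi); case: (rng c i hi).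
    + by move=> i i'; rewrite /r2; case: (b) => //; lia.
    + by move=> i i'; rewrite /r1; case: (c) => //; lia.
  - rewrite (eq_sq2 hdt); apply: sq2_reindex_le.
    + by move=> i hi; case: (rng b i hi); case: (rng c i hi).
    + by move=> i i'; rewrite /r1; case: (b) => //; lia.
    + by move=> i i'; rewrite /r2; case: (c) => //; lia.
  - rewrite [leLHS](_ : _ = sq2 (2 * n - 1) (2 * n - 1) (fun i j => shear u1 u2 (r b i) (r c j))).
      apply: sq2_reindex_le.
      + by move=> i hi; case: (rng b i hi); case: (rng c i hi).
      + by move=> i i'; rewrite /r; case: (b) => //; lia.
      + by move=> i i'; rewrite /r; case: (c) => //; lia.
    apply: eq_bigr => i _; apply: eq_bigr => j _; rewrite {1}/shear hdt1 // hds2 //.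
    by rewrite -!mulrDr !sgn.
apply: ler_wpM2l; first by rewrite divr_ge0 // sqr_ge0.
apply: lerD.
  rewrite [leLHS](_ : _ = sq2 (2 * n) (2 * n) (fun i j => u1 (r b i) (r1 c j))).
    apply: sq2_reindex_le.
    + by move=> i hi; case: (rng' b i hi); case: (rng' c i hi).
    + by move=> i i'; rewrite /r; case: (b) => //; lia.
    + by move=> i i'; rewrite /r1; case: (c) => //; lia.
  by apply: eq_bigr => i _; apply: eq_bigr => j _; rewrite sgn.
rewrite [leLHS](_ : _ = sq2 (2 * n) (2 * n) (fun i j => u2 (r1 b i) (r c j))).
  apply: sq2_reindex_le.
  + by move=> i hi; case: (rng' b i hi); case: (rng' c i hi).
  + by move=> i i'; rewrite /r1; case: (b) => //; lia.
  + by move=> i i'; rewrite /r; case: (c) => //; lia.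
by apply: eq_bigr => i _; apply: eq_bigr => j _; rewrite sgn.
Qed.

Lemma sum_fold n f :
  \sum_(i < 2 * n) f i = \sum_(i < n) f i + \sum_(i < n) f (2 * n - 1 - i)%N.
Proof.
rewrite mul2n -addnn big_split_ord /=; congr (_ + _).
rewrite (reindex_inj rev_ord_inj) /=; apply: eq_bigr => i _; congr f.
by have := ltn_ord i; lia.
Qed.

(** Korn's second inequality: the square is covered by four quadrants, each read from its own
    corner. *)
Lemma korn_second n u1 u2 : (1 < n)%N ->
  sq2 (2 * n) (2 * n) (dt u1) <= 4 * (137 * (137 * (6 * energy (2 * n + 1) (2 * n + 1) u1 u2
       + 48 / n%:R ^+ 2 * mass (2 * n + 1) u1 u2))).
Proof.
move=> n1; set B := 137 * _.
have := korn_quadrant_reflected u1 u2 false false n1.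
have := korn_quadrant_reflected u1 u2 false true n1.
have := korn_quadrant_reflected u1 u2 true false n1.
have := korn_quadrant_reflected u1 u2 true true n1.
rewrite -/B => h1 h2 h3 h4.
have -> : sq2 (2 * n) (2 * n) (dt u1) =
    sq2 n n (fun i j => dt u1 i j) + sq2 n n (fun i j => dt u1 i (2 * n - 1 - j)%N) +
    (sq2 n n (fun i j => dt u1 (2 * n - 1 - i)%N j) +
     sq2 n n (fun i j => dt u1 (2 * n - 1 - i)%N (2 * n - 1 - j)%N)).
  rewrite {1}/sq2 (sum_fold _ (fun i => \sum_(j < 2 * n) dt u1 i j ^+ 2)).
  congr (_ + _); rewrite /sq2 -big_split; apply: eq_bigr => i _ /=.
    by rewrite (sum_fold _ (fun j => dt u1 i j ^+ 2)).
  by rewrite (sum_fold _ (fun j => dt u1 (2 * n - 1 - i)%N j ^+ 2)).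
lra.
Qed.

Lemma sqr_sum_le m x : (\sum_(l < m) x l) ^+ 2 <= m%:R * \sum_(l < m) x l ^+ 2.
Proof.
elim: m => [|m IH]; first by rewrite !big_ord0 expr0n mul0r.
rewrite !big_ord_recr /=; set S := \sum_(l < m) x l in IH *; set Q := \sum_(l < m) _ in IH *.
have Q0 : 0 <= Q by apply: sumr_ge0 => *; exact: sqr_ge0.
have : 2 * (S * x m) <= Q + m%:R * x m ^+ 2.
  have [m0|m0] := posnP m.
    rewrite /S; subst m; rewrite big_ord0; lra.
  have m0' : 0 < m%:R :> R by rewrite ltr0n.
  have := sqr_ge0 (S - m%:R * x m) => h.
  rewrite -(ler_pM2l m0'); nra.
rewrite -natr1; nra.
Qed.

Definition avg n f := (\sum_(i < n) f i) / n%:R.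

Lemma avg_sqr_le n f a : (0 < n)%N ->
  n%:R * (a + avg n f) ^+ 2 <= \sum_(i < n) (a + f i) ^+ 2.
Proof.
move=> n0; have n0' : 0 < n%:R :> R by rewrite ltr0n.
have := sqr_sum_le n (fun i => a + f i).
rewrite big_split /= sumr_const card_ord -(mulr_natl a).
have -> : n%:R * a + \sum_(i < n) f i = n%:R * (a + avg n f).
  by rewrite /avg mulrDr; congr (_ + _); rewrite mulrCA divff ?mulr1 // gt_eqF.
by rewrite exprMn expr2 -mulrA ler_pM2l.
Qed.

Lemma telescope_le x i m :
  (x (i + m)%N - x i) ^+ 2 <= m%:R * \sum_(l < m) (x (i + l).+1 - x (i + l)%N) ^+ 2.
Proof.
apply: le_trans (sqr_sum_le m (fun l => x (i + l).+1 - x (i + l)%N)).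
suff -> : \sum_(l < m) (x (i + l).+1 - x (i + l)%N) = x (i + m)%N - x i by [].
elim: m => [|m IH]; first by rewrite big_ord0 addn0 subrr.
by rewrite big_ord_recr /= IH addnS; ring.
Qed.

Lemma variation_le L x i i' : (i < L)%N -> (i' < L)%N ->
  (x i - x i') ^+ 2 <= L%:R * \sum_(l < L) (x l.+1 - x l) ^+ 2.
Proof.
wlog le : i i' / (i' <= i)%N => [th|].
  case: (leqP i' i) => [|/ltnW] h hi hi'; first exact: th.
  by rewrite -opprB sqrrN; apply: th.
move=> hi hi'; have -> : i = (i' + (i - i'))%N by lia.
apply: (le_trans (telescope_le _ _ _)); apply: ler_pM; rewrite ?ler0n ?ler_nat //; last 2 first.
- by lia.
- apply: (@sum_inj_le _ _ _ (fun l => i' + l)%N (fun l => (x l.+1 - x l) ^+ 2)).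
  + by move=> j; exact: sqr_ge0.
  + by move=> l l' _ _; lia.
  + by move=> l hl h; exfalso; lia.
by apply: sumr_ge0 => *; exact: sqr_ge0.
Qed.

Lemma poincare1 L x : (0 < L)%N ->
  \sum_(i < L) (x i - avg L x) ^+ 2 <= L%:R ^+ 2 * \sum_(l < L) (x l.+1 - x l) ^+ 2.
Proof.
move=> L0; have L0' : 0 < L%:R :> R by rewrite ltr0n.
set D := \sum_(l < L) (x l.+1 - x l) ^+ 2.
have h (i : 'I_L) : (x i - avg L x) ^+ 2 <= L%:R * D.
  rewrite -opprB sqrrN addrC -(ler_pM2l L0').
  apply: (le_trans (avg_sqr_le _ _ L0)).
  apply: (@le_trans _ _ (\sum_(i' < L) L%:R * D)).
    apply: ler_sum => i' _; rewrite addrC; exact: variation_le.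
  by rewrite sumr_const card_ord -(mulr_natl (_ * D)).
apply: (@le_trans _ _ (\sum_(i < L) L%:R * D)); first by apply: ler_sum => i _; exact: h.
by rewrite sumr_const card_ord -(mulr_natl (_ * D)) expr2 mulrA.
Qed.

(* An [l^2] version of the Hyers-Ulam stability of Cauchy's equation. *)
Lemma almost_constant K z B : (0 < K)%N ->
  (forall m, (m <= K)%N -> \sum_(j < K) (z (j + m)%N - z j) ^+ 2 <= B) ->
  exists d, \sum_(j < 2 * K) (z j - d) ^+ 2 <= 8 * B.
Proof.
move=> K0 h; have K0' : 0 < K%:R :> R by rewrite ltr0n.
have B0 : 0 <= B by apply: le_trans (h 0%N _) => //; apply: sumr_ge0 => *; exact: sqr_ge0.
pose F j j' := (z j' - z j) ^+ 2.
have F0 j j' : 0 <= F j j' by exact: sqr_ge0.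
(* Every pair [j <= j'] below [K] is joined by the shift [m = j' - j], so the bounds for single
   shifts add up to a bound for all pairs. *)
have half : \sum_(j < K) \sum_(j' < K) (j <= j')%N%:R * F j j' <= K%:R * B.
  apply: (@le_trans _ _ (\sum_(j < K) \sum_(m < K) F j (j + m)%N)); last first.
    rewrite exchange_big /=; apply: (@le_trans _ _ (\sum_(m < K) B)).
      by apply: ler_sum => m _; apply: h; exact: ltnW.
    by rewrite sumr_const card_ord -(mulr_natl B).
  apply: ler_sum => j _; apply: (@le_trans _ _ (\sum_(m < K - j) F j (j + m)%N)); last first.
    apply: (@sum_inj_le _ K (K - j) id (fun m => F j (j + m)%N)) => // l hl h'; exfalso; lia.
  suff H L : L = (j + (K - j))%N -> \sum_(j' < L) (j <= j')%N%:R * F j j' <= \sum_(m < K - j) F j (j + m)%N.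
    by apply: H; have := ltn_ord j; lia.
  move=> ->; rewrite big_split_ord /= big1 ?add0r; last first.
    by move=> l _; rewrite (_ : (j <= l)%N = false) ?mul0r //; have := ltn_ord l; lia.
  by apply: ler_sum => l _; rewrite leq_addr mul1r.
have all : \sum_(j < K) \sum_(j' < K) F j j' <= 2 * (K%:R * B).
  apply: (@le_trans _ _ (\sum_(j < K) \sum_(j' < K) (j <= j')%N%:R * F j j'
      + \sum_(j < K) \sum_(j' < K) (j' <= j)%N%:R * F j' j)); last first.
    by rewrite mulr_natl mulr2n; apply: lerD => //; rewrite exchange_big.
  rewrite -big_split; apply: ler_sum => j _; rewrite -big_split; apply: ler_sum => j' _ /=.
  have -> : F j' j = F j j' by rewrite /F -opprB sqrrN.
  rewrite -mulrDl -[leLHS]mul1r; apply: ler_wpM2r => //.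
  by case: (leqP j j') => h1; rewrite ?addr0 ?lerDl ?ler0n // (ltnW h1) add0r.
(* The mean over the first half approximates the first half with [2 * B]; the shift by [K] carries
   this to the second half with [2 * B + 2 * (2 * B)]. Hence the 8. *)
pose d := avg K z; exists d.
have low : \sum_(j < K) (z j - d) ^+ 2 <= 2 * B.
  rewrite -(ler_pM2l K0') mulrCA (le_trans _ all) // mulr_sumr; apply: ler_sum => j _.
  rewrite -opprB sqrrN addrC; apply: (le_trans (avg_sqr_le _ _ K0)).
  by apply: ler_sum => j' _; rewrite addrC.
rewrite mul2n -addnn big_split_ord /=.
have up : \sum_(i < K) (z (K + i)%N - d) ^+ 2 <= 6 * B.
  apply: (@le_trans _ _ (\sum_(i < K) (2 * (z (i + K)%N - z i) ^+ 2 + 2 * (z i - d) ^+ 2))).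
    apply: ler_sum => i _; rewrite addnC; set a := z _; have := sqr_ge0 (a - z i - (z i - d)); lra.
  rewrite big_split /= -!mulr_sumr; have := h K (leqnn K); lra.
lra.
Qed.

(** A Pexider equation with error. Averaging over [i] shows that the increments of [p] over [m] are
    nearly independent of [j], and likewise for [q] with opposite sign. Once they are known to be
    nearly linear in [m], removing the slope reduces the claim to almost constant sequences. *)
Lemma almost_affine K p q B : (0 < K)%N ->
  (forall m, (m <= K)%N -> \sum_(i < K) \sum_(j < K)
     (p (j + m)%N - p j + (q (i + m)%N - q i)) ^+ 2 <= B) ->
  exists c d e, \sum_(j < 2 * K) (p j - c * j%:R - d) ^+ 2 <= 128 * B / K%:R /\ \sum_(i < 2 * K) (q i + c * i%:R - e) ^+ 2 <= 128 * B / K%:R.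
Proof.
move=> K0 h; have K0' : 0 < K%:R :> R by rewrite ltr0n.
have B0 : 0 <= B.
  by apply: le_trans (h 0%N _) => //; do 2 (apply: sumr_ge0 => ? _); exact: sqr_ge0.
pose P m := avg K (fun j => p (j + m)%N - p j).
pose Q m := avg K (fun j => q (j + m)%N - q j).
pose B' := B / K%:R.
have B'0 : 0 <= B' by rewrite divr_ge0 // ltW.
have KB' : K%:R * B' = B by rewrite mulrC divfK // gt_eqF.
have hp m : (m <= K)%N -> \sum_(j < K) (p (j + m)%N - p j + Q m) ^+ 2 <= B'.
  move=> mK; rewrite -(ler_pM2l K0') KB'; apply: le_trans (h m mK).
  rewrite exchange_big mulr_sumr; apply: ler_sum => j _ /=.
  exact: avg_sqr_le.
have hq m : (m <= K)%N -> \sum_(j < K) (q (j + m)%N - q j + P m) ^+ 2 <= B'.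
  move=> mK; rewrite -(ler_pM2l K0') KB'; apply: le_trans (h m mK).
  rewrite mulr_sumr; apply: ler_sum => j _ /=.
  apply: (le_trans (@avg_sqr_le K (fun j => p (j + m)%N - p j) _ K0)).
  by apply: ler_sum => i _; rewrite addrC.
have hPQ m : (m <= K)%N -> K%:R * (P m + Q m) ^+ 2 <= B'.
  move=> mK; apply: le_trans (hp m mK); rewrite [P m + _]addrC.
  apply: (le_trans (@avg_sqr_le K (fun j => p (j + m)%N - p j) (Q m) K0)).
  by apply: ler_sum => i _; rewrite addrC.
have hpp m : (m <= K)%N -> \sum_(j < K) (p (j + m)%N - p j - P m) ^+ 2 <= 4 * B'.
  move=> mK; apply: (@le_trans _ _ (\sum_(j < K) (2 * (p (j + m)%N - p j + Q m) ^+ 2 + 2 * (P m + Q m) ^+ 2))).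
    apply: ler_sum => j _; set a := p _ - _.
    have := sqr_ge0 (a + Q m + (P m + Q m)); lra.
  rewrite big_split /= -mulr_sumr sumr_const card_ord -(mulr_natl (2 * _)) mulrCA.
  have := hPQ m mK; have := hp m mK; lra.
pose c := P K / K%:R.
(* Exchange of windows: increments over [m], summed over [K] starting points, equal increments over
   [K], summed over [m] starting points. The latter are all close to [P K], so [P m] is close to
   [m / K] times [P K], which explains the slope [c]. *)
have PE m : P m = (\sum_(l < m) (p (l + K)%N - p l)) / K%:R.
  rewrite /P /avg; congr (_ / _).
  rewrite !big_split /= !sumrN; apply/eqP; rewrite subr_eq addrAC -subr_eq opprK; apply/eqP.
  have e1 : \sum_(i < K) p (i + m)%N = \sum_(i < m + K) p i - \sum_(i < m) p i.
    rewrite big_split_ord /= addrAC subrr add0r; apply: eq_bigr => i _; by rewrite addnC.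
  have e2 : \sum_(i < m) p (i + K)%N = \sum_(i < K + m) p i - \sum_(i < K) p i.
    rewrite big_split_ord /= addrAC subrr add0r; apply: eq_bigr => i _; by rewrite addnC.
  by rewrite e1 e2 addnC; ring.
have hc m : (m <= K)%N -> K%:R * (P m - c * m%:R) ^+ 2 <= 4 * B'.
  move=> mK.
  have -> : P m - c * m%:R = (\sum_(l < m) (p (l + K)%N - p l - P K)) / K%:R.
    rewrite big_split /= sumr_const card_ord -(mulr_natl (- P K)) PE /c; field.
    by rewrite gt_eqF.
  rewrite expr_div_n mulrA ler_pdivrMr ?exprn_gt0 // [leRHS]mulrC [K%:R ^+ 2]expr2 -mulrA ler_pM2l //.
  apply: (le_trans (sqr_sum_le m (fun l => p (l + K)%N - p l - P K))); apply: ler_pM; rewrite ?ler0n ?ler_nat //.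
    by apply: sumr_ge0 => *; exact: sqr_ge0.
  apply: le_trans (hpp K (leqnn K)).
  by apply: (@sum_inj_le _ K m id (fun l => (p (l + K)%N - p l - P K) ^+ 2)) => [j|//|l hl h'];
    [exact: sqr_ge0 | exfalso; lia].
have hz m : (m <= K)%N ->
    \sum_(j < K) (p (j + m)%N - c * (j + m)%:R - (p j - c * j%:R)) ^+ 2 <= 16 * B'.
  move=> mK; apply: (@le_trans _ _ (\sum_(j < K) (2 * (p (j + m)%N - p j - P m) ^+ 2 + 2 * (P m - c * m%:R) ^+ 2))).
    apply: ler_sum => j _; rewrite natrD; set a := p _; set b := p j.
    have := sqr_ge0 (a - b - P m - (P m - c * m%:R)); lra.
  rewrite big_split /= -mulr_sumr sumr_const card_ord -(mulr_natl (2 * _)) mulrCA.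
  have := hc m mK; have := hpp m mK; lra.
have hw m : (m <= K)%N ->
    \sum_(j < K) (q (j + m)%N + c * (j + m)%:R - (q j + c * j%:R)) ^+ 2 <= 16 * B'.
  move=> mK; apply: (@le_trans _ _ (\sum_(j < K) (2 * (q (j + m)%N - q j + P m) ^+ 2 + 2 * (P m - c * m%:R) ^+ 2))).
    apply: ler_sum => j _; rewrite natrD; set a := q _; set b := q j.
    have := sqr_ge0 (a - b + P m + (P m - c * m%:R)); lra.
  rewrite big_split /= -mulr_sumr sumr_const card_ord -(mulr_natl (2 * _)) mulrCA.
  have := hc m mK; have := hq m mK; lra.
have [d hd] := @almost_constant K (fun j => p j - c * j%:R) _ K0 hz.
have [e he] := @almost_constant K (fun j => q j + c * j%:R) _ K0 hw.
exists c, d, e; have -> : 128 * B / K%:R = 8 * (16 * B') by rewrite /B'; ring.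
by [].
Qed.
(* Along a diagonal the increment of u1 + u2 only involves the strain. *)
Lemma diagonal_increment u1 u2 i j :
  (u1 i.+1 j.+1 + u2 i.+1 j.+1) - (u1 i j + u2 i j) =
  ds u1 i j.+1 + dt u2 i.+1 j + shear u1 u2 i j.
Proof. by rewrite /shear /ds /dt; ring. Qed.

Lemma diagonal_le K m u1 u2 : (m <= K)%N ->
  sq2 K K (fun i j => (u1 (i + m)%N (j + m)%N + u2 (i + m)%N (j + m)%N) - (u1 i j + u2 i j))
  <= 3 * K%:R ^+ 2 * energy (2 * K) (2 * K) u1 u2.
Proof.
move=> mK; set E := energy _ _ _ _; have E0 : 0 <= E by exact: energy_ge0.
pose g i j := ds u1 i j.+1 + dt u2 i.+1 j + shear u1 u2 i j.
(* The minimum and the factor [(m != 0)] keep the shift below [K] for every [l]; for [l < m], the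
   only case used, both are inert. *)
have gE l : sq2 K K (fun i j => (m != 0)%N%:R * g (i + minn l m.-1)%N (j + minn l m.-1)%N) <= 3 * E.
  have [m0|m0] := posnP m.
    by rewrite m0 (@eq_sq2 _ _ _ _ (fun _ _ => 0)) => [|i j _ _]; rewrite ?mul0r // /sq2
      big1 => [|i _]; [rewrite mulr_ge0|rewrite big1 // => j _; rewrite expr0n].
  set s := minn l m.-1; have sK : (s < K)%N by rewrite /s; lia.
  rewrite (@eq_sq2 _ _ _ _ (fun i j => g (i + s) (j + s))%N); last first.
    by move=> i j _ _ /=; rewrite mul1r.
  have k0 : (K + s <= 2 * K)%N by lia.
  have k1 : (K + s.+1 <= 2 * K)%N by lia.
  have := @sq2_le3 R K K (fun i j => g (i + s) (j + s))%N
    (fun i j => ds u1 (i + s) (j + s.+1))%N (fun i j => dt u2 (i + s.+1) (j + s))%N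
    (fun i j => shear u1 u2 (i + s) (j + s))%N 3 3 3.
  have := le_trans (sq2_shift K K (ds u1) s s.+1) (sq2_sub _ k0 k1).
  have := le_trans (sq2_shift K K (dt u2) s.+1 s) (sq2_sub _ k1 k0).
  have := le_trans (sq2_shift K K (shear u1 u2) s s) (sq2_sub _ k0 k0).
  rewrite /E /energy => h1 h2 h3 h.
  apply: (le_trans (h _)); last by lra.
  move=> i j _ _; rewrite !addnS /g; set a := ds _ _ _; set b := dt _ _ _; set c := shear _ _ _ _.
  have := sqr_ge0 (a - b); have := sqr_ge0 (a - c); have := sqr_ge0 (b - c); lra.
apply: (@le_trans _ _ (\sum_(i < K) \sum_(j < K) (m%:R * \sum_(l < m) g (i + l)%N (j + l)%N ^+ 2))).
  apply: ler_sum => i _; apply: ler_sum => j _.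
  have := telescope_le (fun l => u1 (i + l)%N (j + l)%N + u2 (i + l)%N (j + l)%N) 0 m.
  rewrite add0n !addn0 => h; apply: (le_trans h); rewrite le_eqVlt; apply/orP; left; apply/eqP.
  by congr (_ * _); apply: eq_bigr => l _; rewrite add0n !addnS diagonal_increment.
under eq_bigr do rewrite -mulr_sumr exchange_big /=.
rewrite -mulr_sumr exchange_big /=.
rewrite (mulrC 3) -mulrA expr2 -mulrA; apply: ler_pM; rewrite ?ler0n ?ler_nat //.
  by do 3 (apply: sumr_ge0 => ? _); exact: sqr_ge0.
apply: (@le_trans _ _ (\sum_(l < m) 3 * E)); last first.
  rewrite sumr_const card_ord -(mulr_natl (3 * E)); apply: ler_wpM2r; rewrite ?ler_nat //; exact: mulr_ge0.
apply: ler_sum => l _; apply: le_trans (gE l).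
rewrite le_eqVlt; apply/orP; left; apply/eqP; apply: eq_bigr => i _; apply: eq_bigr => j _.
have lm := ltn_ord l; have -> : (m != 0)%N by rewrite -lt0n; exact: leq_trans lm.
by rewrite mul1r (_ : minn l m.-1 = l) //; lia.
Qed.

Lemma korn_L2 K u1 u2 : (0 < K)%N -> exists c d e,
  sq2 (2 * K) (2 * K) (fun i j => u1 i j - c * j%:R - d) +
  sq2 (2 * K) (2 * K) (fun i j => u2 i j + c * i%:R - e) <=
  2 * 10 ^+ 5 * K%:R ^+ 2 * energy (2 * K) (2 * K) u1 u2.
Proof.
move=> K0; have K0' : 0 < K%:R :> R by rewrite ltr0n.
set L := (2 * K)%N; have L0 : (0 < L)%N by rewrite /L; lia.
set E := energy _ _ _ _; have E0 : 0 <= E by exact: energy_ge0.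
pose p j := avg L (fun i => u1 i j); pose q i := avg L (fun j => u2 i j).
have LE : L%:R = 2 * K%:R :> R by rewrite /L natrM.
have E1 : sq2 L L (ds u1) <= E.
  by rewrite /E /energy; have := sq2_ge0 L L (dt u2); have := sq2_ge0 L L (shear u1 u2); lra.
have E2 : sq2 L L (dt u2) <= E.
  by rewrite /E /energy; have := sq2_ge0 L L (ds u1); have := sq2_ge0 L L (shear u1 u2); lra.
have hp : sq2 L L (fun i j => u1 i j - p j) <= 4 * K%:R ^+ 2 * E.
  apply: (@le_trans _ _ (L%:R ^+ 2 * sq2 L L (ds u1))); last first.
    by rewrite LE (_ : (2 * K%:R) ^+ 2 = 4 * K%:R ^+ 2) ?ler_pM2l ?mulr_gt0 ?exprn_gt0 //; ring.
  rewrite -sq2C -(sq2C _ _ (ds u1)) /sq2 mulr_sumr; apply: ler_sum => j _.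
  exact: (poincare1 (fun i => u1 i j)).
have hq : sq2 L L (fun i j => u2 i j - q i) <= 4 * K%:R ^+ 2 * E.
  apply: (@le_trans _ _ (L%:R ^+ 2 * sq2 L L (dt u2))); last first.
    by rewrite LE (_ : (2 * K%:R) ^+ 2 = 4 * K%:R ^+ 2) ?ler_pM2l ?mulr_gt0 ?exprn_gt0 //; ring.
  rewrite /sq2 mulr_sumr; apply: ler_sum => i _; exact: (poincare1 (fun j => u2 i j)).
set X := K%:R ^+ 2 * E; have X0 : 0 <= X by rewrite mulr_ge0 // sqr_ge0.
rewrite -mulrA -/X in hp; rewrite -mulrA -/X in hq.
have KK : (K <= L)%N by rewrite /L; lia.
(* [105 = 3 * 3 + 3 * 16 + 3 * 16]: the diagonal increment and the errors of the averages at both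
   ends. *)
have hR m : (m <= K)%N -> \sum_(i < K) \sum_(j < K)
     (p (j + m)%N - p j + (q (i + m)%N - q i)) ^+ 2 <= 105 * X.
  move=> mK; have Km : (K + m <= L)%N by rewrite /L; lia.
  have hd := diagonal_le u1 u2 mK; rewrite -/L -/E -mulrA -/X in hd.
  pose P i j := u1 i j - p j; pose Q i j := u2 i j - q i.
  have hp1 := le_trans (le_trans (sq2_shift K K P m m) (sq2_sub _ Km Km)) hp.
  have hq1 := le_trans (le_trans (sq2_shift K K Q m m) (sq2_sub _ Km Km)) hq.
  have hp2 := le_trans (sq2_sub P KK KK) hp.
  have hq2 := le_trans (sq2_sub Q KK KK) hq.
  pose D i j := (u1 (i + m)%N (j + m)%N + u2 (i + m)%N (j + m)%N) - (u1 i j + u2 i j).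
  pose A i j := P (i + m)%N (j + m)%N + Q (i + m)%N (j + m)%N; pose B i j := P i j + Q i j.
  have hA : sq2 K K A <= 16 * X.
    apply: (@le_trans _ _ (2 * sq2 K K (fun i j => P (i + m)%N (j + m)%N) +
       2 * sq2 K K (fun i j => Q (i + m)%N (j + m)%N) + 0 * sq2 K K P)); last by lra.
    apply: sq2_le3 => i j _ _; rewrite /A; set a := P _ _; set b := Q _ _.
    have := sqr_ge0 (a - b); lra.
  have hB : sq2 K K B <= 16 * X.
    apply: (@le_trans _ _ (2 * sq2 K K P + 2 * sq2 K K Q + 0 * sq2 K K P)); last by lra.
    apply: sq2_le3 => i j _ _; rewrite /B; set a := P _ _; set b := Q _ _.
    have := sqr_ge0 (a - b); lra.
  apply: (@le_trans _ _ (3 * sq2 K K D + 3 * sq2 K K A + 3 * sq2 K K B)).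
    apply: (@sq2_le3 _ _ _ (fun i j => p (j + m)%N - p j + (q (i + m)%N - q i))) => i j _ _.
    have -> : p (j + m)%N - p j + (q (i + m)%N - q i) = D i j - A i j + B i j.
      by rewrite /D /A /B /P /Q; ring.
    set a := D _ _; set b := A _ _; set c := B _ _.
    have := sqr_ge0 (a + b); have := sqr_ge0 (a - c); have := sqr_ge0 (b + c); lra.
  rewrite -/D in hd; lra.
have [c [d [e [hd he]]]] := almost_affine K0 hR.
exists c, d, e; rewrite -mulrA -/X.
have h1 : sq2 L L (fun i j => p j - c * j%:R - d) <= (2 * (128 * 105)) * X.
  rewrite /sq2 sumr_const card_ord -(mulr_natl (\sum_(_ < _) _)) LE.
  have := ler_wpM2l (ltW K0') hd.
  rewrite [_ * (_ / _)]mulrCA mulfV ?gt_eqF // mulr1; lra.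
have h2 : sq2 L L (fun i j => q i + c * i%:R - e) <= (2 * (128 * 105)) * X.
  rewrite -sq2C /sq2 sumr_const card_ord -(mulr_natl (\sum_(_ < _) _)) LE.
  have := ler_wpM2l (ltW K0') he.
  rewrite [_ * (_ / _)]mulrCA mulfV ?gt_eqF // mulr1; lra.
have h3 : sq2 L L (fun i j => u1 i j - c * j%:R - d) <= (6 * 10 ^+ 4) * X.
  apply: (@le_trans _ _ (2 * sq2 L L (fun i j => u1 i j - p j)
     + 2 * sq2 L L (fun i j => p j - c * j%:R - d) + 0 * sq2 L L u1)); last by lra.
  apply: sq2_le3 => i j _ _; set a := p j; set b := c * _.
  have := sqr_ge0 (u1 i j - a - (a - b - d)); lra.
have h4 : sq2 L L (fun i j => u2 i j + c * i%:R - e) <= (6 * 10 ^+ 4) * X.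
  apply: (@le_trans _ _ (2 * sq2 L L (fun i j => u2 i j - q i)
     + 2 * sq2 L L (fun i j => q i + c * i%:R - e) + 0 * sq2 L L u1)); last by lra.
  apply: sq2_le3 => i j _ _; set a := q i; set b := c * _.
  have := sqr_ge0 (u2 i j - a - (a + b - e)); lra.
lra.
Qed.

(** The powers of [n] match: the cutoff costs [1 / n ^ 2] times the mass, and after removal of a
    rigid motion, which leaves the energy unchanged, the mass is at most a multiple of [n ^ 2] times
    the energy. *)
Theorem discrete_korn n u1 u2 : (1 < n)%N -> exists c,
  sq2 (2 * n) (2 * n) (fun i j => dt u1 i j - c) <=
  10 ^+ 13 * energy (2 * n + 2) (2 * n + 2) u1 u2.
Proof.
move=> n1; have n0 : (0 < n)%N by lia.
have n0' : 0 < n%:R :> R by rewrite ltr0n.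
have [c [d [e h]]] := korn_L2 u1 u2 (ltn0Sn n); exists c.
have nE : (2 * n.+1 = 2 * n + 2)%N by lia.
rewrite nE in h; set E := energy _ _ _ _ in h *.
have E0 : 0 <= E by exact: energy_ge0.
pose w1 i j := u1 i j - c * j%:R - d; pose w2 i j := u2 i j + c * i%:R - e.
have nn : (2 * n + 1 <= 2 * n + 2)%N by lia.
have hE : energy (2 * n + 1) (2 * n + 1) w1 w2 <= E.
  have -> : E = energy (2 * n + 2) (2 * n + 2) w1 w2.
    rewrite /E /energy; congr (_ + _ + _); apply: eq_sq2 => i j _ _;
      rewrite /shear /ds /dt /w1 /w2 -?natr1; ring.
  by rewrite /energy; do !apply: lerD; apply: sq2_sub.
have hm : mass (2 * n + 1) w1 w2 <= (8 * 10 ^+ 5) * n%:R ^+ 2 * E.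
  apply: (@le_trans _ _ (mass (2 * n + 2) w1 w2)); first by apply: lerD; apply: sq2_sub.
  apply: (le_trans h); rewrite ler_wpM2r // (_ : 8 * 10 ^+ 5 * n%:R ^+ 2 = 2 * 10 ^+ 5 * (2 * n%:R) ^+ 2); last by ring.
  apply: ler_wpM2l; first by rewrite mulr_ge0 ?exprn_ge0.
  have h2 : n.+1%:R <= 2 * n%:R :> R by rewrite -natrM ler_nat; lia.
  by rewrite lerXn2r ?nnegrE ?mulr_ge0.
have := korn_second w1 w2 n1.
rewrite [leLHS](_ : _ = sq2 (2 * n) (2 * n) (fun i j => dt u1 i j - c)); last first.
  by apply: eq_sq2 => i j _ _; rewrite /dt /w1 -natr1; ring.
move=> k; apply: (le_trans k).
have : 48 / n%:R ^+ 2 * mass (2 * n + 1) w1 w2 <= 48 * (8 * 10 ^+ 5) * E.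
  rewrite mulrAC ler_pdivrMr ?exprn_gt0 //.
  rewrite (_ : 48 * (8 * 10 ^+ 5) * E * n%:R ^+ 2 = 48 * ((8 * 10 ^+ 5) * n%:R ^+ 2 * E)); last by ring.
  by rewrite ler_pM2l.
lra.
Qed.

Theorem discrete_poincare L w : (0 < L)%N -> exists c,
  sq2 L L (fun i j => w i j - c) <=
  2 * L%:R ^+ 2 * (sq2 L L (ds w) + sq2 L L (dt w)).
Proof.
move=> L0; have L0' : 0 < L%:R :> R by rewrite ltr0n.
pose p j := avg L (fun i => w i j); exists (avg L p).
have h1 : sq2 L L (fun i j => w i j - p j) <= L%:R ^+ 2 * sq2 L L (ds w).
  rewrite -sq2C -(sq2C _ _ (ds w)) /sq2 mulr_sumr; apply: ler_sum => j _.
  exact: (poincare1 (fun i => w i j)).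
have h2 : sq2 L L (fun i j => p j - avg L p) <= L%:R ^+ 2 * sq2 L L (dt w).
  rewrite {1}/sq2 sumr_const card_ord -(mulr_natl (\sum_(_ < _) _)).
  apply: (le_trans (ler_wpM2l (ltW L0') (poincare1 p L0))).
  rewrite mulrCA ler_pM2l ?exprn_gt0 // [sq2 _ _ _]exchange_big /= mulr_sumr.
  apply: ler_sum => j _.
  have -> : p j.+1 - p j = 0 + avg L (fun i => dt w i j).
    by rewrite add0r /p /avg -mulrBl -sumrB.
  apply: (le_trans (avg_sqr_le _ _ L0)).
  by rewrite le_eqVlt; apply/orP; left; apply/eqP; apply: eq_bigr => i _; rewrite add0r.
apply: (@le_trans _ _ (2 * sq2 L L (fun i j => w i j - p j)
   + 2 * sq2 L L (fun i j => p j - avg L p) + 0 * sq2 L L w)); last by lra.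
apply: sq2_le3 => i j _ _; set a := p j; set b := avg L p.
have := sqr_ge0 (w i j - a - (a - b)); lra.
Qed.
End DiscreteKornMain.

(** * Smooth functions and bumps *)
Section Smooth.
Variable R : realType.
Implicit Types (f g F : R -> R).

(** Smoothness is encoded by finite towers of derivatives, so that closure properties are inductions
    on the height of the tower. *)
Fixpoint smooth_upto n f : Prop :=
  if n is m.+1 then exists f', (forall x : R, is_derive x (1 : R) f (f' x)) /\ smooth_upto m f'
  else True.
Definition smooth f := forall n, smooth_upto n f.

Lemma smooth_uptoS n f : smooth_upto n.+1 f -> smooth_upto n f.
Proof. by elim: n f => [//|n IH] f [f' [h1 h2]]; exists f'; split => //; exact: IH. Qed.

Lemma smooth_upto_cst n c : smooth_upto n (fun=> c).
Proof. by elim: n c => // n IH c; exists (fun=> 0); split => [x|]; [exact: is_derive_cst|]. Qed.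

Lemma smooth_uptoD n f g : smooth_upto n f -> smooth_upto n g ->
  smooth_upto n (fun x => f x + g x).
Proof.
elim: n f g => // n IH f g [f' [hf sf]] [g' [hg sg]].
exists (fun x => f' x + g' x); split => [x|]; last exact: IH.
by have := @is_deriveD _ _ _ f g x 1 _ _ (hf x) (hg x).
Qed.

Lemma smooth_uptoN n f : smooth_upto n f -> smooth_upto n (fun x => - f x).
Proof.
elim: n f => // n IH f [f' [hf sf]].
exists (fun x => - f' x); split => [x|]; last exact: IH.
exact: (@is_deriveN _ _ _ f x 1 _ (hf x)).
Qed.

Lemma smooth_uptoM n f g : smooth_upto n f -> smooth_upto n g ->
  smooth_upto n (fun x => f x * g x).
Proof.
elim: n f g => // n IH f g sf sg.
case: (sf) => f' [hf sf']; case: (sg) => g' [hg sg'].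
exists (fun x => f x * g' x + g x * f' x); split => [x|].
  by have := @is_deriveM _ _ f g x 1 _ _ (hf x) (hg x).
by apply: smooth_uptoD; apply: IH => //; exact: smooth_uptoS.
Qed.

Lemma smooth_uptoV n f : (forall x, f x != 0) -> smooth_upto n f ->
  smooth_upto n (fun x => (f x)^-1).
Proof.
move=> f0; elim: n => // n IH sf; case: (sf) => f' [hf sf'].
exists (fun x => - ((f x)^-1 * (f x)^-1) * f' x); split => [x|].
  have := is_deriveV (f0 x) (hf x).
  by rewrite /GRing.scale /= expr2 invfM.
apply: smooth_uptoM => //; apply: smooth_uptoN.
by apply: smooth_uptoM; apply: IH; exact: smooth_uptoS.
Qed.

Lemma smooth_upto_affine n f a b : smooth_upto n f -> smooth_upto n (fun x => f (a * x + b)).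
Proof.
elim: n f => // n IH f [f' [hf sf]].
exists (fun x => a * f' (a * x + b)); split => [x|]; last first.
  by apply: smooth_uptoM; [exact: smooth_upto_cst|exact: IH].
have ha : is_derive x 1 (fun x : R => a * x + b) a.
  apply: is_derive_eq; rewrite /GRing.scale /=; ring.
have := @is_derive1_comp _ f _ x _ _ (hf _) ha.
by rewrite mulrC.
Qed.

Lemma smooth_primitive f F : (forall x, is_derive x (1 : R) F (f x)) -> smooth f -> smooth F.
Proof. by move=> h s [|n] //=; exists f; split. Qed.

Lemma smooth_der f F : (forall x, is_derive x (1 : R) F (f x)) -> smooth F -> smooth f.
Proof.
move=> h s n; case: (s n.+1) => f' [h' s']; suff -> : f = f' by [].
by apply/funext => x; have [_ <-] := h x; have [_ <-] := h' x.
Qed.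

Lemma smooth_is_derive f : smooth f -> forall x : R, is_derive x (1 : R) f (derive1 f x).
Proof.
by move=> s x; case: (s 1%N) => f' [h _]; have [? d] := h x; rewrite derive1E; exact: derivableP.
Qed.

Lemma smooth_derive1 f : smooth f -> smooth (derive1 f).
Proof. by move=> s; apply: (smooth_der _ s) => x; exact: smooth_is_derive. Qed.

Lemma is_derive_continuous f (f' : R -> R) : (forall x, is_derive x (1 : R) f (f' x)) -> continuous f.
Proof.
move=> h x; apply/differentiable_continuous/derivable1_diffP.
by have [? _] := h x.
Qed.

Lemma smooth_continuous f : smooth f -> continuous f.
Proof. by move=> s; apply: is_derive_continuous => x; exact: smooth_is_derive. Qed.

Lemma smoothD f g : smooth f -> smooth g -> smooth (fun x => f x + g x).
Proof. by move=> a b n; exact: smooth_uptoD. Qed.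
Lemma smoothM f g : smooth f -> smooth g -> smooth (fun x => f x * g x).
Proof. by move=> a b n; exact: smooth_uptoM. Qed.
Lemma smoothN f : smooth f -> smooth (fun x => - f x).
Proof. by move=> a n; exact: smooth_uptoN. Qed.
Lemma smooth_cst c : smooth (fun=> c).
Proof. by move=> n; exact: smooth_upto_cst. Qed.
Lemma smooth_affine f a b : smooth f -> smooth (fun x => f (a * x + b)).
Proof. by move=> s n; exact: smooth_upto_affine. Qed.
Lemma smooth_sum (I : eqType) (r : seq I) (h : I -> R -> R) :
  (forall i, smooth (h i)) -> smooth (fun x => \sum_(i <- r) h i x).
Proof.
move=> s; elim: r => [|i r IH].
  by rewrite (_ : (fun _ => _) = fun=> 0); [exact: smooth_cst|apply/funext => x; rewrite big_nil].
rewrite (_ : (fun _ => _) = fun x => h i x + \sum_(i <- r) h i x); first exact: smoothD.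
by apply/funext => x; rewrite big_cons.
Qed.

(** The classical [exp (- 1 / x)] with a polynomial in [1 / x] as a factor: this makes the family
    closed under differentiation, and smoothness follows by induction. *)
Definition flat (p : {poly R}) (x : R) : R := if 0 < x then p.[x^-1] * expR (- x^-1) else 0.

(** The quadratic decay makes the difference quotient at 0 tend to 0. It comes from
    [exp y >= y ^ n / n!] at [y = 1 / x], monomial by monomial. *)
Lemma flat_small (p : {poly R}) : exists C, 0 <= C /\ forall x, 0 < x -> `|flat p x| <= C * x ^+ 2.
Proof.
pose C := \sum_(i < size p) `|p`_i| * (i.+2)`!%:R.
have C0 : 0 <= C by apply: sumr_ge0 => *; rewrite mulr_ge0.
exists C; split => // x x0; rewrite /flat x0.
set y := x^-1; have y0 : 0 < y by rewrite invr_gt0.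
have -> : x = y^-1 by rewrite invrK.
rewrite expRN normrM normfV [`|expR y|]ger0_norm ?expR_ge0 // ler_pdivrMr ?expR_gt0 //.
rewrite exprVn mulrAC ler_pdivlMr ?exprn_gt0 //.
have -> : `|p.[y]| * y ^+ 2 = `|p.[y] * y ^+ 2| by rewrite normrM (ger0_norm (exprn_ge0 _ (ltW y0))).
rewrite horner_coef !mulr_suml.
apply: (le_trans (ler_norm_sum _ _ _)); apply: ler_sum => i _.
rewrite -mulrA -exprD addn2 normrM -mulrA; apply: ler_wpM2l => //.
rewrite ger0_norm ?exprn_ge0 ?(ltW y0) // -ler_pdivrMl; last by rewrite ltr0n fact_gt0.
rewrite mulrC; apply: le_trans (expR_ge1Dxn i.+1 (ltW y0)).
by rewrite lerDr.
Qed.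

Lemma flat_is_derive (p : {poly R}) (x : R) :
  is_derive x (1 : R) (flat p) (flat ('X^2 * (p - p^`())) x).
Proof.
have [x0|x0|->] := ltgtP x 0.
- have -> : flat ('X^2 * (p - p^`())) x = 0 by rewrite /flat ltNge (ltW x0).
  apply: (@near_eq_is_derive _ _ _ (cst 0)).
    near=> y; rewrite /cst /flat ifF //; apply/negbTE; rewrite -leNgt.
    by near: y; exact: lt_le_nbhsl.
- apply: (@near_eq_is_derive R R^o R^o (fun y : R => p.[y^-1] * expR (- y^-1))).
    near=> y; rewrite /flat ifT //; near: y; exact: lt_nbhsr.
  have xn0 : x != 0 by rewrite gt_eqF.
  have dV : is_derive x (1 : R) (fun y : R => y^-1) (- x^-2).
    have := @is_deriveV _ id x 1 1 xn0 _; rewrite /GRing.scale /= mulr1; exact.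
  have dp : is_derive x (1 : R) (fun y : R => p.[y^-1]) (- x^-2 * p^`().[x^-1]).
    have hp : is_derive x^-1 (1 : R) (horner p) p^`().[x^-1].
      by rewrite derivE derive1E; apply: derivableP; exact: derivable_horner.
    by rewrite mulrC; exact: (@is_derive1_comp _ (horner p) (fun y : R => y^-1) x _ _ hp dV).
  have de : is_derive x (1 : R) (fun y : R => expR (- y^-1)) (x^-2 * expR (- x^-1)).
    have := @is_derive1_comp _ expR (fun y : R => - y^-1) x _ _ (is_derive_expR _) (@is_deriveN _ _ _ _ x 1 _ dV).
    by rewrite opprK mulrC.
  have := @is_deriveM _ _ (fun y : R => p.[y^-1]) (fun y : R => expR (- y^-1)) x 1 _ _ dp de.
  rewrite /flat x0 !hornerE /GRing.scale /= exprVn; move=> h; apply: is_derive_eq h _; ring.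
- have h : is_derive (0 : R) (1 : R) (flat p) 0; last by rewrite [flat ('X^2 * _) 0]/flat ltxx.
  have [C [C0 hC]] := flat_small p.
  suff cv : (fun h : R => h^-1 *: (flat p (h *: 1 + 0) - flat p 0)) @ 0^' --> (0 : R).
    apply: DeriveDef; first by apply/cvg_ex; exists 0; exact: cv.
    exact: (cvg_lim _ cv).
  apply/cvgr0Pnorm_lt => e e0; near=> h.
  have -> : flat p 0 = 0 by rewrite /flat ltxx.
  rewrite subr0 addr0 /GRing.scale /= mulr1 normrM normfV.
  have hn0 : h != 0 by near: h; exact: nbhs_dnbhs_neq.
  have h0 : 0 < `|h| by rewrite normr_gt0.
  rewrite mulrC ltr_pdivrMr //.
  have hlt : `|h| < e / (C + 1).
    near: h; apply: (@cvgr0_norm_lt _ _ _ _ _ id); last by rewrite divr_gt0 // ltr_wpDl.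
    exact: cvg_within.
  have [hp|hp] := ltP 0 h; last first.
    by rewrite (_ : flat p h = 0) ?normr0 ?mulr_gt0 //; rewrite /flat ltNge hp.
  apply: (le_lt_trans (hC _ hp)); rewrite expr2 mulrA; rewrite (gtr0_norm hp) in hlt *.
  rewrite ltr_pM2r //; move: hlt; rewrite ltr_pdivlMr; last by rewrite ltr_wpDl.
  nra.
Unshelve. all: by end_near. Qed.

Lemma smooth_flat p : smooth (flat p).
Proof.
move=> n; elim: n p => // n IH p; exists (flat ('X^2 * (p - p^`()))); split => //.
by move=> x; exact: flat_is_derive.
Qed.

End Smooth.

(** * Smooth steps, built as B-splines are *)

Section Steps.
Variable R : realType.
Implicit Types (f g F H : R -> R).

Lemma mean_value f (f' : R -> R) a b : a <= b -> (forall x, is_derive x (1 : R) f (f' x)) ->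
  exists c, a <= c <= b /\ f b - f a = f' c * (b - a).
Proof.
move=> ab h; have [//|c cab ->] := @MVT_segment R f f' a b ab (fun x _ => h x) _.
  exact/continuous_subspaceT/(is_derive_continuous h).
by exists c; rewrite in_itv /= in cab.
Qed.

(* Smooth cardinal steps: b(x) = H(x) - H(x-1) is a bump whose integer translates
   form a partition of unity. *)
Definition is_step (k : nat) H :=
  [/\ smooth H, forall x, x <= 0 -> H x = 0, forall x, k%:R <= x -> H x = 1,
    forall x, 0 <= H x <= 1 & forall x, H (x - 1) <= H x].

Lemma flat1_gt0 x : 0 < x -> 0 < flat (1 : {poly R}) x.
Proof. by move=> x0; rewrite /flat x0 hornerE mul1r expR_gt0. Qed.
Lemma flat1_le0 x : x <= 0 -> flat (1 : {poly R}) x = 0.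
Proof. by move=> x0; rewrite /flat ltNge x0. Qed.
Lemma flat1_ge0 x : 0 <= flat (1 : {poly R}) x.
Proof. by case: (leP x 0) => h; [rewrite flat1_le0|rewrite ltW ?flat1_gt0]. Qed.

Lemma step1 : exists H, is_step 1 H.
Proof.
pose f := flat (1 : {poly R}); pose d x := f x + f (-1 * x + 1).
have d0 x : 0 < d x.
  rewrite /d; case: (leP x 0) => h; last by rewrite ltr_wpDr ?flat1_ge0 ?flat1_gt0.
  by rewrite ltr_wpDl ?flat1_ge0 // flat1_gt0 //; lra.
have dn x : d x != 0 by rewrite gt_eqF.
pose H x := f x * (d x)^-1; exists H.
have H0 x : x <= 0 -> H x = 0 by move=> h; rewrite /H /f flat1_le0 // mul0r.
have H1 x : 1 <= x -> H x = 1.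
  by move=> h; rewrite /H /d [f (_ + _)]flat1_le0 ?addr0 ?divff // ?gt_eqF ?flat1_gt0 //; lra.
have H01 x : 0 <= H x <= 1.
  rewrite /H divr_ge0 ?flat1_ge0 ?(ltW (d0 _)) //= ler_pdivrMr // mul1r /d lerDl.
  exact: flat1_ge0.
split => //.
- have sf : smooth f by exact: smooth_flat.
  apply: smoothM => // n; apply: smooth_uptoV => //.
  by apply: smooth_uptoD; [exact: sf|apply: smooth_upto_affine; exact: sf].
- move=> x; case: (leP x 1) => h.
    by rewrite (H0 (x - 1)) ?(andP (H01 x)).1 //; lra.
  by rewrite (H1 x (ltW h)) (andP (H01 _)).2.
Qed.

Lemma primitive_exists f : smooth f -> (forall x, x <= 0 -> f x = 0) ->
  exists F, (forall x, is_derive x (1 : R) F (f x)) /\ (forall x, x <= 0 -> F x = 0).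
Proof.
move=> sf f0; have cf := smooth_continuous sf.
(* The base point -1 lies strictly to the left of every [x >= 0], so the fundamental theorem applies
   at [x = 0] as well. *)
pose F x : R := \int[@lebesgue_measure R]_(t in `[-1, x]) f t.
have F0 x : x <= 0 -> F x = 0.
  move=> x0; rewrite /F (@eq_Rintegral _ _ _ _ _ (cst 0)); last first.
    move=> t; rewrite inE /= in_itv /= => /andP[_ tx]; rewrite f0 //; exact: le_trans tx x0.
  by rewrite /Rintegral /= integral0.
exists F; split => // x.
have [x0|x0] := ltP x 0.
  rewrite (f0 _ (ltW x0)); apply: (@near_eq_is_derive R R^o R^o (cst 0)).
    near=> y; rewrite F0 //; near: y; exact: lt_le_nbhsl.
have [|||d e] := @continuous_FTC1_closed R f (-1) x (x + 1) _ _ _ (cf x).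
- by rewrite ltrDl.
- apply: continuous_compact_integrable; first exact: segment_compact.
  exact: continuous_subspaceT.
- by lra.
by rewrite -e derive1E; apply: derivableP.
Unshelve. all: by end_near. Qed.

Lemma is_derive_shift1 F (f : R -> R) x a : (forall x, is_derive x (1 : R) F (f x)) ->
  is_derive x (1 : R) (fun y => F (y - a)) (f (x - a)).
Proof.
move=> h; have ha : is_derive x 1 (fun x : R => x - a) 1.
  by apply: is_derive_eq; rewrite subr0.
by have := @is_derive1_comp _ F _ x _ _ (h _) ha; rewrite mulr1.
Qed.

(** As in the recursion for B-splines, [H'] is the convolution of [H] with the indicator of
    [[0, 1]]. Its derivative is therefore a difference of two values of [H], the source of the exact
    finite differences below. *)
Lemma step_next k H : is_step k H -> exists H', is_step k.+1 H' /\
  forall x, is_derive x (1 : R) H' (H x - H (x - 1)).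
Proof.
case=> sH H0 H1 H01 Hm; have [P [dP P0]] := primitive_exists sH H0.
pose H' x := P x - P (x - 1); exists H'.
have dH' x : is_derive x (1 : R) H' (H x - H (x - 1)).
  have := @is_deriveB _ _ _ P (fun y => P (y - 1)) x 1 _ _ (dP x) (is_derive_shift1 x 1 dP); exact.
split => //.
have mv x : exists c, x - 1 <= c <= x /\ H' x = H c.
  have [|c [hc e]] := @mean_value P H (x - 1) x _ dP; first by lra.
  by exists c; split => //; rewrite /H' e (_ : x - (x - 1) = 1) ?mulr1 //; lra.
split.
- have sP := smooth_primitive dP sH.
  apply: smoothD => //; apply: smoothN.
  have := smooth_affine 1 (-1) sP; congr smooth; by apply/funext => x; rewrite mul1r.
- by move=> x x0; rewrite /H' !P0 ?subr0 //; lra.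
- by move=> x; rewrite -natr1 => h; have [c [/andP[hc _] ->]] := mv x; rewrite H1 //; lra.
- by move=> x; have [c [_ ->]] := mv x.
- move=> x; have [|c [_ e]] := @mean_value H' _ (x - 1) x _ dH'; first by lra.
  rewrite -subr_ge0 e mulr_ge0 ?subr_ge0 //; lra.
Qed.

Lemma steps_exist : exists Hs : nat -> R -> R, (forall k, is_step k.+1 (Hs k)) /\
  forall k x, is_derive x (1 : R) (Hs k.+1) (Hs k x - Hs k (x - 1)).
Proof.
have [H1 h1] := step1.
pose T := {kH : nat * (R -> R) | is_step kH.1.+1 kH.2}.
have nxt (a : T) : {b : T | (sval b).1 = (sval a).1.+1 /\
    forall x, is_derive x (1 : R) (sval b).2 ((sval a).2 x - (sval a).2 (x - 1))}.
  case: a => -[k H] /= s; apply: cid; have [H' [s' d']] := step_next s.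
  by exists (exist _ (k.+1, H') s').
pose seq := fix seq n : T := if n is m.+1 then sval (nxt (seq m)) else exist _ (0%N, H1) h1.
have idx n : (sval (seq n)).1 = n.
  by elim: n => //= n IH; case: (svalP (nxt (seq n))) => -> _; rewrite IH.
exists (fun n => (sval (seq n)).2); split => k.
  by have := svalP (seq k); rewrite idx.
by move=> x; case: (svalP (nxt (seq k))).
Qed.

End Steps.

(** * The space L^2(S) *)
Section L2space.
Variable R : realType.
Notation S := (@Sdom R).
Notation mu := (@mu2 R).
Implicit Types (f g h m : R * R -> R).

Lemma SdomE : S = (`]0, 1[%classic `*` `](- 2^-1), 2^-1[%classic : set (R * R)).
Proof. by apply/seteqP; split => -[s t] /=; rewrite /Sdom /= !in_itv. Qed.

(* The product measure [mu2] lives on [measurableTypeR R * measurableTypeR R]; the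
   canonical measurable structure of [R * R] is convertible to it but not
   syntactically equal. *)
Notation TT := (measurableTypeR R * measurableTypeR R)%type.

Lemma measurable_Sdom : measurable (S : set TT).
Proof. by rewrite SdomE; apply: measurableX; exact: measurable_itv. Qed.
Let mS := measurable_Sdom.

Lemma mu2_Sdom : mu S = 1%E.
Proof.
rewrite SdomE /mu2 product_measure1E; [|exact: measurable_itv..].
rewrite [X in (X * _)%E](lebesgue_measure_itv `]0, 1[) [X in (_ * X)%E](lebesgue_measure_itv `](- 2^-1), 2^-1[).
rewrite /= !lte_fin ltr01 ifT; last by lra.
by rewrite -!EFinB -EFinM; congr EFin; lra.
Qed.

Notation intg f := (mu.-integrable S (EFin \o f)).
Notation msr f := (@measurable_fun _ _ TT R S f).
Definition int2 f := \int[mu]_(x in S) f x.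

Lemma intg_msr f : intg f -> msr f.
Proof. by move/integrableP => -[/measurable_EFinP]. Qed.

Lemma intgD f g : intg f -> intg g -> intg (fun x => f x + g x).
Proof. by move=> hf hg; have := integrableD mS hf hg. Qed.

Lemma intgZ a f : intg f -> intg (fun x => a * f x).
Proof. by move=> hf; have := integrableZl mS a hf. Qed.

Lemma intg_le f g : msr f -> (forall x, S x -> `|f x| <= g x) -> intg g -> intg f.
Proof.
move=> mf h ig; apply: (le_integrable mS _ _ ig); first exact/measurable_EFinP.
move=> x Sx /=; rewrite lee_fin; apply: (le_trans (h x Sx)); exact: ler_norm.
Qed.

Lemma intg_cst a : intg (fun=> a).
Proof.
apply: (measurable_bounded_integrable mS); first by have := ltry (1 : R); rewrite -mu2_Sdom.
  exact: measurable_cst.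
by exists `|a|; split => // b ab x _ /=; exact: ltW.
Qed.

Lemma intg_bounded M f : msr f -> (forall x, S x -> `|f x| <= M) -> intg f.
Proof. by move=> mf h; apply: (intg_le mf h); exact: intg_cst. Qed.

Lemma intg_eq f g : (forall x, S x -> f x = g x) -> intg f -> intg g.
Proof.
move=> e; apply: eq_integrable => // x; rewrite inE => Sx /=; by rewrite e.
Qed.

Lemma msr_eq f g : (forall x, S x -> f x = g x) -> msr f -> msr g.
Proof. by move=> e; apply: eq_measurable_fun => x; rewrite inE; exact: e. Qed.

Lemma int2_eq f g : (forall x, S x -> f x = g x) -> int2 f = int2 g.
Proof. by move=> e; apply: eq_Rintegral => x; rewrite inE; exact: e. Qed.

Lemma int2D f g : intg f -> intg g -> int2 (fun x => f x + g x) = int2 f + int2 g.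
Proof. by move=> hf hg; rewrite /int2 RintegralD. Qed.

Lemma int2Z a f : intg f -> int2 (fun x => a * f x) = a * int2 f.
Proof. by move=> hf; rewrite /int2 RintegralZl. Qed.

Lemma int2_cst a : int2 (fun=> a) = a.
Proof.
rewrite /int2 Rintegral_cst // [X in fine X](_ : _ = 1%E) ?mulr1 //.
exact: mu2_Sdom.
Qed.

Lemma int2_ge0 f : (forall x, S x -> 0 <= f x) -> 0 <= int2 f.
Proof. by move=> h; apply: Rintegral_ge0. Qed.

Lemma int2_le f g : intg f -> intg g -> (forall x, S x -> f x <= g x) -> int2 f <= int2 g.
Proof. by move=> hf hg h; apply: le_Rintegral. Qed.

Lemma L2P f : L2 f <-> msr f /\ intg (fun x => f x ^+ 2).
Proof. by split => -[h1 h2]; split => //; exact: h1. Qed.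

Lemma L2_msr f : L2 f -> msr f. Proof. by case. Qed.

Lemma msrM f g : msr f -> msr g -> msr (fun x => f x * g x).
Proof. by move=> a b; have := measurable_funM a b. Qed.
Lemma msrD f g : msr f -> msr g -> msr (fun x => f x + g x).
Proof. by move=> a b; have := measurable_funD a b. Qed.
Lemma msr_cst a : msr (fun=> a).
Proof. exact: measurable_cst. Qed.
Lemma msrZ a f : msr f -> msr (fun x => a * f x).
Proof. by move=> mf; apply: msrM => //; exact: msr_cst. Qed.

Lemma L2_intgM f g : L2 f -> L2 g -> intg (fun x => f x * g x).
Proof.
move=> [mf f2] [mg g2]; apply: (@intg_le _ (fun x => f x ^+ 2 + g x ^+ 2)).
- exact: msrM.
- move=> x _; rewrite ler_norml; apply/andP; split.
    have := sqr_ge0 (f x + g x); have := sqr_ge0 (f x); have := sqr_ge0 (g x); nra.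
  have := sqr_ge0 (f x - g x); have := sqr_ge0 (f x); have := sqr_ge0 (g x); nra.
- exact: intgD.
Qed.

Lemma L2D f g : L2 f -> L2 g -> L2 (fun x => f x + g x).
Proof.
move=> hf hg; case: (hf) => mf f2; case: (hg) => mg g2; split; first exact: msrD.
have := intgD (intgD f2 (intgZ 2 (L2_intgM hf hg))) g2.
by apply: intg_eq => x _; ring.
Qed.

Lemma bounded_L2M M m f : msr m -> (forall x, S x -> `|m x| <= M) -> L2 f ->
  L2 (fun x => m x * f x).
Proof.
move=> mm hm [mf f2]; split; first exact: msrM.
apply: (@intg_le _ (fun x => M ^+ 2 * f x ^+ 2)).
- by have := msrM (msrM mm mf) (msrM mm mf); apply: msr_eq => x _; rewrite expr2.
- move=> x Sx; rewrite ger0_norm ?sqr_ge0 // exprMn ler_wpM2r ?sqr_ge0 //.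
  by rewrite -real_normK ?num_real // lerXn2r ?nnegrE ?hm // (le_trans _ (hm x Sx)).
- exact: intgZ.
Qed.

Lemma bounded_L2 M m : msr m -> (forall x, S x -> `|m x| <= M) -> L2 m.
Proof.
move=> mm hm; split => //; apply: (@intg_bounded (M ^+ 2)).
  by have := msrM mm mm; apply: msr_eq => x _; rewrite expr2.
move=> x Sx; rewrite ger0_norm ?sqr_ge0 //.
by rewrite -real_normK ?num_real // lerXn2r ?nnegrE ?hm // (le_trans _ (hm x Sx)).
Qed.

Lemma L2_cst (a : R) : L2 (fun _ : R * R => a).
Proof. by apply: (@bounded_L2 `|a|) => //; exact: msr_cst. Qed.

Lemma L2Z a f : L2 f -> L2 (fun x => a * f x).
Proof. by apply: (@bounded_L2M `|a|) => //; exact: msr_cst. Qed.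

Lemma L2_eq f g : (forall x, S x -> f x = g x) -> L2 f -> L2 g.
Proof.
move=> e [mf f2]; split; first exact: msr_eq e mf.
by apply: intg_eq f2 => x Sx; rewrite e.
Qed.

Lemma L2N f : L2 f -> L2 (fun x => - f x).
Proof. by move/(L2Z (-1)); apply: L2_eq => x _; rewrite mulN1r. Qed.

Lemma L2B f g : L2 f -> L2 g -> L2 (fun x => f x - g x).
Proof. by move=> hf hg; apply: L2D => //; exact: L2N. Qed.

Lemma L2_sum (n : nat) (F : 'I_n -> R * R -> R) :
  (forall i, L2 (F i)) -> L2 (fun x => \sum_i F i x).
Proof.
elim: n F => [|n IH] F h.
  by apply: L2_eq (L2_cst 0) => x _; rewrite big_ord0.
apply: (L2_eq _ (L2D (h ord0) (IH (fun i => F (lift ord0 i)) (fun i => h _)))) => x _.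
by rewrite big_ord_recl.
Qed.

Lemma L2_intg f : L2 f -> intg f.
Proof.
by move=> hf; apply: intg_eq (L2_intgM hf (L2_cst 1)) => x _; rewrite mulr1.
Qed.

Definition ip f g := int2 (fun x => f x * g x).
Definition nrm f := Num.sqrt (ip f f).

Lemma ipC f g : ip f g = ip g f.
Proof. by apply: int2_eq => x _; rewrite mulrC. Qed.

Lemma ip_eq f f' g g' : (forall x, S x -> f x = f' x) -> (forall x, S x -> g x = g' x) ->
  ip f g = ip f' g'.
Proof. by move=> e e'; apply: int2_eq => x Sx; rewrite e // e'. Qed.

Lemma ipDl f g h : L2 f -> L2 g -> L2 h -> ip (fun x => f x + g x) h = ip f h + ip g h.
Proof.
move=> hf hg hh; rewrite /ip -int2D; try exact: L2_intgM.
by apply: int2_eq => x _; rewrite mulrDl.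
Qed.

Lemma ipZl a f h : L2 f -> L2 h -> ip (fun x => a * f x) h = a * ip f h.
Proof.
move=> hf hh; rewrite /ip -int2Z; last exact: L2_intgM.
by apply: int2_eq => x _; rewrite mulrA.
Qed.

Lemma ipDr f g h : L2 f -> L2 g -> L2 h -> ip h (fun x => f x + g x) = ip h f + ip h g.
Proof. by move=> *; rewrite ipC ipDl // !(ipC h). Qed.
Lemma ipZr a f h : L2 f -> L2 h -> ip h (fun x => a * f x) = a * ip h f.
Proof. by move=> *; rewrite ipC ipZl // (ipC h). Qed.
Lemma ipNl f h : L2 f -> L2 h -> ip (fun x => - f x) h = - ip f h.
Proof.
move=> hf hh; rewrite -mulN1r -ipZl //; apply: ip_eq => // x _; by rewrite mulN1r.
Qed.
Lemma ipBl f g h : L2 f -> L2 g -> L2 h -> ip (fun x => f x - g x) h = ip f h - ip g h.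
Proof. by move=> hf hg hh; rewrite ipDl ?ipNl //; exact: L2N. Qed.
Lemma ipBr f g h : L2 f -> L2 g -> L2 h -> ip h (fun x => f x - g x) = ip h f - ip h g.
Proof. by move=> *; rewrite ipC ipBl // !(ipC h). Qed.

Lemma ip_ge0 f : 0 <= ip f f.
Proof. by apply: int2_ge0 => x _; rewrite -expr2 sqr_ge0. Qed.

Lemma ip_suml (n : nat) (F : 'I_n -> R * R -> R) g : (forall i, L2 (F i)) -> L2 g ->
  ip (fun x => \sum_i F i x) g = \sum_i ip (F i) g.
Proof.
elim: n F => [|n IH] F hF hg.
  rewrite big_ord0 (@ip_eq _ (fun=> 0) g g) //; last by move=> x _; rewrite big_ord0.
  by rewrite /ip (@int2_eq _ (fun=> 0)) ?int2_cst // => x _; rewrite mul0r.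
rewrite big_ord_recl -IH //.
rewrite -ipDl //; first by apply: ip_eq => // x _; rewrite big_ord_recl.
exact: L2_sum.
Qed.

Lemma cauchy_schwarz f g : L2 f -> L2 g -> (ip f g) ^+ 2 <= ip f f * ip g g.
Proof.
move=> hf hg.
have q a b : 0 <= a ^+ 2 * ip f f + 2 * (a * b) * ip f g + b ^+ 2 * ip g g.
  have := ip_ge0 (fun x => a * f x + b * g x).
  have ha := L2Z a hf; have hb := L2Z b hg.
  rewrite ipDl ?ipDr ?ipZl ?ipZr //; try exact: L2D.
  by rewrite (ipC g f); lra.
have [g0|g0] := eqVneq (ip g g) 0.
  have h := q ; rewrite g0 mulr0.
  have [->|n0] := eqVneq (ip f g) 0; first by rewrite expr0n.
  have := q 1 (- (ip f f + 1) / (2 * ip f g)); rewrite g0.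
  have -> : 2 * (1 * (- (ip f f + 1) / (2 * ip f g))) * ip f g = - (ip f f + 1).
    by field.
  lra.
have gp : 0 < ip g g by rewrite lt_def g0 ip_ge0.
have := q (ip g g) (- ip f g) => h.
rewrite -(ler_pM2l gp); lra.
Qed.

Lemma nrm_ge0 f : 0 <= nrm f. Proof. exact: sqrtr_ge0. Qed.
Lemma nrm_sqr f : nrm f ^+ 2 = ip f f. Proof. by rewrite sqr_sqrtr // ip_ge0. Qed.

Lemma ip_le_nrm f g : L2 f -> L2 g -> `|ip f g| <= nrm f * nrm g.
Proof.
move=> hf hg; rewrite -(@ler_pXn2r _ 2) ?nnegrE ?mulr_ge0 ?nrm_ge0 //.
by rewrite real_normK ?num_real // exprMn !nrm_sqr; exact: cauchy_schwarz.
Qed.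

Lemma nrmD f g : L2 f -> L2 g -> nrm (fun x => f x + g x) <= nrm f + nrm g.
Proof.
move=> hf hg; rewrite -(@ler_pXn2r _ 2) ?nnegrE ?addr_ge0 ?nrm_ge0 //.
rewrite nrm_sqr ipDl ?ipDr //; last exact: L2D.
rewrite (ipC g f) -!nrm_sqr; have := ip_le_nrm hf hg; rewrite ler_norml => /andP[_].
lra.
Qed.

Lemma nrm_eq f g : (forall x, S x -> f x = g x) -> nrm f = nrm g.
Proof. by move=> e; rewrite /nrm (ip_eq e e). Qed.

Lemma nrm_le f g : L2 f -> L2 g -> (forall x, S x -> `|f x| <= `|g x|) -> nrm f <= nrm g.
Proof.
move=> hf hg h; rewrite ler_sqrt ?ip_ge0 //; apply: int2_le; try exact: L2_intgM.
move=> x Sx; rewrite -!expr2 -[f x ^+ 2]real_normK ?num_real // -[g x ^+ 2]real_normK ?num_real //.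
by rewrite lerXn2r ?nnegrE ?h.
Qed.

Lemma nrmZ a f : L2 f -> nrm (fun x => a * f x) = `|a| * nrm f.
Proof.
move=> hf; rewrite /nrm ipZl ?ipZr //; last exact: L2Z.
by rewrite mulrA -expr2 sqrtrM ?sqr_ge0 // sqrtr_sqr.
Qed.

Lemma nrmN f : nrm (fun x => - f x) = nrm f.
Proof. by rewrite /nrm; congr Num.sqrt; apply: int2_eq => x _; rewrite mulrNN. Qed.

Lemma nrmB f g : L2 f -> L2 g -> nrm (fun x => f x - g x) <= nrm f + nrm g.
Proof. by move=> hf hg; rewrite -(nrmN g); apply: nrmD => //; exact: L2N. Qed.

Lemma nrmM_le M m f : msr m -> (forall x, S x -> `|m x| <= M) -> 0 <= M -> L2 f ->
  nrm (fun x => m x * f x) <= M * nrm f.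
Proof.
move=> mm hm M0 hf; rewrite -[M in M * _]ger0_norm // -nrmZ //.
apply: nrm_le; [exact: bounded_L2M hm hf|exact: L2Z|].
by move=> x Sx; rewrite !normrM ler_wpM2r // (ger0_norm M0) hm.
Qed.

End L2space.

(** * Bumps and their partition of unity *)

Section Bumps.
Variable R : realType.
Variable Hs : nat -> R -> R.
Hypothesis hs : forall k, is_step k.+1 (Hs k).
Hypothesis hd : forall k x, is_derive x (1 : R) (Hs k.+1) (Hs k x - Hs k (x - 1)).

(** By [hd] this is also the derivative of [Hs k.+1], so the steps provide explicit primitives of
    the bumps. *)
Definition bump k x := Hs k x - Hs k (x - 1).

Lemma bump_ge0 k x : 0 <= bump k x.
Proof. by rewrite subr_ge0; case: (hs k). Qed.

Lemma bump_le0 k x : x <= 0 -> bump k x = 0.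
Proof. by move=> x0; rewrite /bump; case: (hs k) => _ h0 _ _ _; rewrite !h0 ?subrr //; lra. Qed.

Lemma bump_large k x : k.+2%:R <= x -> bump k x = 0.
Proof.
rewrite -natr1 => x0; rewrite /bump; case: (hs k) => _ _ h1 _ _; rewrite !h1 ?subrr //; lra.
Qed.

Lemma bump_support k x : bump k x != 0 -> 0 < x < k.+2%:R.
Proof.
move=> h; rewrite !ltNge; apply/andP; split; apply/negP => h'; move: h.
  by rewrite bump_le0 // eqxx.
by rewrite bump_large // eqxx.
Qed.

Lemma sum_bump k x M : \sum_(i < M) bump k (x - i%:R) = Hs k x - Hs k (x - M%:R).
Proof.
elim: M => [|M IH]; first by rewrite big_ord0 subr0 subrr.
rewrite big_ord_recr /= IH /bump (_ : x - M.+1%:R = x - M%:R - 1); first by ring.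
by rewrite -natr1; ring.
Qed.

Lemma sum_bump_le1 k x M : \sum_(i < M) bump k (x - i%:R) <= 1.
Proof.
rewrite sum_bump; case: (hs k) => _ _ _ h _.
by have /andP[_ a] := h x; have /andP[b _] := h (x - M%:R); lra.
Qed.

Lemma sum_bump_eq1 k x M : k.+1%:R <= x -> x <= M%:R -> \sum_(i < M) bump k (x - i%:R) = 1.
Proof.
move=> h1 h2; rewrite sum_bump; case: (hs k) => _ a b _ _.
by rewrite b // a ?subr0 //; lra.
Qed.

Lemma bump_smooth k : smooth (bump k).
Proof.
case: (hs k) => s _ _ _ _; apply: smoothD => //; apply: smoothN.
by have := smooth_affine 1 (-1) s; congr smooth; apply/funext => x; rewrite mul1r.
Qed.

Lemma bump_der k x : is_derive x (1 : R) (bump k.+1) (bump k x - bump k (x - 1)).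
Proof.
have := @is_deriveB _ _ _ (Hs k.+1) (fun y => Hs k.+1 (y - 1)) x 1 _ _ (hd k x)
  (is_derive_shift1 x 1 (hd k)); exact.
Qed.

End Bumps.

(** * Smooth approximation of Lipschitz functions *)

Section Approximation.
Variable R : realType.

Lemma continuous_bounded_itv (q : R -> R) a b : continuous q ->
  exists K, 0 <= K /\ forall x, a <= x <= b -> `|q x| <= K.
Proof.
move=> cq; have [ab|ba] := leP a b; last first.
  by exists 0; split => // x /andP[h1 h2]; have := le_trans h1 h2; rewrite leNgt ba.
have [|c _ hc] := @EVT_max R (fun x => `|q x|) a b ab.
  apply: continuous_subspaceT => x; apply: continuous_comp; first exact: cq.
  exact: norm_continuous.
by exists `|q c|; split => // x xab; apply: hc; rewrite in_itv.
Qed.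

Lemma C1_lipschitz (q q' : R -> R) a b : (forall x, is_derive x (1 : R) q (q' x)) ->
  continuous q' ->
  exists K, 0 <= K /\ forall x y, a <= x <= b -> a <= y <= b -> `|q x - q y| <= K * `|x - y|.
Proof.
move=> dq cq; have [K [K0 hK]] := continuous_bounded_itv a b cq.
exists K; split => // x y; wlog xy : x y / y <= x => [th|].
  case: (leP y x) => [|/ltW] h hx hy; first exact: th.
  by rewrite distrC (distrC x); apply: th.
move=> /andP[ax xb] /andP[ay yb]; have [c [/andP[h1 h2] ->]] := mean_value xy dq.
by rewrite normrM ler_wpM2r // hK // (le_trans ay h1) (le_trans h2 xb).
Qed.

(** A quasi-interpolant: values [q (i / N)] weighted by bumps, whose primitive is the same sum with
    steps. The offset 3 puts [[0, 1]] where the bumps sum to 1; the nodes then run up to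
    [(N + 3) / N <= 4], hence the interval [[0, 4]]. *)
Lemma smooth_approximation (q : R -> R) (K d : R) : 0 <= K -> 0 < d ->
  (forall x y : R, 0 <= x <= 4 -> 0 <= y <= 4 -> `|q x - q y| <= K * `|x - y|) ->
  exists P Q : R -> R, [/\ forall x, is_derive x (1 : R) P (Q x), smooth Q &
    forall s, 0 <= s <= 1 -> `|Q s - q s| <= d].
Proof.
move=> K0 d0 hK; have [Hs [hs hd]] := steps_exist R.
(* The error is at most [3 * K / N], because a bump that does not vanish at [s] belongs to a node
   within [3 / N] of [s]. *)
pose N := (Num.bound (3 * K / d)).+1.
have N0 : 0 < N%:R :> R by rewrite ltr0n.
have Nd : 3 * K / N%:R <= d.
  rewrite ler_pdivrMr // [d * _]mulrC -ler_pdivrMr //; apply: ltW.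
  apply: (lt_le_trans (archi_boundP _)); first by rewrite divr_ge0 ?mulr_ge0 // ltW.
  by rewrite ler_nat leqnSn.
pose Q s := \sum_(i < N + 4) q (i%:R / N%:R) * bump Hs 0 (N%:R * s + (3 - i%:R)).
pose P s := \sum_(i < N + 4) (q (i%:R / N%:R) / N%:R) * Hs 1 (N%:R * s + (3 - i%:R)).
exists P, Q; split.
- move=> x.
  have h (i : 'I_(N + 4)) : is_derive x (1 : R)
      (fun s => (q (i%:R / N%:R) / N%:R) * Hs 1 (N%:R * s + (3 - i%:R)))
      (q (i%:R / N%:R) * bump Hs 0 (N%:R * x + (3 - i%:R))).
    have ha : is_derive x 1 (fun s : R => N%:R * s + (3 - i%:R)) N%:R.
      apply: is_derive_eq; rewrite /GRing.scale /=; ring.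
    have := @is_derive1_comp _ (Hs 1) _ x _ _ (hd 0%N _) ha => h1.
    have h2 := is_deriveZ (q (i%:R / N%:R) / N%:R) h1.
    apply: is_derive_eq h2 _; rewrite /GRing.scale /bump /=; field.
    by rewrite gt_eqF.
  have := is_derive_sum h.
  by congr is_derive; apply/funext => s; rewrite fct_sumE.
- apply: (@smooth_sum R _ _ (fun (i : 'I_(N + 4)) s => q (i%:R / N%:R) * bump Hs 0 (N%:R * s + (3 - i%:R)))) => i.
  apply: smoothM; first exact: smooth_cst.
  by apply: smooth_affine; exact: bump_smooth.
- move=> s /andP[s0 s1]; set x := N%:R * s + 3.
  have x3 : 3 <= x by rewrite lerDr mulr_ge0.
  have xN : x <= (N + 4)%:R.
    rewrite /x natrD; have : N%:R * s <= N%:R * 1 by apply: ler_wpM2l.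
    lra.
  have S1 : \sum_(i < N + 4) bump Hs 0 (x - i%:R) = 1 by apply: sum_bump_eq1 => //; lra.
  have -> : Q s - q s = \sum_(i < N + 4) (q (i%:R / N%:R) - q s) * bump Hs 0 (x - i%:R).
    have e : q s = \sum_(i < N + 4) q s * bump Hs 0 (x - i%:R) by rewrite -mulr_sumr S1 mulr1.
    rewrite [in LHS]e /Q -sumrB; apply: eq_bigr => i _.
    by rewrite /x addrA mulrBl.
  apply: (le_trans (ler_norm_sum _ _ _)); apply: (@le_trans _ _ (\sum_(i < N + 4) d * bump Hs 0 (x - i%:R))).
    apply: ler_sum => i _; rewrite normrM (ger0_norm (bump_ge0 hs _ _)).
    have [->|n0] := eqVneq (bump Hs 0 (x - i%:R)) 0; first by rewrite !mulr0.
    apply: ler_wpM2r; first exact: bump_ge0.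
    have /andP[i1 i2] := bump_support hs n0.
    apply: (le_trans (hK _ _ _ _)).
    + rewrite divr_ge0 //= ler_pdivrMr //.
      have : (i <= N + 3)%N by rewrite -ltnS -addnS.
      rewrite -(ler_nat R) natrD => h.
      have : 1 <= N%:R :> R by rewrite (ler_nat _ 1).
      lra.
    + by rewrite s0 /=; lra.
    + apply: le_trans Nd; rewrite -[3 * K]mulrC -mulrA ler_wpM2l //.
      rewrite -[s](mulfK (lt0r_neq0 N0)) -mulrBl normrM [`|N%:R^-1|]ger0_norm ?invr_ge0 //.
      rewrite ler_wpM2r ?invr_ge0 // ler_norml.
      by rewrite /x in i1 i2; apply/andP; split; lra.
  by rewrite -mulr_sumr S1 mulr1.
Qed.

End Approximation.

(** * Weak derivatives *)
Section Tensor.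
Variable R : realType.
Notation S := (@Sdom R).
Notation TT := (measurableTypeR R * measurableTypeR R)%type.
Notation msr f := (@measurable_fun _ _ TT R S f).
Implicit Types (F G m : R -> R) (f g v : R * R -> R).

Definition tensor F G : R * R -> R := fun x => F x.1 * G x.2.

Lemma is_derive_fst f (x : R * R) (d : R) :
  is_derive x.1 (1 : R) (fun s => f (s, x.2)) d -> is_derive x ((1, 0) : R * R) f d.
Proof.
have e : (fun h : R => h^-1 *: ((f \o shift x) (h *: ((1, 0) : R * R)) - f x)) =
  (fun h : R => h^-1 *: (((fun s => f (s, x.2)) \o shift x.1) (h *: (1 : R)) - f (x.1, x.2))).
  apply/funext => h /=; congr (_ *: (f _ - f _)); last by case: x.
  by case: x => a b /=; congr pair; rewrite /= /GRing.scale /= mulr0 add0r.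
by case=> dv de; apply: DeriveDef; rewrite /derivable /derive e.
Qed.

Lemma is_derive_snd f (x : R * R) (d : R) :
  is_derive x.2 (1 : R) (fun t => f (x.1, t)) d -> is_derive x ((0, 1) : R * R) f d.
Proof.
have e : (fun h : R => h^-1 *: ((f \o shift x) (h *: ((0, 1) : R * R)) - f x)) =
  (fun h : R => h^-1 *: (((fun t => f (x.1, t)) \o shift x.2) (h *: (1 : R)) - f (x.1, x.2))).
  apply/funext => h /=; congr (_ *: (f _ - f _)); last by case: x.
  by case: x => a b /=; congr pair; rewrite /= /GRing.scale /= mulr0 add0r.
by case=> dv de; apply: DeriveDef; rewrite /derivable /derive e.
Qed.

Lemma dir0 : dir R ord0 = (1, 0). Proof. by []. Qed.
Lemma dir1 : dir R (lift ord0 ord0) = (0, 1). Proof. by []. Qed.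

Lemma ord2_cases (j : 'I_2) : j = ord0 \/ j = lift ord0 ord0.
Proof.
case: j => -[|[|//]] h; [left|right]; exact: val_inj.
Qed.

Lemma tensor_derive_fst F G (x : R * R) : smooth F ->
  is_derive x (dir R ord0) (tensor F G) (tensor (derive1 F) G x).
Proof.
move=> sF; rewrite dir0; apply: is_derive_fst; rewrite /tensor /=.
have := @is_deriveM _ _ F (cst (G x.2)) x.1 1 _ _ (smooth_is_derive sF x.1) (is_derive_cst _ _ _).
by move=> h; apply: is_derive_eq h _; rewrite scaler0 add0r /GRing.scale /= mulrC.
Qed.

Lemma tensor_derive_snd F G (x : R * R) : smooth G ->
  is_derive x (dir R (lift ord0 ord0)) (tensor F G) (tensor F (derive1 G) x).
Proof.
move=> sG; rewrite dir1; apply: is_derive_snd; rewrite /tensor /=.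
have := @is_deriveM _ _ (cst (F x.1)) G x.2 1 _ _ (is_derive_cst _ _ _) (smooth_is_derive sG x.2).
by move=> h; apply: is_derive_eq h _; rewrite scaler0 addr0.
Qed.

Lemma pderiv_tensor0 F G : smooth F -> pderiv ord0 (tensor F G) = tensor (derive1 F) G.
Proof. by move=> sF; apply/funext => x; case: (tensor_derive_fst G x sF). Qed.

Lemma pderiv_tensor1 F G : smooth G ->
  pderiv (lift ord0 ord0) (tensor F G) = tensor F (derive1 G).
Proof. by move=> sG; apply/funext => x; case: (tensor_derive_snd F x sG). Qed.

Lemma tensor_continuous F G : continuous F -> continuous G -> continuous (tensor F G).
Proof.
move=> cF cG x; apply: cvgM.
  apply: continuous_comp; [exact: cvg_fst|exact: cF].
apply: continuous_comp; [exact: cvg_snd|exact: cG].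
Qed.

Lemma tensor_smooth2 F G : smooth F -> smooth G -> smooth2 (tensor F G).
Proof.
move=> sF sG js.
have [F' [G' [sF' [sG' ->]]]] : exists F' G', smooth F' /\ smooth G' /\
    iter_pderiv js (tensor F G) = tensor F' G'.
  elim: js => [|j js [F' [G' [sF' [sG' e]]]]]; first by exists F, G.
  rewrite /= -/(iter_pderiv js _) e; case: (ord2_cases j) => ->.
    by exists (derive1 F'), G'; rewrite pderiv_tensor0 //; split => //; exact: smooth_derive1.
  by exists F', (derive1 G'); rewrite pderiv_tensor1 //; do !split => //; exact: smooth_derive1.
split; first by apply: tensor_continuous; exact: smooth_continuous.
move=> j x; case: (ord2_cases j) => ->.
  by case: (tensor_derive_fst G' x sF').
by case: (tensor_derive_snd F' x sG').
Qed.

Definition bump_in (lo hi : R) F := smooth F /\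
  exists a b, [/\ lo < a, a < b, b < hi & forall s, ~ (a <= s <= b) -> F s = 0].
Notation tests := (bump_in 0 1).
Notation testt := (bump_in (- 2^-1) (2^-1)).

Lemma tensor_test F G : tests F -> testt G -> test_fun (tensor F G).
Proof.
move=> [sF [a [b [h1 h2 h3 hF]]]] [sG [c [d [h4 h5 h6 hG]]]].
split; first exact: tensor_smooth2.
exists a, b, c, d; do !split => //; move=> x /not_andP[h|h]; rewrite /tensor.
  by rewrite hF ?mul0r.
by rewrite hG ?mulr0.
Qed.

Lemma bump_inM lo hi m F : smooth m -> bump_in lo hi F -> bump_in lo hi (fun s => m s * F s).
Proof.
move=> sm [sF [a [b [h1 h2 h3 hF]]]]; split; first exact: smoothM.
by exists a, b; split => // s h; rewrite hF // mulr0.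
Qed.

Lemma continuous_msr1 m : continuous m -> msr (fun x => m x.1).
Proof.
move=> cm; apply: (@measurable_funTS _ _ TT); apply: measurableT_comp.
  exact: continuous_measurable_fun.
exact: measurable_fst.
Qed.

Lemma continuous_msr2 m : continuous m -> msr (fun x => m x.2).
Proof.
move=> cm; apply: (@measurable_funTS _ _ TT); apply: measurableT_comp.
  exact: continuous_measurable_fun.
exact: measurable_snd.
Qed.

Lemma continuous_bounded1 m : continuous m ->
  exists M, 0 <= M /\ forall x, S x -> `|m x.1| <= M.
Proof.
move=> cm; have [M [M0 hM]] := continuous_bounded_itv 0 1 cm.
by exists M; split => // x [/andP[h1 h2] _]; rewrite hM // !ltW.
Qed.

Lemma continuous_bounded2 m : continuous m ->
  exists M, 0 <= M /\ forall x, S x -> `|m x.2| <= M.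
Proof.
move=> cm; have [M [M0 hM]] := continuous_bounded_itv (- 2^-1) 2^-1 cm.
by exists M; split => // x [_ /andP[h1 h2]]; rewrite hM // !ltW.
Qed.

Lemma tensor_bounded F G : continuous F -> continuous G ->
  msr (tensor F G) /\ exists M, 0 <= M /\ forall x, S x -> `|tensor F G x| <= M.
Proof.
move=> cF cG; split.
  by apply: msrM; [exact: continuous_msr1|exact: continuous_msr2].
have [M [M0 hM]] := continuous_bounded1 cF; have [N [N0 hN]] := continuous_bounded2 cG.
exists (M * N); split; first exact: mulr_ge0.
by move=> x Sx; rewrite normrM; apply: ler_pM; rewrite ?hM ?hN.
Qed.

Lemma tensor_L2 F G : continuous F -> continuous G -> L2 (tensor F G).
Proof. by move=> cF cG; have [mt [M [_ hM]]] := tensor_bounded cF cG; exact: bounded_L2 hM. Qed.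

Lemma L2_mul1 m f : continuous m -> L2 f -> L2 (fun x => m x.1 * f x).
Proof.
move=> cm; have [M [_ hM]] := continuous_bounded1 cm; apply: bounded_L2M hM.
exact: continuous_msr1.
Qed.

(** Only products are used as test functions: the sampling kernels are of this kind, and derivatives
    of a product stay products. *)
Definition weak_s f g := forall F G, tests F -> testt G ->
  ip f (tensor (derive1 F) G) = - ip g (tensor F G).
Definition weak_t f g := forall F G, tests F -> testt G ->
  ip f (tensor F (derive1 G)) = - ip g (tensor F G).

Lemma weak_pderiv_s f g : weak_pderiv ord0 f g -> weak_s f g.
Proof.
move=> h F G tF tG; have := h _ (tensor_test tF tG).
by rewrite pderiv_tensor0 //; case: tF.
Qed.

Lemma weak_pderiv_t f g : weak_pderiv (lift ord0 ord0) f g -> weak_t f g.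
Proof.
move=> h F G tF tG; have := h _ (tensor_test tF tG).
by rewrite pderiv_tensor1 //; case: tG.
Qed.

Lemma test_continuous lo hi F : bump_in lo hi F -> continuous F.
Proof. by case=> sF _; exact: smooth_continuous. Qed.
Lemma test_dcontinuous lo hi F : bump_in lo hi F -> continuous (derive1 F).
Proof. by case=> sF _; apply/smooth_continuous/smooth_derive1. Qed.

Lemma weak_sD f g f' g' : L2 f -> L2 g -> L2 f' -> L2 g' -> weak_s f f' -> weak_s g g' ->
  weak_s (fun x => f x + g x) (fun x => f' x + g' x).
Proof.
move=> hf hg hf' hg' w w' F G tF tG.
have cF := test_continuous tF; have cG := test_continuous tG; have cF' := test_dcontinuous tF.
rewrite !ipDl ?w ?w' ?opprD //; exact: tensor_L2.
Qed.

Lemma weak_tD f g f' g' : L2 f -> L2 g -> L2 f' -> L2 g' -> weak_t f f' -> weak_t g g' ->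
  weak_t (fun x => f x + g x) (fun x => f' x + g' x).
Proof.
move=> hf hg hf' hg' w w' F G tF tG.
have cF := test_continuous tF; have cG := test_continuous tG; have cG' := test_dcontinuous tG.
rewrite !ipDl ?w ?w' ?opprD //; exact: tensor_L2.
Qed.

Lemma eq0_of_small (a C : R) : (forall d, 0 < d -> d <= 1 -> `|a| <= C * d) -> a = 0.
Proof.
move=> h; apply/eqP; rewrite -normr_le0 leNgt; apply/negP => a0.
have C0 : 0 < C by have := h 1 ltr01 (lexx _); lra.
have := h (Num.min 1 (`|a| / (2 * C))) _ _; rewrite ge_min lexx lt_min ltr01 divr_gt0 ?mulr_gt0 //=.
move=> /(_ isT isT) h1.
have : C * Num.min 1 (`|a| / (2 * C)) <= C * (`|a| / (2 * C)).
  by apply: ler_wpM2l; [exact: ltW|rewrite ge_min lexx orbT].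
have -> : C * (`|a| / (2 * C)) = `|a| / 2 by field; rewrite gt_eqF.
lra.
Qed.

(** The derivative is approximated and the result integrated with the right value at 0, which makes
    both functions close at once. *)
Lemma C2_smooth_approximation m m' m'' d : (forall x, is_derive x (1 : R) m (m' x)) ->
  (forall x, is_derive x (1 : R) m' (m'' x)) -> continuous m'' -> 0 < d ->
  exists P : R -> R, smooth P /\ forall s, 0 <= s <= 1 ->
    `|m s - P s| <= d /\ `|m' s - derive1 P s| <= d.
Proof.
move=> dm dm' cm'' d0; have [K [K0 hK]] := C1_lipschitz 0 4 dm' cm''.
have [P [Q [dP sQ hQ]]] := smooth_approximation K0 d0 hK.
have sP := smooth_primitive dP sQ.
exists (fun s => P s + (m 0 - P 0)); split; first by apply: smoothD => //; exact: smooth_cst.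
have dP' x : is_derive x (1 : R) (fun s => P s + (m 0 - P 0)) (Q x).
  by have := @is_deriveD _ _ _ P (cst (m 0 - P 0)) x 1 _ _ (dP x) (is_derive_cst _ _ _); rewrite addr0.
move=> s /andP[s0 s1].
have -> : derive1 (fun s => P s + (m 0 - P 0)) s = Q s by rewrite derive1E; case: (dP' s).
split; last by rewrite distrC hQ // s0.
pose D x := m x - (P x + (m 0 - P 0)).
have dD x : is_derive x (1 : R) D (m' x - Q x) by have := is_deriveB (dm x) (dP' x); exact.
have [c [/andP[c0 cs] e]] := mean_value s0 dD.
have D0 : D 0 = 0 by rewrite /D; ring.
rewrite -/(D s) -[D s]subr0 -D0 e normrM subr0 distrC.
have h : `|Q c - m' c| <= d by rewrite hQ // c0 (le_trans cs).
by rewrite -[leRHS]mulr1; apply: ler_pM => //; rewrite ger0_norm.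
Qed.

(** The coefficient is only of class [C^2], so its product with a test function is not a test
    function. The identity is exact for smooth coefficients, and [m] and [m'] are approximated
    uniformly by such a coefficient and its derivative. *)
Lemma weak_mul m m' m'' f fs ft : (forall x, is_derive x (1 : R) m (m' x)) ->
  (forall x, is_derive x (1 : R) m' (m'' x)) -> continuous m'' ->
  L2 f -> L2 fs -> L2 ft -> weak_s f fs -> weak_t f ft ->
  weak_s (fun x => m x.1 * f x) (fun x => m x.1 * fs x + m' x.1 * f x) /\
  weak_t (fun x => m x.1 * f x) (fun x => m x.1 * ft x).
Proof.
move=> dm dm' cm'' hf hfs hft ws wt.
have cm : continuous m := is_derive_continuous dm.
have cm' : continuous m' := is_derive_continuous dm'.
have S01 x : S x -> 0 <= x.1 <= 1 by case=> /andP[? ?] _; rewrite !ltW.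
have small (h : R * R -> R) (q : R -> R) F G d : L2 h -> continuous q -> continuous F -> continuous G ->
    (forall s, 0 <= s <= 1 -> `|q s| <= d) -> 0 <= d ->
    `|ip h (tensor (fun s => q s * F s) G)| <= (nrm h * nrm (tensor F G)) * d.
  move=> hh cq cF cG hq d0.
  have hT := tensor_L2 cF cG.
  have hT' : L2 (fun x => q x.1 * tensor F G x) by exact: L2_mul1.
  rewrite (@ip_eq _ h h _ (fun x => q x.1 * tensor F G x)) //; last by move=> x _; rewrite /tensor mulrA.
  apply: (le_trans (ip_le_nrm hh hT')); rewrite -mulrA; apply: ler_wpM2l; first exact: nrm_ge0.
  rewrite mulrC; apply: nrmM_le => //; first exact: continuous_msr1.
  by move=> x Sx; apply: hq; exact: S01.
have cB (a b : R -> R) : continuous a -> continuous b -> continuous (fun x => a x - b x).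
  by move=> ca cb x; apply: cvgB; [exact: ca|exact: cb].
have cM (a b : R -> R) : continuous a -> continuous b -> continuous (fun x => a x * b x).
  by move=> ca cb x; apply: cvgM; [exact: ca|exact: cb].
split=> F G tF tG.
- have cF := test_continuous tF; have cG := test_continuous tG; have cF' := test_dcontinuous tF.
  have [sF _] := tF.
  pose T1 (q : R -> R) := ip f (tensor (fun s => q s * derive1 F s) G).
  pose T2 (q : R -> R) := ip f (tensor (fun s => q s * F s) G).
  pose T3 (q : R -> R) := ip fs (tensor (fun s => q s * F s) G).
  suff e : T1 m + T2 m' + T3 m = 0.
    have hT := tensor_L2 cF cG; have hT' := tensor_L2 cF' cG.
    rewrite ipDl //; try exact: L2_mul1.
    have -> : ip (fun x => m x.1 * f x) (tensor (derive1 F) G) = T1 m.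
      by apply: int2_eq => x _; rewrite /tensor; ring.
    have -> : ip (fun x => m' x.1 * f x) (tensor F G) = T2 m'.
      by apply: int2_eq => x _; rewrite /tensor; ring.
    have -> : ip (fun x => m x.1 * fs x) (tensor F G) = T3 m.
      by apply: int2_eq => x _; rewrite /tensor; ring.
    lra.
  apply: (@eq0_of_small _ (nrm f * nrm (tensor (derive1 F) G) + nrm f * nrm (tensor F G)
     + nrm fs * nrm (tensor F G))) => d d0 _.
  have [P [sP hP]] := C2_smooth_approximation dm dm' cm'' d0.
  have cP := smooth_continuous sP; have cP' := smooth_continuous (smooth_derive1 sP).
  have z : T1 P + T2 (derive1 P) + T3 P = 0.
    have := ws _ _ (bump_inM sP tF) tG.
    have -> : derive1 (fun s => P s * F s) = (fun s => P s * derive1 F s + derive1 P s * F s).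
      apply/funext => s; rewrite derive1E.
      have := @is_deriveM _ _ P F s 1 _ _ (smooth_is_derive sP s) (smooth_is_derive sF s).
      by case=> _ ->; rewrite /GRing.scale /= [F s * _]mulrC.
    rewrite -/(T3 P) (@ip_eq _ f f _ (fun x => tensor (fun s => P s * derive1 F s) G x
      + tensor (fun s => derive1 P s * F s) G x)) //; last by move=> x _; rewrite /tensor mulrDl.
    rewrite ipDr // -/(T1 P) -/(T2 (derive1 P)) => [->||]; first by rewrite addNr.
      by apply: tensor_L2 => //; exact: cM.
    by apply: tensor_L2 => //; exact: cM.
  have lin (h : R * R -> R) (q p : R -> R) (E : R -> R) : L2 h -> continuous q -> continuous p -> continuous E ->
      ip h (tensor (fun s => q s * E s) G) - ip h (tensor (fun s => p s * E s) G) =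
      ip h (tensor (fun s => (q s - p s) * E s) G).
    move=> hh cq cp cE; rewrite -ipBr //; try by apply: tensor_L2 => //; exact: cM.
    by apply: int2_eq => x _; rewrite /tensor; ring.
  have -> : T1 m + T2 m' + T3 m = (T1 m - T1 P) + (T2 m' - T2 (derive1 P)) + (T3 m - T3 P) by lra.
  rewrite !lin // !mulrDl.
  apply: (le_trans (ler_normD _ _)); apply: lerD; last first.
    by apply: small => //; [exact: cB|move=> s h; case: (hP s h)|exact: ltW].
  apply: (le_trans (ler_normD _ _)); apply: lerD.
    by apply: small => //; [exact: cB|move=> s h; case: (hP s h)|exact: ltW].
  by apply: small => //; [exact: cB|move=> s h; case: (hP s h)|exact: ltW].
- have cF := test_continuous tF; have cG := test_continuous tG; have cG' := test_dcontinuous tG.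
  pose T1 (q : R -> R) := ip f (tensor (fun s => q s * F s) (derive1 G)).
  pose T3 (q : R -> R) := ip ft (tensor (fun s => q s * F s) G).
  suff e : T1 m + T3 m = 0.
    have -> : ip (fun x => m x.1 * f x) (tensor F (derive1 G)) = T1 m.
      by apply: int2_eq => x _; rewrite /tensor; ring.
    have -> : ip (fun x => m x.1 * ft x) (tensor F G) = T3 m.
      by apply: int2_eq => x _; rewrite /tensor; ring.
    lra.
  apply: (@eq0_of_small _ (nrm f * nrm (tensor F (derive1 G)) + nrm ft * nrm (tensor F G))) => d d0 _.
  have [P [sP hP]] := C2_smooth_approximation dm dm' cm'' d0.
  have cP := smooth_continuous sP.
  have z : T1 P + T3 P = 0.
    by have := wt _ _ (bump_inM sP tF) tG; rewrite -/(T3 P) -/(T1 P) => ->; rewrite addNr.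
  have lin (h : R * R -> R) (q p : R -> R) (E : R -> R) : L2 h -> continuous q -> continuous p -> continuous E ->
      ip h (tensor (fun s => q s * F s) E) - ip h (tensor (fun s => p s * F s) E) =
      ip h (tensor (fun s => (q s - p s) * F s) E).
    move=> hh cq cp cE; rewrite -ipBr //; try by apply: tensor_L2 => //; exact: cM.
    by apply: int2_eq => x _; rewrite /tensor; ring.
  have -> : T1 m + T3 m = (T1 m - T1 P) + (T3 m - T3 P) by lra.
  rewrite !lin // mulrDl.
  apply: (le_trans (ler_normD _ _)); apply: lerD.
    by apply: small => //; [exact: cB|move=> s h; case: (hP s h)|exact: ltW].
  by apply: small => //; [exact: cB|move=> s h; case: (hP s h)|exact: ltW].
Qed.

End Tensor.

(** * Fubini's theorem and integrals of derivatives *)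

Section Fubini.
Variable R : realType.
Notation S := (@Sdom R).
Notation mu := (@mu2 R).
Notation TT := (measurableTypeR R * measurableTypeR R)%type.
Notation msr f := (@measurable_fun _ _ TT R S f).
Notation intg f := (mu.-integrable S (EFin \o f)).

Lemma integral_derivative_itv (P p : R -> R) a b : a < b ->
  (forall s, is_derive s (1 : R) P (p s)) -> continuous p -> P a = P b ->
  (\int[@lebesgue_measure R]_(x in `]a, b[) (p x)%:E = 0)%E.
Proof.
move=> ab dP cp e.
have mp (i : interval R) : measurable_fun [set` i] (EFin \o p).
  apply: measurable_funTS; apply/measurable_EFinP; exact: continuous_measurable_fun.
rewrite -(integral_itv_bndoo true false); last exact: (mp `]a, b[).
rewrite (@continuous_FTC2 _ p P) //.
- by rewrite e -EFinB subrr.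
- exact: continuous_subspaceT.
- have cP := is_derive_continuous dP.
  split => [x _||]; first by case: (dP x).
    by apply: cvg_at_right_filter; exact: cP.
  by apply: cvg_at_left_filter; exact: cP.
- by move=> x _; rewrite derive1E; case: (dP x).
Qed.

Lemma int2_ds (P p : R * R -> R) : intg p ->
  (forall t, - 2^-1 < t < 2^-1 -> forall s, is_derive s (1 : R) (fun s => P (s, t)) (p (s, t))) ->
  (forall t, - 2^-1 < t < 2^-1 -> continuous (fun s => p (s, t))) ->
  (forall t, - 2^-1 < t < 2^-1 -> P (0, t) = P (1, t)) -> int2 p = 0.
Proof.
move=> ip dP cp eP; rewrite /int2 /Rintegral integral_mkcond.
have i' := (integrable_mkcond _ (@measurable_Sdom R)).1 ip.
rewrite -(integral21_prod_meas1 i') integral0_eq // => t _.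
rewrite /fubini_G.
have [ht|ht] := boolP (- 2^-1 < t < 2^-1).
  rewrite -[RHS](integral_derivative_itv ltr01 (dP t ht) (cp t ht) (eP t ht)).
  rewrite [RHS]integral_mkcond; apply: eq_integral => s _.
  rewrite /patch; congr (if _ then _ else _); apply/idP/idP; rewrite !inE /Sdom /= in_itv /=.
    by case.
  by move=> ->.
rewrite integral0_eq // => s _; rewrite /patch ifF //; apply/negbTE/negP; rewrite inE => -[_ /= h].
by rewrite h in ht.
Qed.

Lemma int2_dt (P p : R * R -> R) : intg p ->
  (forall s, 0 < s < 1 -> forall t, is_derive t (1 : R) (fun t => P (s, t)) (p (s, t))) ->
  (forall s, 0 < s < 1 -> continuous (fun t => p (s, t))) ->
  (forall s, 0 < s < 1 -> P (s, - 2^-1) = P (s, 2^-1)) -> int2 p = 0.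
Proof.
move=> ip dP cp eP; rewrite /int2 /Rintegral integral_mkcond.
have i' := (integrable_mkcond _ (@measurable_Sdom R)).1 ip.
have lt : - 2^-1 < 2^-1 :> R by lra.
rewrite -(integral12_prod_meas1 i') integral0_eq // => s _.
rewrite /fubini_F.
have [hs|hs] := boolP (0 < s < 1).
  rewrite -[RHS](integral_derivative_itv lt (dP s hs) (cp s hs) (eP s hs)).
  rewrite [RHS]integral_mkcond; apply: eq_integral => t _.
  rewrite /patch; congr (if _ then _ else _); apply/idP/idP; rewrite !inE /Sdom /= in_itv /=.
    by case.
  by move=> ->.
rewrite integral0_eq // => t _; rewrite /patch ifF //; apply/negbTE/negP; rewrite inE => -[/= h _].
by rewrite h in hs.
Qed.

Lemma is_derive_mulr (P p : R -> R) (s c : R) : is_derive s (1 : R) P (p s) ->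
  is_derive s (1 : R) (fun s => P s * c) (p s * c).
Proof.
move=> h; have := @is_deriveM _ _ P (cst c) s 1 _ _ h (is_derive_cst _ _ _).
by move=> h'; apply: is_derive_eq h' _; rewrite scaler0 add0r /GRing.scale /= mulrC.
Qed.

Lemma is_derive_mull (P p : R -> R) (s c : R) : is_derive s (1 : R) P (p s) ->
  is_derive s (1 : R) (fun s => c * P s) (c * p s).
Proof.
move=> h; have := @is_deriveM _ _ (cst c) P s 1 _ _ (is_derive_cst _ _ _) h.
by move=> h'; apply: is_derive_eq h' _; rewrite scaler0 addr0.
Qed.

(** Subtracting the mean slope turns a factor into the derivative of a function with equal values at
    both ends, whose integral vanishes. This is done in s and then in t, until a constant is
    left. *)
Lemma int2_tensor (P p Q q : R -> R) :
  (forall s, is_derive s (1 : R) P (p s)) -> (forall s, is_derive s (1 : R) Q (q s)) ->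
  continuous p -> continuous q ->
  int2 (tensor p q) = (P 1 - P 0) * (Q 2^-1 - Q (- 2^-1)).
Proof.
move=> dP dQ cp cq.
pose a := P 1 - P 0; pose b := Q 2^-1 - Q (- 2^-1).
have ct : continuous (fun _ : R => 1 : R) by move=> x; exact: cvg_cst.
have L1 : L2 (tensor p q) by exact: tensor_L2.
have L3 : L2 (tensor (fun=> 1) q) by exact: tensor_L2.
have e1 : int2 (fun x : R * R => tensor p q x - a * tensor (fun=> 1) q x) = 0.
  apply: (@int2_ds (fun x => (P x.1 - a * x.1) * q x.2)).
  - by apply: L2_intg; apply: L2B => //; exact: L2Z.
  - move=> t _ s /=; have -> : tensor p q (s, t) - a * tensor (fun=> 1) q (s, t) = (p s - a) * q t.
      by rewrite /tensor /=; ring.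
    apply: (@is_derive_mulr (fun s => P s - a * s) (fun s => p s - a)).
    have h1 := @is_derive_mull id (fun=> 1) s a (is_derive_id _ _).
    have h2 := is_deriveB (dP s) h1; apply: is_derive_eq h2 _; by rewrite mulr1.
  - move=> t _ s; rewrite /tensor /=; apply: cvgB; last exact: cvg_cst.
    by apply: cvgM; [exact: cp|exact: cvg_cst].
  - by move=> t _ /=; rewrite /a; ring.
have e2 : int2 (fun x : R * R => tensor (fun=> 1) q x - b) = 0.
  apply: (@int2_dt (fun x => Q x.2 - b * x.2)).
  - by apply: L2_intg; apply: L2B => //; exact: L2_cst.
  - move=> s _ t /=; rewrite /tensor /= mul1r.
    have h1 := @is_derive_mull id (fun=> 1) t b (is_derive_id _ _).
    have h2 := is_deriveB (dQ t) h1; apply: is_derive_eq h2 _; by rewrite mulr1.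
  - move=> s _ t; rewrite /tensor /=; apply: cvgB; last exact: cvg_cst.
    by apply: cvgM; [exact: cvg_cst|exact: cq].
  - by move=> s _ /=; rewrite /b; field.
have Lb : L2 (fun _ : R * R => b) := L2_cst b.
have i2 : int2 (tensor (fun=> 1) q) = b.
  apply/eqP; rewrite -subr_eq0; apply/eqP; rewrite -[RHS]e2 -[in LHS](int2_cst b) -mulN1r -int2Z; last exact: L2_intg.
  rewrite -int2D; [|exact: L2_intg|by apply: intgZ; exact: L2_intg].
  by apply: int2_eq => x _; rewrite mulN1r.
rewrite -/a -/b -i2; apply/eqP; rewrite -subr_eq0; apply/eqP; rewrite -[RHS]e1.
rewrite -mulNr -int2Z; last exact: L2_intg.
rewrite -int2D; [|exact: L2_intg|by apply: intgZ; exact: L2_intg].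
by apply: int2_eq => x _; rewrite mulNr.
Qed.

End Fubini.

(** * Approximation of measurable sets by bounded continuous functions *)

Section Density.
Variable R : realType.
Notation S := (@Sdom R).
Notation mu := (@mu2 R).
Notation TT := (measurableTypeR R * measurableTypeR R)%type.
Notation msr f := (@measurable_fun _ _ TT R S f).
Notation intg f := (mu.-integrable S (EFin \o f)).

Lemma int2_dominated (h_ : nat -> R * R -> R) (h g : R * R -> R) :
  (forall n, msr (h_ n)) -> msr h -> (forall x, S x -> h_ ^~ x @ \oo --> h x) ->
  intg g -> (forall n x, S x -> `|h_ n x| <= g x) ->
  (fun n => int2 (h_ n)) @ \oo --> int2 h.
Proof.
move=> mh_ mh cv ig le.
have ih_ n : intg (h_ n) by apply: (intg_le (mh_ n) (le n) ig).
have mh_' n : measurable_fun (S : set TT) (EFin \o h_ n) by exact/measurable_EFinP.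
have mh' : measurable_fun (S : set TT) (EFin \o h) by exact/measurable_EFinP.
have [||ih _ lim] := @dominated_convergence _ TT R mu S (@measurable_Sdom R)
  (fun n => EFin \o h_ n) (EFin \o h) (EFin \o g) mh_' mh' _ ig _.
- by apply: aeW => x Sx; apply: cvg_EFin; [by apply: nearW|exact: cv].
- by apply: aeW => x n Sx; rewrite /= lee_fin; exact: le.
have e (q : R * R -> R) : intg q -> (\int[mu]_(x in S) (EFin \o q) x = (int2 q)%:E)%E.
  by move=> iq; rewrite /int2 /Rintegral fineK //; exact: (integrable_fin_num (@measurable_Sdom R) iq).
rewrite e // in lim.
exact: fine_cvg lim.
Qed.

Definition good (g : R * R -> R) :=
  [/\ msr g, exists M, 0 <= M /\ forall x, `|g x| <= M & continuous g].

Lemma good_cst (a : R) : good (fun=> a).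
Proof.
split; [exact: msr_cst|by exists (`|a|); split|by move=> x; exact: cvg_cst].
Qed.

Lemma goodD f g : good f -> good g -> good (fun x => f x + g x).
Proof.
move=> [mf [M [M0 hM]] cf] [mg [N [N0 hN]] cg]; split; first exact: msrD.
  exists (M + N); split; first exact: addr_ge0.
  by move=> x; apply: (le_trans (ler_normD _ _)); exact: lerD.
by move=> x; apply: cvgD; [exact: cf|exact: cg].
Qed.

Lemma goodM f g : good f -> good g -> good (fun x => f x * g x).
Proof.
move=> [mf [M [M0 hM]] cf] [mg [N [N0 hN]] cg]; split; first exact: msrM.
  exists (M * N); split; first exact: mulr_ge0.
  by move=> x; rewrite normrM; exact: ler_pM.
by move=> x; apply: cvgM; [exact: cf|exact: cg].
Qed.

Lemma goodZ a g : good g -> good (fun x => a * g x).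
Proof. by move=> hg; apply: goodM => //; exact: good_cst. Qed.

Lemma good_L2 g : good g -> L2 g.
Proof. by move=> [mg [M [_ hM]] _]; apply: (bounded_L2 mg (M := M)) => x _. Qed.

(** The sets with this property form a sigma-algebra, so half-open strips suffice. Values in
    [[0, 1]] make products serve for intersections and turn the [L^1] bound into an [L^2] bound. *)
Definition approximable (A : set TT) := measurable A /\ forall d : R, 0 < d ->
  exists g, [/\ good g, forall x, 0 <= g x <= 1 & int2 (fun x => `|g x - \1_A x|) <= d].

Lemma msr_indic (A : set TT) : measurable A -> msr (\1_A : R * R -> R).
Proof. by move=> mA; apply: (@measurable_funTS _ _ TT); exact: measurable_indic. Qed.

Lemma indic01 (A : set TT) x : 0 <= (\1_A x : R) <= 1.
Proof. by rewrite indicE; case: (x \in A); rewrite ?lexx ler01. Qed.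

Lemma msr_norm (f : R * R -> R) : msr f -> msr (fun x => `|f x|).
Proof. by move=> mf; apply: measurableT_comp. Qed.

Lemma msrB (f g : R * R -> R) : msr f -> msr g -> msr (fun x => f x - g x).
Proof. by move=> mf mg; have := measurable_funB mf mg. Qed.

Lemma intg_diff_indic g (A : set TT) : good g -> measurable A -> intg (fun x => `|g x - \1_A x|).
Proof.
move=> [mg [M [M0 hM]] _] mA; apply: (@intg_bounded _ (M + 1)).
  by apply: msr_norm; apply: msrB => //; exact: msr_indic.
move=> x _; rewrite normr_id; apply: (le_trans (ler_normB _ _)); apply: lerD => //.
by have /andP[a b] := indic01 A x; rewrite ger0_norm.
Qed.

Lemma approximableC A : approximable A -> approximable (~` A).
Proof.
move=> [mA h]; split; first exact: measurableC.
move=> d d0; have [g [gg g01 gd]] := h d d0.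
exists (fun x => 1 - g x); split.
- by have := goodD (good_cst 1) (goodZ (-1) gg); congr good; apply/funext => x; rewrite mulN1r.
- by move=> x; have /andP[a b] := g01 x; apply/andP; split; lra.
- rewrite (@int2_eq _ _ (fun x => `|g x - \1_A x|)) // => x _.
  rewrite !indicE in_setC; case: (x \in A) => /=; rewrite -normrN; congr `|_|; ring.
Qed.

Lemma approximableI A B : approximable A -> approximable B -> approximable (A `&` B).
Proof.
move=> [mA hA] [mB hB]; split; first exact: measurableI.
move=> d d0; have d2 : 0 < d / 2 by rewrite divr_gt0.
have [g [gg g01 gd]] := hA _ d2; have [h [gh h01 hd]] := hB _ d2.
exists (fun x => g x * h x); split; first exact: goodM.
  move=> x; have /andP[a b] := g01 x; have /andP[a' b'] := h01 x.
  by rewrite mulr_ge0 //= mulr_ile1.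
have ig := intg_diff_indic gg mA; have ih := intg_diff_indic gh mB.
have ip := intg_diff_indic (goodM gg gh) (measurableI _ _ mA mB).
apply: (@le_trans _ _ (int2 (fun x => `|g x - \1_A x| + `|h x - \1_B x|))).
  apply: int2_le => //; first exact: intgD.
  move=> x _; rewrite indicI /=.
  have -> : g x * h x - \1_A x * \1_B x = (g x - \1_A x) * h x + \1_A x * (h x - \1_B x) by ring.
  apply: (le_trans (ler_normD _ _)); rewrite !normrM; apply: lerD.
    by rewrite -[leRHS]mulr1; apply: ler_wpM2l => //; have /andP[a b] := h01 x; rewrite ger0_norm.
  by rewrite -[leRHS]mul1r; apply: ler_wpM2r => //; have /andP[a b] := indic01 A x; rewrite ger0_norm.
rewrite int2D //; lra.
Qed.

(** Dominated convergence. Countable unions use it with finite unions, and strips with the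
    trapezoids [tent]. *)
Lemma approximable_lim (A : set TT) (h_ : nat -> R * R -> R) : measurable A ->
  (forall n, msr (h_ n)) -> (forall n x, 0 <= h_ n x <= 1) ->
  (forall x, h_ ^~ x @ \oo --> (\1_A x : R)) ->
  (forall n d, 0 < d -> exists g, [/\ good g, forall x, 0 <= g x <= 1 &
     int2 (fun x => `|g x - h_ n x|) <= d]) ->
  approximable A.
Proof.
move=> mA mh h01 cv ap; split => // d d0.
have b1 n x : `|h_ n x| <= 1 by have /andP[a b] := h01 n x; rewrite ger0_norm.
have b2 x : `|\1_A x : R| <= 1 by have /andP[a b] := indic01 A x; rewrite ger0_norm.
have mA' := msr_indic mA.
have lim : (fun n => int2 (fun x => `|h_ n x - \1_A x|)) @ \oo --> int2 (fun _ : R * R => (0 : R)).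
  apply: (@int2_dominated _ _ (fun=> 2)).
  - by move=> n; apply: msr_norm; exact: msrB.
  - exact: msr_cst.
  - by move=> x _; apply/norm_cvg0P; apply/subr_cvg0; exact: cv.
  - exact: intg_cst.
  - move=> n x _; rewrite normr_id; apply: (le_trans (ler_normB _ _)).
    by have := b1 n x; have := b2 x; lra.
rewrite int2_cst in lim.
have d2 : 0 < d / 2 by rewrite divr_gt0.
have [n _ hn] := (cvgr0Pnorm_lt _).1 lim _ d2.
have := hn n (leqnn n) => /= hn'.
have {}hn' : int2 (fun x => `|h_ n x - \1_A x|) <= d / 2 by apply: le_trans (ltW hn'); exact: ler_norm.
have [g [gg g01 gd]] := ap n _ d2.
exists g; split => //.
have i1 : intg (fun x => `|g x - h_ n x|).
  case: gg => mg [M [M0 hM]] _; apply: (@intg_bounded _ (M + 1)); first by apply: msr_norm; exact: msrB.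
  by move=> x _; rewrite normr_id; apply: (le_trans (ler_normB _ _)); apply: lerD.
have i2 : intg (fun x => `|h_ n x - \1_A x|).
  apply: (@intg_bounded _ 2); first by apply: msr_norm; exact: msrB.
  move=> x _; rewrite normr_id; apply: (le_trans (ler_normB _ _)).
  by have := b1 n x; have := b2 x; lra.
apply: (@le_trans _ _ (int2 (fun x => `|g x - h_ n x| + `|h_ n x - \1_A x|))); last first.
  by rewrite int2D //; lra.
apply: int2_le; [exact: intg_diff_indic|exact: intgD|].
by move=> x _; exact: ler_distD.
Qed.

Lemma approximable0 : approximable set0.
Proof.
split=> // d d0; exists (fun=> 0); split; [exact: good_cst|by move=> x; rewrite lexx ler01|].
rewrite (@int2_eq _ _ (fun=> 0)) ?int2_cst ?ltW // => x _.
by rewrite indic0 /= subr0 normr0.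
Qed.

Lemma approximable_bigcup (A : (set TT)^nat) : (forall n, approximable (A n)) ->
  approximable (\bigcup_n A n).
Proof.
move=> h.
have U n : approximable (\big[setU/set0]_(i < n) A i).
  elim: n => [|n IH]; first by rewrite big_ord0; exact: approximable0.
  rewrite big_ord_recr /= -[_ `|` _]setCK setCU; apply: approximableC.
  by apply: approximableI; apply: approximableC.
have mU : measurable (\bigcup_n A n) by apply: bigcup_measurable => n _; case: (h n).
apply: (approximable_lim (h_ := fun n => \1_(\big[setU/set0]_(i < n) A i))) => //.
- by move=> n; apply: msr_indic; case: (U n).
- by move=> n x; exact: indic01.
- move=> x; apply: cvg_near_cst; have [xA|xA] := pselect ((\bigcup_n A n) x).
    have [k _ Ak] := xA; near=> n; rewrite !indicE [in RHS]mem_set // mem_set //.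
    rewrite -bigcup_mkord; exists k => //=; near: n; exact: nbhs_infty_gt.
  near=> n; rewrite !indicE [in RHS]memNset // memNset // -bigcup_mkord => -[k _ Ak].
  by apply: xA; exists k.
- by move=> n; case: (U n).
Unshelve. all: by end_near. Qed.

(** The truncation of [x] to [[0, 1]], written with absolute values so that its continuity follows
    from that of the norm. *)
Definition clamp (x : R) : R := (`|x| - `|x - 1| + 1) / 2.

Lemma clamp01 x : 0 <= clamp x <= 1.
Proof.
rewrite /clamp; case: (ger0P x) => h; case: (ger0P (x - 1)) => h'; apply/andP; split; lra.
Qed.
Lemma clamp0 x : x <= 0 -> clamp x = 0.
Proof. by move=> h; rewrite /clamp (ler0_norm h) ler0_norm; lra. Qed.
Lemma clamp1 x : 1 <= x -> clamp x = 1.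
Proof. by move=> h; rewrite /clamp !ger0_norm; lra. Qed.

(** A trapezoid with both flanks to the right of the end points: it is 0 at [a] and, for large [n],
    1 at [b] when [a < b], so its limit is the indicator of the half-open interval []a, b]], a
    generator of the Borel sets. *)
Definition tent (n : nat) (a b x : R) := clamp (n%:R * (x - a)) * (1 - clamp (n%:R * (x - b))).

Lemma tent01 n a b x : 0 <= tent n a b x <= 1.
Proof.
rewrite /tent; have /andP[h1 h2] := clamp01 (n%:R * (x - a)); have /andP[h3 h4] := clamp01 (n%:R * (x - b)).
have h5 : 0 <= 1 - clamp (n%:R * (x - b)) by lra.
by rewrite mulr_ge0 //= mulr_ile1 //; lra.
Qed.

Lemma clamp_continuous (n : nat) (a : R) : continuous (fun x : R => clamp (n%:R * (x - a))).
Proof.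
move=> x; rewrite /clamp.
have c1 : (n%:R * (y - a) : R) @[y --> x] --> (n%:R * (x - a) : R).
  by apply: cvgMr; apply: cvgB; [exact: cvg_id|exact: cvg_cst].
apply: cvgMl; apply: cvgD; last exact: cvg_cst.
apply: cvgB; first exact: cvg_norm c1.
by apply: cvg_norm; apply: cvgB; [exact: c1|exact: cvg_cst].
Qed.

Lemma tent_continuous n a b : continuous (tent n a b).
Proof.
move=> x; apply: cvgM; first exact: clamp_continuous.
by apply: cvgB; [exact: cvg_cst|exact: clamp_continuous].
Qed.

Lemma tent_cvg a b (x : R) : (fun n => tent n a b x) @ \oo --> (\1_(`]a, b]%classic : set R) x : R).
Proof.
apply: cvg_near_cst; rewrite indicE.
have big (y : R) : 0 < y -> \forall n \near \oo, 1 <= n%:R * y.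
  move=> y0; near=> n; rewrite -ler_pdivrMr // mul1r; near: n.
  exact: nbhs_infty_ger.
have [xa|ax] := leP x a.
  apply: nearW => n; rewrite memNset /=; last by rewrite in_itv /= ltNge xa.
  by rewrite /tent clamp0 ?mul0r // mulr_ge0_le0 //; lra.
have [xb|bx] := leP x b.
  have xa' : 0 < x - a by lra.
  near=> n; rewrite mem_set /=; last by rewrite in_itv /= ax xb.
  rewrite /tent clamp1 ?clamp0 ?subr0 ?mulr1 //; first by rewrite mulr_ge0_le0 //; lra.
  by near: n; exact: big.
have bx' : 0 < x - b by lra.
near=> n; rewrite memNset /=; last by rewrite in_itv /= ax leNgt bx.
rewrite /tent [clamp (_ * (x - b))]clamp1 ?subrr ?mulr0 //.
by near: n; exact: big.
Unshelve. all: by end_near. Qed.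

Lemma approximable_fst a b : approximable (fst @^-1` `]a, b]).
Proof.
have mA : measurable (fst @^-1` `]a, b] : set TT).
  by rewrite -[X in measurable X]setTI; apply: (@measurable_fst _ _ (measurableTypeR R) (measurableTypeR R)) => //; exact: measurable_itv.
apply: (approximable_lim (h_ := fun n x => tent n a b x.1)) => //.
- by move=> n; apply: continuous_msr1; exact: tent_continuous.
- by move=> n x; exact: tent01.
- by move=> x; exact: tent_cvg.
- move=> n d d0; exists (fun x => tent n a b x.1); split; last 2 first.
  + by move=> x; exact: tent01.
  + by rewrite (@int2_eq _ _ (fun=> 0)) ?int2_cst ?ltW // => x _; rewrite subrr normr0.
  split; first by apply: continuous_msr1; exact: tent_continuous.
    by exists 1; split => // x; have /andP[h1 h2] := tent01 n a b x.1; rewrite ger0_norm.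
  by move=> x; apply: continuous_comp; [exact: cvg_fst|exact: tent_continuous].
Qed.

Lemma approximable_snd a b : approximable (snd @^-1` `]a, b]).
Proof.
have mA : measurable (snd @^-1` `]a, b] : set TT).
  by rewrite -[X in measurable X]setTI; apply: (@measurable_snd _ _ (measurableTypeR R) (measurableTypeR R)) => //; exact: measurable_itv.
apply: (approximable_lim (h_ := fun n x => tent n a b x.2)) => //.
- by move=> n; apply: continuous_msr2; exact: tent_continuous.
- by move=> n x; exact: tent01.
- by move=> x; exact: tent_cvg.
- move=> n d d0; exists (fun x => tent n a b x.2); split; last 2 first.
  + by move=> x; exact: tent01.
  + by rewrite (@int2_eq _ _ (fun=> 0)) ?int2_cst ?ltW // => x _; rewrite subrr normr0.
  split; first by apply: continuous_msr2; exact: tent_continuous.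
    by exists 1; split => // x; have /andP[h1 h2] := tent01 n a b x.2; rewrite ger0_norm.
  by move=> x; apply: continuous_comp; [exact: cvg_snd|exact: tent_continuous].
Qed.

Lemma measurable_approximable (A : set TT) : measurable A -> approximable A.
Proof.
have sig (p : TT -> measurableTypeR R) : (forall a b, approximable (p @^-1` `]a, b])) ->
    forall B, measurable (B : set (measurableTypeR R)) -> approximable (p @^-1` B).
  move=> hp B; rewrite /measurable /=.
  have : <<s R.-ocitv.-measurable >> `<=` [set B | approximable (p @^-1` B)].
    apply: smallest_sub.
      split; first by rewrite /= preimage_set0; exact: approximable0.
        by move=> C /= hC; rewrite setTD preimage_setC; exact: approximableC.
      by move=> F hF /=; rewrite preimage_bigcup; exact: approximable_bigcup.
    by move=> C /= [[a b] _ <-]; exact: hp.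
  by apply.
suff : g_sigma_preimageU (@fst (measurableTypeR R) (measurableTypeR R)) (@snd (measurableTypeR R) (measurableTypeR R)) `<=` [set A : set TT | approximable A] by apply.
apply: smallest_sub.
  split; first exact: approximable0.
    by move=> C hC; rewrite setTD; exact: approximableC.
  by move=> F hF; exact: approximable_bigcup.
move=> C [|] [B mB <-]; rewrite setTI.
  by apply: (sig fst) => //; exact: approximable_fst.
by apply: (sig snd) => //; exact: approximable_snd.
Qed.

End Density.

(** * Density in L^2, and the norm by duality *)

Section L2Density.
Variable R : realType.
Notation S := (@Sdom R).
Notation mu := (@mu2 R).
Notation TT := (measurableTypeR R * measurableTypeR R)%type.
Notation msr f := (@measurable_fun _ _ TT R S f).
Notation intg f := (mu.-integrable S (EFin \o f)).
Implicit Types f g h : R * R -> R.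

Definition L2_approximable f := L2 f /\ forall d : R, 0 < d ->
  exists g, good g /\ nrm (fun x => f x - g x) <= d.

Lemma L2_approximable_indic (A : set TT) : measurable A -> L2_approximable (\1_A : R * R -> R).
Proof.
move=> mA; have b x : `|\1_A x : R| <= 1 by have /andP[a b] := indic01 A x; rewrite ger0_norm.
have LA : L2 (\1_A : R * R -> R) by apply: (bounded_L2 (msr_indic mA) (M := 1)) => x _.
split => // d d0; have [_ h] := measurable_approximable mA.
have [g [gg g01 gd]] := h _ (exprn_gt0 2 d0); exists g; split => //.
rewrite -(@ler_pXn2r _ 2) ?nnegrE ?nrm_ge0 ?(ltW d0) // nrm_sqr.
have Lg := good_L2 gg.
apply: le_trans gd; apply: int2_le.
- by apply: L2_intgM; exact: L2B.
- exact: intg_diff_indic.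
- move=> x _; rewrite -expr2 -sqrrN opprB -real_normK ?num_real //.
  rewrite expr2 -[leRHS]mulr1; apply: ler_wpM2l => //.
  have /andP[a1 a2] := g01 x; have /andP[a3 a4] := indic01 A x.
  by rewrite ler_norml; apply/andP; split; lra.
Qed.

Lemma L2_approximableD f g : L2_approximable f -> L2_approximable g ->
  L2_approximable (fun x => f x + g x).
Proof.
move=> [Lf hf] [Lg hg]; split; first exact: L2D.
move=> d d0; have d2 : 0 < d / 2 by rewrite divr_gt0.
have [f' [gf nf]] := hf _ d2; have [g' [gg ng]] := hg _ d2.
exists (fun x => f' x + g' x); split; first exact: goodD.
have Lf' := good_L2 gf; have Lg' := good_L2 gg.
rewrite (@nrm_eq _ _ (fun x => (f x - f' x) + (g x - g' x))); last by move=> x _; ring.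
by apply: (le_trans (nrmD (L2B Lf Lf') (L2B Lg Lg'))); lra.
Qed.

Lemma L2_approximableZ a f : L2_approximable f -> L2_approximable (fun x => a * f x).
Proof.
move=> [Lf hf]; split; first exact: L2Z.
move=> d d0; have a1 : 0 < `|a| + 1 by rewrite ltr_wpDl.
have [g [gg ng]] := hf _ (divr_gt0 d0 a1); exists (fun x => a * g x); split; first exact: goodZ.
have Lg := good_L2 gg.
rewrite (@nrm_eq _ _ (fun x => a * (f x - g x))); last by move=> x _; ring.
rewrite nrmZ; last exact: L2B.
apply: (@le_trans _ _ ((`|a| + 1) * (d / (`|a| + 1)))).
  by apply: ler_pM; rewrite ?nrm_ge0 // lerDl.
by rewrite mulrC divfK // gt_eqF.
Qed.

Lemma L2_approximable_good g : good g -> L2_approximable g.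
Proof.
move=> gg; split; first exact: good_L2.
move=> d d0; exists g; split => //.
rewrite (@nrm_eq _ _ (fun=> 0)); last by move=> x _; rewrite subrr.
by rewrite /nrm /ip (@int2_eq _ _ (fun=> 0)) ?int2_cst ?sqrtr0 ?ltW // => x _; rewrite mul0r.
Qed.

Lemma L2_approximable_sum n (F : 'I_n -> R * R -> R) :
  (forall i, L2_approximable (F i)) -> L2_approximable (fun x => \sum_i F i x).
Proof.
elim: n F => [|n IH] F h.
  have -> : (fun x : R * R => \sum_(i < 0) F i x) = (fun=> 0).
    by apply/funext => x; rewrite big_ord0.
  by apply: L2_approximable_good; exact: good_cst.
have -> : (fun x : R * R => \sum_(i < n.+1) F i x) =
    (fun x => F ord0 x + \sum_(i < n) F (lift ord0 i) x).
  by apply/funext => x; rewrite big_ord_recl.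
by apply: L2_approximableD => //; exact: IH.
Qed.

Lemma L2_approximable_closed f : L2 f ->
  (forall d : R, 0 < d -> exists g, L2_approximable g /\ nrm (fun x => f x - g x) <= d) ->
  L2_approximable f.
Proof.
move=> Lf h; split => // d d0; have d2 : 0 < d / 2 by rewrite divr_gt0.
have [g [[Lg hg] ng]] := h _ d2; have [g' [gg ng']] := hg _ d2; exists g'; split => //.
have Lg' := good_L2 gg.
rewrite (@nrm_eq _ _ (fun x => (f x - g x) + (g x - g' x))); last by move=> x _; ring.
by apply: (le_trans (nrmD (L2B Lf Lg) (L2B Lg Lg'))); lra.
Qed.

(** The sum is the integer part of [y]. Applied to a multiple of a bounded function, it gives a
    uniform approximation by indicators of superlevel sets. *)
Lemma layer_sum (y : R) J : 0 <= y <= J%:R ->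
  y - 1 <= \sum_(j < J) (j.+1%:R <= y)%R%:R <= y.
Proof.
elim: J => [|J IH] /andP[y0 yJ].
  by rewrite mulr0n in yJ; rewrite big_ord0; apply/andP; split; lra.
rewrite big_ord_recr /=; have [h|h] := leP y J%:R.
  rewrite (_ : (J.+1%:R <= y) = false) /= ?mulr0n ?addr0; first by apply: IH; rewrite y0.
  by apply/negbTE; rewrite -ltNge -natr1; lra.
have -> : \sum_(i < J) (i.+1%:R <= y)%R%:R = J%:R :> R.
  rewrite -[RHS]mulr1 mulr_natl -[J in RHS]card_ord -sumr_const; apply: eq_bigr => i _.
  by rewrite (le_trans _ (ltW h)) // ler_nat.
rewrite -natr1 in yJ *; case: (leP (J%:R + 1) y) => h'; rewrite /= ?mulr0n ?mulr1n; apply/andP; split; lra.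
Qed.

Lemma L2_approximable_bounded f M : msr f -> (forall x, S x -> 0 <= f x <= M) -> L2_approximable f.
Proof.
move=> mf hf; have Lf : L2 f.
  by apply: (bounded_L2 mf (M := M)) => x Sx; have /andP[a b] := hf x Sx; rewrite ger0_norm.
apply: L2_approximable_closed => // d d0.
pose m := (Num.bound (d^-1)).+1; have m0 : 0 < m%:R :> R by rewrite ltr0n.
have md : m%:R^-1 <= d.
  rewrite -[d]invrK lef_pV2 ?posrE ?invr_gt0 //; apply: ltW.
  apply: (lt_le_trans (archi_boundP _)); first by rewrite invr_ge0 ltW.
  by rewrite ler_nat leqnSn.
pose J := Num.bound (m%:R * `|M|).
have hJ x : S x -> 0 <= m%:R * f x <= J%:R.
  move=> Sx; have /andP[a b] := hf x Sx; rewrite mulr_ge0 //=; apply: ltW.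
  apply: le_lt_trans (archi_boundP _); last by rewrite mulr_ge0.
  by apply: ler_wpM2l => //; apply: (le_trans b); exact: ler_norm.
pose A (j : nat) : set TT := S `&` f @^-1` `[(j.+1%:R / m%:R), +oo[.
have mA j : measurable (A j).
  by apply: mf; [exact: measurable_Sdom|exact: measurable_itv].
pose h (x : R * R) : R := \sum_(j < J) m%:R^-1 * \1_(A j) x.
have hh : L2_approximable h.
  apply: L2_approximable_sum => j; apply: L2_approximableZ.
  exact: L2_approximable_indic.
exists h; split => //.
have Lh : L2 h by case: hh.
have -> : d = nrm (fun _ : R * R => d).
  by rewrite /nrm /ip int2_cst -expr2 sqrtr_sqr gtr0_norm.
apply: nrm_le; [exact: L2B|exact: L2_cst|] => x Sx.
rewrite (gtr0_norm d0); apply: le_trans md.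
have hx : m%:R * h x = \sum_(j < J) (j.+1%:R <= m%:R * f x)%R%:R.
  rewrite /h mulr_sumr; apply: eq_bigr => j _; rewrite mulrA divff ?gt_eqF // mul1r indicE.
  congr (_%:R); congr nat_of_bool; apply/idP/idP; rewrite inE /A /= in_itv /= andbT ler_pdivrMr // mulrC.
    by case.
  by move=> ->.
have /andP[l1 l2] := layer_sum (hJ x Sx); rewrite -hx in l1 l2.
rewrite -(ler_pM2l m0) divff ?gt_eqF // -{1}(gtr0_norm m0) -normrM mulrBr ler_norml.
by apply/andP; split; lra.
Qed.

Lemma L2_dense f : L2 f -> L2_approximable f.
Proof.
move=> Lf; have mf := L2_msr Lf; apply: L2_approximable_closed => // d d0.
pose A (T : nat) : set TT := S `&` f @^-1` `[- T%:R, T%:R].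
have mA T : measurable (A T) by apply: mf; [exact: measurable_Sdom|exact: measurable_itv].
pose h (T : nat) (x : R * R) := \1_(A T) x * f x.
have hE T x : S x -> h T x = if `|f x| <= T%:R then f x else 0.
  move=> Sx; rewrite /h indicE; case: ifP => h'.
    by rewrite mem_set ?mul1r // /A /=; split => //; rewrite in_itv /= -ler_norml.
  by rewrite memNset ?mul0r // /A /= => -[_]; rewrite in_itv /= -ler_norml h'.
have Lh T : L2 (h T).
  apply: (bounded_L2M (M := 1) (msr_indic (mA T))) => //.
  by move=> x _; have /andP[a b] := indic01 (A T) x; rewrite ger0_norm.
have ah T : L2_approximable (h T).
  (* Adding [T] makes the truncated function nonnegative, as the decomposition into layers
     requires. *)
  have -> : h T = (fun x => (h T x + T%:R) + (- T%:R)) by apply/funext => x; ring.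
  apply: L2_approximableD; last by apply: L2_approximable_good; exact: good_cst.
  apply: (@L2_approximable_bounded _ (2 * T%:R)).
    by apply: msrD; [exact: L2_msr|exact: msr_cst].
  move=> x Sx; rewrite hE //; case: ifP => h'.
    by rewrite ler_norml in h'; case/andP: h' => a b; apply/andP; split; lra.
  by have : 0 <= T%:R :> R by []; move=> a; apply/andP; split; lra.
have lim : (fun T => ip (fun x => f x - h T x) (fun x => f x - h T x)) @ \oo --> int2 (fun _ : R * R => (0 : R)).
  apply: (@int2_dominated _ _ _ (fun x => f x * f x)).
  - by move=> T; apply: msrM; apply: msrB => //; exact: L2_msr.
  - exact: msr_cst.
  - move=> x Sx; apply: cvg_near_cst; near=> T; rewrite hE // ifT ?subrr ?mul0r //.
    by near: T; exact: nbhs_infty_ger.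
  - exact: L2_intgM.
  - move=> T x Sx; rewrite hE //; case: ifP => _.
      by rewrite subrr mul0r normr0 -expr2 sqr_ge0.
    by rewrite subr0 ger0_norm // -expr2 sqr_ge0.
rewrite int2_cst in lim.
have [T _ hT] := (cvgr0Pnorm_lt _).1 lim _ (exprn_gt0 2 d0).
exists (h T); split => //.
rewrite -(@ler_pXn2r _ 2) ?nnegrE ?nrm_ge0 ?(ltW d0) // nrm_sqr.
apply: le_trans (ltW (hT T (leqnn T))); exact: ler_norm.
Unshelve. all: by end_near. Qed.

(** The test function is taken close to [f] itself, which gives [nrm f ^+ 2 <= K * nrm f] up to an
    arbitrarily small error. *)
Lemma nrm_le_dual f K : L2 f -> 0 <= K ->
  (forall g, good g -> `|ip f g| <= K * nrm g) -> nrm f <= K.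
Proof.
move=> Lf K0 h.
have key d : 0 < d -> nrm f ^+ 2 <= K * nrm f + (K + nrm f) * d.
  move=> d0; have [_ ap] := L2_dense Lf; have [g [gg ng]] := ap _ d0.
  have Lg := good_L2 gg; have Lfg := L2B Lf Lg.
  have -> : nrm f ^+ 2 = ip f g + ip f (fun x => f x - g x).
    by rewrite ipBr // nrm_sqr; ring.
  have h1 : ip f g <= K * nrm g by apply: le_trans (h g gg); exact: ler_norm.
  have h2 : ip f (fun x => f x - g x) <= nrm f * d.
    apply: (le_trans (ler_norm _)); apply: (le_trans (ip_le_nrm Lf Lfg)).
    by apply: ler_wpM2l => //; exact: nrm_ge0.
  have h3 : nrm g <= nrm f + d.
    rewrite (@nrm_eq _ g (fun x => f x - (f x - g x))); last by move=> x _; ring.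
    by apply: (le_trans (nrmB Lf Lfg)); lra.
  have := ler_wpM2l K0 h3; lra.
have f0 := nrm_ge0 f.
rewrite leNgt; apply/negP => lt.
(* At this distance the error [(K + nrm f) * d] is half of the gap [nrm f * (nrm f - K)]. *)
have e0 : 0 < nrm f * (nrm f - K) / (2 * (K + nrm f)).
  by rewrite divr_gt0 ?mulr_gt0 //; lra.
have := key _ e0.
have -> : (K + nrm f) * (nrm f * (nrm f - K) / (2 * (K + nrm f))) = nrm f * (nrm f - K) / 2.
  by field; rewrite gt_eqF //; lra.
have : 0 < nrm f * (nrm f - K) by rewrite mulr_gt0 //; lra.
lra.
Qed.

End L2Density.

(** * Sampling on grids *)
Section Sampling.
Variable R : realType.
Notation S := (@Sdom R).
Notation mu := (@mu2 R).
Notation TT := (measurableTypeR R * measurableTypeR R)%type.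
Notation msr f := (@measurable_fun _ _ TT R S f).
Notation intg f := (mu.-integrable S (EFin \o f)).
Implicit Types f g h : R * R -> R.

Variable Hs : nat -> R -> R.
Hypothesis hs : forall k, is_step k.+1 (Hs k).
Hypothesis hd : forall k x, is_derive x (1 : R) (Hs k.+1) (Hs k x - Hs k (x - 1)).

Section Grid.
Variable N : nat.
Hypothesis N0 : (0 < N)%N.
Let NR0 : 0 < N%:R :> R. Proof. by rewrite ltr0n. Qed.

Definition wave k (o s : R) := bump Hs k (N%:R * s + o).

Lemma wave_smooth k o : smooth (wave k o).
Proof. by apply: smooth_affine; exact: bump_smooth. Qed.

Lemma wave_ge0 k o s : 0 <= wave k o s. Proof. exact: bump_ge0. Qed.

Lemma is_derive_affine (o s : R) : is_derive s (1 : R) (fun s : R => N%:R * s + o) N%:R.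
Proof. by apply: is_derive_eq; rewrite /GRing.scale /=; ring. Qed.

Lemma wave_derive1 k o : derive1 (wave k.+1 o) = fun s => N%:R * (wave k o s - wave k (o - 1) s).
Proof.
apply/funext => s; rewrite derive1E.
have := @is_derive1_comp _ (bump Hs k.+1) _ s _ _ (bump_der hd k _) (is_derive_affine o s).
by case=> _ ->; rewrite mulrC /wave addrA.
Qed.

Lemma wave_bump_in k o lo hi : N%:R * lo + o < 0 -> k.+2%:R < N%:R * hi + o ->
  bump_in lo hi (wave k o).
Proof.
move=> h1 h2; split; first exact: wave_smooth.
have aux (a b : R) : a < N%:R * b + o -> (a - o) / N%:R < b.
  by move=> h; rewrite ltr_pdivrMr // mulrC; lra.
have aux' (a b : R) : N%:R * b + o < a -> b < (a - o) / N%:R.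
  by move=> h; rewrite ltr_pdivlMr // mulrC; lra.
exists ((0 - o) / N%:R), ((k.+2%:R - o) / N%:R); split.
- exact: aux'.
- by rewrite ltr_pM2r ?invr_gt0 // ltrD2r ltr0n.
- exact: aux.
- move=> s hs'; rewrite /wave; have [h|h] := leP (N%:R * s + o) 0; first exact: (bump_le0 hs).
  have [h'|h'] := leP k.+2%:R (N%:R * s + o); first exact: (bump_large hs).
  by case: hs'; rewrite !ltW ?aux ?aux'.
Qed.

(** With [i.+1] in place of [i], even the kernel at [i = 0] is supported at a positive distance from
    the edge, as a test function must be. The same holds for [off2] after the translation by one
    half. *)
Definition off1 i : R := - i.+1%:R.
Definition off2 j : R := N%:R / 2 - j.+1%:R.
Definition ker k l i j : R * R -> R := tensor (wave k (off1 i)) (wave l (off2 j)).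
Definition samp f k l i j := ip f (ker k l i j).

Lemma wave_s_in k i : (k + i + 3 < N)%N -> bump_in 0 1 (wave k (off1 i)).
Proof.
move=> h; apply: wave_bump_in; rewrite /off1; first by rewrite mulr0 add0r oppr_lt0 ltr0n.
rewrite mulr1 ltrBrDr -natrD ltr_nat; lia.
Qed.

Lemma wave_t_in k j : (k + j + 3 < N)%N -> bump_in (- 2^-1) 2^-1 (wave k (off2 j)).
Proof.
move=> h; apply: wave_bump_in; rewrite /off2.
  have : 0 < j.+1%:R :> R by rewrite ltr0n.
  lra.
have : k.+2%:R + j.+1%:R < N%:R :> R by rewrite -natrD ltr_nat; lia.
lra.
Qed.

Lemma wave_continuous k o : continuous (wave k o).
Proof. exact/smooth_continuous/wave_smooth. Qed.

Lemma ker_L2 k l i j : L2 (ker k l i j).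
Proof. by apply: tensor_L2; exact: wave_continuous. Qed.

Lemma off1S i : off1 i.+1 = off1 i - 1.
Proof. by rewrite /off1 -[i.+2%:R]natr1 opprD. Qed.
Lemma off2S i : off2 i.+1 = off2 i - 1.
Proof. by rewrite /off2 -[i.+2%:R]natr1 opprD addrA. Qed.

(** The derivative of a bump of degree [k.+1] is a difference of neighbouring bumps of degree [k].
    Tested against such a kernel, the weak derivative becomes a difference of samples without error,
    at the price of one degree. *)
Lemma samp_ds f g k l i j : L2 f -> weak_s f g ->
  (k.+1 + i + 3 < N)%N -> (l + j + 3 < N)%N ->
  ds (samp f k l) i j = N%:R^-1 * samp g k.+1 l i j.
Proof.
move=> Lf w hi hj; have := w _ _ (wave_s_in hi) (wave_t_in hj).
rewrite wave_derive1 => e; have {}e : N%:R * (samp f k l i j - samp f k l i.+1 j) = - samp g k.+1 l i j.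
  rewrite -e /samp -ipBr ?ipZr -?ipZr //; try exact: ker_L2; last by apply: L2B; exact: ker_L2.
  apply: int2_eq => x _; rewrite /ker /tensor off1S; ring.
apply: (mulfI (lt0r_neq0 NR0)); rewrite mulVKf ?gt_eqF // /ds; lra.
Qed.

Lemma samp_dt f g k l i j : L2 f -> weak_t f g ->
  (k + i + 3 < N)%N -> (l.+1 + j + 3 < N)%N ->
  dt (samp f k l) i j = N%:R^-1 * samp g k l.+1 i j.
Proof.
move=> Lf w hi hj; have := w _ _ (wave_s_in hi) (wave_t_in hj).
rewrite wave_derive1 => e; have {}e : N%:R * (samp f k l i j - samp f k l i j.+1) = - samp g k l.+1 i j.
  rewrite -e /samp -ipBr ?ipZr -?ipZr //; try exact: ker_L2; last by apply: L2B; exact: ker_L2.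
  apply: int2_eq => x _; rewrite /ker /tensor off2S; ring.
apply: (mulfI (lt0r_neq0 NR0)); rewrite mulVKf ?gt_eqF // /dt; lra.
Qed.

Lemma int2_ker k l i j : (k + i + 3 < N)%N -> (l + j + 3 < N)%N ->
  int2 (ker k l i j) = N%:R^-1 ^+ 2.
Proof.
move=> hi hj.
pose W (k : nat) (o s : R) := N%:R^-1 * Hs k.+1 (N%:R * s + o).
have dW k' o s : is_derive s (1 : R) (W k' o) (wave k' o s).
  have h := @is_derive1_comp _ (Hs k'.+1) _ s _ _ (hd k' _) (is_derive_affine o s).
  have h' := is_deriveZ (N%:R^-1) h; apply: is_derive_eq h' _.
  by rewrite /GRing.scale /= mulrC -mulrA divff ?gt_eqF // mulr1 /wave /bump.
rewrite (int2_tensor (dW _ _) (dW _ _)); [|exact: wave_continuous..].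
have H0 k' x : x <= 0 -> Hs k' x = 0 by case: (hs k') => _ h _ _ _; apply: h.
have H1 k' x : k'.+1%:R <= x -> Hs k' x = 1 by case: (hs k') => _ _ h _ _; apply: h.
rewrite /W /off1 /off2 mulr0 add0r mulr1.
have s0 : - i.+1%:R <= 0 :> R by rewrite oppr_le0.
have s1 : k.+2%:R <= N%:R - i.+1%:R :> R by rewrite lerBrDr -natrD ler_nat; lia.
have t0 : N%:R * - 2^-1 + (N%:R / 2 - j.+1%:R) <= 0 :> R.
  have : 0 <= j.+1%:R :> R by []. 
  lra.
have t1 : l.+2%:R <= N%:R * 2^-1 + (N%:R / 2 - j.+1%:R) :> R.
  have : l.+2%:R + j.+1%:R <= N%:R :> R by rewrite -natrD ler_nat; lia.
  lra.
rewrite (H0 _ _ s0) (H1 _ _ s1) (H0 _ _ t0) (H1 _ _ t1); ring.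
Qed.

Lemma ker_ge0 k l i j x : 0 <= ker k l i j x.
Proof. by rewrite mulr_ge0 ?wave_ge0. Qed.

Lemma ker_bounded k l i j : msr (ker k l i j) /\
  exists M, 0 <= M /\ forall x, S x -> `|ker k l i j x| <= M.
Proof. by apply: tensor_bounded; exact: wave_continuous. Qed.


Lemma sum_wave1 k M s : \sum_(i < M) wave k (off1 i) s <= 1.
Proof.
rewrite (eq_bigr (fun i : 'I_M => bump Hs k ((N%:R * s - 1) - i%:R))); first exact: sum_bump_le1.
by move=> i _; rewrite /wave /off1 -natr1; congr bump; ring.
Qed.
Lemma sum_wave2 k M s : \sum_(i < M) wave k (off2 i) s <= 1.
Proof.
rewrite (eq_bigr (fun i : 'I_M => bump Hs k ((N%:R * s + N%:R / 2 - 1) - i%:R))); first exact: sum_bump_le1.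
by move=> i _; rewrite /wave /off2 -natr1; congr bump; ring.
Qed.

Lemma sum_ker_le1 M k l x : \sum_(i < M) \sum_(j < M) ker k l i j x <= 1.
Proof.
under eq_bigr do rewrite /ker /tensor -mulr_sumr.
rewrite -mulr_suml -[leRHS]mulr1; apply: ler_pM; rewrite ?sum_wave1 ?sum_wave2 //;
  by apply: sumr_ge0 => *; exact: wave_ge0.
Qed.

Lemma int2_sum n (F : 'I_n -> R * R -> R) : (forall i, intg (F i)) ->
  intg (fun x => \sum_i F i x) /\ int2 (fun x => \sum_i F i x) = \sum_i int2 (F i).
Proof.
elim: n F => [|n IH] F h.
  have e (x : R * R) : S x -> 0 = \sum_(i < 0) F i x by rewrite big_ord0.
  split; first by apply: (intg_eq e); exact: intg_cst.
  by rewrite -(int2_eq e) int2_cst big_ord0.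
have [i1 i2] := IH (fun i => F (lift ord0 i)) (fun i => h _).
have e (x : R * R) : S x -> F ord0 x + \sum_i F (lift ord0 i) x = \sum_(i < n.+1) F i x.
  by rewrite big_ord_recl.
split; first by apply: (intg_eq e); exact: intgD.
by rewrite -(int2_eq e) int2D // i2 big_ord_recl.
Qed.

(** Jensen's inequality for the weight [ker], whose mass is [1 / N ^ 2] for every degree and node;
    then the kernels add up to at most 1. *)
Lemma samp_bessel M k l f : L2 f -> (k + M + 2 < N)%N -> (l + M + 2 < N)%N ->
  sq2 M M (samp f k l) <= N%:R^-1 ^+ 2 * nrm f ^+ 2.
Proof.
move=> Lf hk hl; have [mf f2] := (L2P f).1 Lf.
have if2 i j : intg (fun x => f x ^+ 2 * ker k l i j x).
  have [mk [B [B0 hB]]] := ker_bounded k l i j.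
  apply: (@intg_le _ _ (fun x => B * f x ^+ 2)); last exact: intgZ.
    by apply: msrM => //; exact: intg_msr f2.
  by move=> x Sx; rewrite normrM mulrC (ger0_norm (sqr_ge0 _)); apply: ler_wpM2r; rewrite ?sqr_ge0 ?hB.
have pt (i j : 'I_M) : samp f k l i j ^+ 2 <= N%:R^-1 ^+ 2 * int2 (fun x => f x ^+ 2 * ker k l i j x).
  set I2 := int2 _; set q := N%:R^-1 ^+ 2; have q0 : 0 < q by rewrite exprn_gt0 // invr_gt0.
  have eq : int2 (ker k l i j) = q.
    by apply: int2_ker; have := ltn_ord i; have := ltn_ord j; lia.
  set a := samp f k l i j.
  have Lk := ker_L2 k l i j; have ik := L2_intg Lk; have ifk := L2_intgM Lf Lk.
  (* The quotient [a / q] is the mean of [f] for the weight [ker], and the integrand is the weighted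
     square of the deviation from it. *)
  have : 0 <= int2 (fun x => f x ^+ 2 * ker k l i j x + ((- 2 * (a / q)) * (f x * ker k l i j x) + (a / q) ^+ 2 * ker k l i j x)).
    apply: int2_ge0 => x _; rewrite (_ : _ + _ = (f x - a / q) ^+ 2 * ker k l i j x); last by ring.
    by rewrite mulr_ge0 ?sqr_ge0 ?ker_ge0.
  rewrite int2D //; last by apply: intgD; exact: intgZ.
  rewrite int2D; [|exact: intgZ|exact: intgZ].
  rewrite !int2Z // eq -/I2 -/(ip f (ker k l i j)) -/(samp f k l i j) -/a.
  have -> : - 2 * (a / q) * a + (a / q) ^+ 2 * q = - (a ^+ 2 / q) by field; rewrite gt_eqF.
  by rewrite subr_ge0 ler_pdivrMr // mulrC.
apply: (@le_trans _ _ (\sum_(i < M) \sum_(j < M) N%:R^-1 ^+ 2 * int2 (fun x => f x ^+ 2 * ker k l i j x))).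
  by apply: ler_sum => i _; apply: ler_sum => j _; exact: pt.
under eq_bigr do rewrite -mulr_sumr.
rewrite -mulr_sumr; apply: ler_wpM2l; first by rewrite exprn_ge0 // invr_ge0.
have h1 (i : 'I_M) := int2_sum (fun j : 'I_M => if2 i j).
have [h2 h3] := int2_sum (fun i : 'I_M => (h1 i).1).
under eq_bigr do rewrite -(h1 _).2.
rewrite -h3 nrm_sqr; apply: int2_le; [exact: h2|exact: (L2_intgM Lf Lf)|].
move=> x Sx; under eq_bigr do rewrite -mulr_sumr.
by rewrite -mulr_sumr -expr2 -[leRHS]mulr1; apply: ler_wpM2l; rewrite ?sqr_ge0 ?sum_ker_le1.
Qed.

End Grid.
End Sampling.

(** * From samples to L^2 norms *)

Section Limit.
Variable R : realType.
Notation S := (@Sdom R).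
Notation mu := (@mu2 R).
Notation TT := (measurableTypeR R * measurableTypeR R)%type.
Notation msr f := (@measurable_fun _ _ TT R S f).
Notation intg f := (mu.-integrable S (EFin \o f)).
Implicit Types f g h : R * R -> R.

Lemma discriminant_le (A B C : R) :
  (forall a b : R, 0 <= a ^+ 2 * A + 2 * (a * b) * C + b ^+ 2 * B) -> C ^+ 2 <= A * B.
Proof.
move=> q.
have A0 : 0 <= A by have := q 1 0; lra.
have B0 : 0 <= B by have := q 0 1; lra.
have [A0'|An] := eqVneq A 0.
  have [->|Cn] := eqVneq C 0; first by rewrite expr0n mulr_ge0.
  have := q (- (B + 1) / (2 * C)) 1; rewrite A0'.
  have -> : 2 * (- (B + 1) / (2 * C) * 1) * C = - (B + 1) by field.
  lra.
have Ap : 0 < A by rewrite lt_def An.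
by have := q (- C) A => h; rewrite -(ler_pM2l Ap); lra.
Qed.

Lemma cauchy_schwarz_sum2 M (x y : nat -> nat -> R) :
  (\sum_(i < M) \sum_(j < M) x i j * y i j) ^+ 2 <= sq2 M M x * sq2 M M y.
Proof.
apply: discriminant_le => a b.
have -> : a ^+ 2 * sq2 M M x + 2 * (a * b) * (\sum_(i < M) \sum_(j < M) x i j * y i j) + b ^+ 2 * sq2 M M y
  = sq2 M M (fun i j => a * x i j + b * y i j); last exact: sq2_ge0.
rewrite /sq2 !mulr_sumr -!big_split; apply: eq_bigr => i _ /=.
rewrite !mulr_sumr -!big_split; apply: eq_bigr => j _ /=; ring.
Qed.

Variable Hs : nat -> R -> R.
Hypothesis hs : forall k, is_step k.+1 (Hs k).
Hypothesis hd : forall k x, is_derive x (1 : R) (Hs k.+1) (Hs k x - Hs k (x - 1)).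

(** The margin 8 leaves room inside S for kernels of degree at most 2 at all nodes below
    [2 * n + 2], the range of the discrete Korn inequality. *)
Definition gridN n := (2 * n + 8)%N.
Definition node n i j : R * R := (i.+1%:R / (gridN n)%:R, j.+1%:R / (gridN n)%:R - 2^-1).
(** A quasi-interpolant of [g]: its pairing with [f] involves [f] only through samples, and it tends
    to [g] boundedly and pointwise in S. *)
Definition quasi n g (x : R * R) :=
  \sum_(i < 2 * n) \sum_(j < 2 * n) g (node n i j) * ker Hs (gridN n) 1 1 i j x.

Let N0 n : (0 < gridN n)%N. Proof. by rewrite /gridN addnS. Qed.
Let NR n : 0 < (gridN n)%:R :> R. Proof. by rewrite ltr0n. Qed.
Let kL n i j : L2 (ker Hs (gridN n) 1 1 i j). Proof. exact: ker_L2. Qed.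

Lemma ip_quasi n f g : L2 f -> ip f (quasi n g) =
  \sum_(i < 2 * n) \sum_(j < 2 * n) g (node n i j) * samp Hs (gridN n) f 1 1 i j.
Proof.
move=> Lf; rewrite ipC ip_suml //; last by move=> i; apply: L2_sum => j; exact: L2Z.
apply: eq_bigr => i _; rewrite ip_suml //; last by move=> j; exact: L2Z.
by apply: eq_bigr => j _; rewrite ipZl // ipC.
Qed.

Lemma quasi_L2 n g : L2 (quasi n g).
Proof. by apply: L2_sum => i; apply: L2_sum => j; exact: L2Z. Qed.

Lemma quasi_bounded n g M x : (forall x, `|g x| <= M) -> `|quasi n g x| <= M.
Proof.
move=> hg; have M0 : 0 <= M by exact: le_trans (hg x).
apply: (@le_trans _ _ (\sum_(i < 2 * n) \sum_(j < 2 * n) M * ker Hs (gridN n) 1 1 i j x)).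
  apply: (le_trans (ler_norm_sum _ _ _)); apply: ler_sum => i _.
  apply: (le_trans (ler_norm_sum _ _ _)); apply: ler_sum => j _.
  by rewrite normrM (ger0_norm (ker_ge0 hs _ _ _ _ _ _)); apply: ler_wpM2r; rewrite ?ker_ge0.
under eq_bigr do rewrite -mulr_sumr.
by rewrite -mulr_sumr -[leRHS]mulr1; apply: ler_wpM2l => //; exact: sum_ker_le1.
Qed.

Lemma quasi_cvg g x : S x -> {for x, continuous g} -> (fun n => quasi n g x) @ \oo --> g x.
Proof.
move=> [/andP[s0 s1] /andP[t0 t1]] cg; apply/cvgrPdist_le => e e0.
have /cvgrPdist_le/(_ _ e0) : g y @[y --> x] --> g x by exact: cg.
rewrite /prop_near1 => -[[U V] /= [[a /= a0 hU] [b /= b0 hV]] hUV].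
(* One margin serves twice: at distance [8 / N] from the edges the kernels sum to 1, and a node
   whose kernel does not vanish at [x] is closer than [8 / N] in each coordinate. *)
have large (d : R) : 0 < d -> \forall n \near \oo, 8 / (gridN n)%:R < d.
  move=> d0; near=> n; rewrite ltr_pdivrMr // mulrC -ltr_pdivrMr //.
  apply: (@lt_trans _ _ n%:R); last by rewrite ltr_nat /gridN; lia.
  by near: n; exact: nbhs_infty_gtr.
near=> n.
have h1 : 8 / (gridN n)%:R < x.1 by near: n; exact: large.
have h2 : 8 / (gridN n)%:R < 1 - x.1 by near: n; apply: large; lra.
have h3 : 8 / (gridN n)%:R < x.2 + 2^-1 by near: n; apply: large; lra.
have h4 : 8 / (gridN n)%:R < 2^-1 - x.2 by near: n; apply: large; lra.
have h5 : 8 / (gridN n)%:R < a by near: n; exact: large.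
have h6 : 8 / (gridN n)%:R < b by near: n; exact: large.
set N : R := (gridN n)%:R in h1 h2 h3 h4 h5 h6 *; have Np : 0 < N by exact: NR.
have NE : N = 2 * n%:R + 8 by rewrite /N /gridN natrD natrM.
rewrite !ltr_pdivrMr // in h1 h2 h3 h4 h5 h6.
have p1 : \sum_(i < 2 * n) wave Hs (gridN n) 1 (off1 R i) x.1 = 1.
  rewrite (eq_bigr (fun i : 'I_(2 * n) => bump Hs 1 ((N * x.1 - 1) - i%:R))).
    apply: (sum_bump_eq1 hs); rewrite ?natrM; clear -h1 h2 NE; lra.
  by move=> i _; rewrite /wave /off1 -natr1; congr bump; rewrite /N; ring.
have p2 : \sum_(i < 2 * n) wave Hs (gridN n) 1 (off2 R (gridN n) i) x.2 = 1.
  rewrite (eq_bigr (fun i : 'I_(2 * n) => bump Hs 1 ((N * x.2 + N / 2 - 1) - i%:R))).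
    apply: (sum_bump_eq1 hs); rewrite ?natrM; clear -h3 h4 NE; lra.
  by move=> i _; rewrite /wave /off2 -natr1; congr bump; rewrite /N; ring.
have p : \sum_(i < 2 * n) \sum_(j < 2 * n) ker Hs (gridN n) 1 1 i j x = 1.
  under eq_bigr do rewrite /ker /tensor -mulr_sumr.
  by rewrite -mulr_suml p1 p2 mulr1.
have -> : g x - quasi n g x = \sum_(i < 2 * n) \sum_(j < 2 * n)
    (g x - g (node n i j)) * ker Hs (gridN n) 1 1 i j x.
  have {1}-> : g x = \sum_(i < 2 * n) \sum_(j < 2 * n) g x * ker Hs (gridN n) 1 1 i j x.
    under eq_bigr do rewrite -mulr_sumr.
    by rewrite -mulr_sumr p mulr1.
  rewrite /quasi -sumrB; apply: eq_bigr => i _; rewrite -sumrB; apply: eq_bigr => j _.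
  by rewrite mulrBl.
apply: (@le_trans _ _ (\sum_(i < 2 * n) \sum_(j < 2 * n) e * ker Hs (gridN n) 1 1 i j x)); last first.
  under eq_bigr do rewrite -mulr_sumr.
  by rewrite -mulr_sumr p mulr1.
apply: (le_trans (ler_norm_sum _ _ _)); apply: ler_sum => i _.
apply: (le_trans (ler_norm_sum _ _ _)); apply: ler_sum => j _.
rewrite normrM (ger0_norm (ker_ge0 hs _ _ _ _ _ _)).
have [->|kn] := eqVneq (ker Hs (gridN n) 1 1 i j x) 0; first by rewrite !mulr0.
apply: ler_wpM2r; first exact: ker_ge0.
move: kn; rewrite /ker /tensor mulf_eq0 negb_or => /andP[k1 k2].
have /andP[k3 k4] := bump_support hs k1; have /andP[k5 k6] := bump_support hs k2.
rewrite /off1 -/N in k3 k4; rewrite /off2 -/N in k5 k6.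
have dist (u v d : R) : `|N * u - v| < 8 -> 8 < d * N -> `|u - v / N| < d.
  move=> hu hd'; rewrite -(ltr_pM2r Np); apply: lt_trans hd'.
  have e' : N * u - v = (u - v / N) * N by field; rewrite gt_eqF.
  by rewrite e' normrM (gtr0_norm Np) in hu.
apply: (hUV (node n i j)); split => /=.
  apply: hU => /=; apply: dist h5; rewrite ltr_norml; apply/andP; clear -k3 k4; split; lra.
apply: hV => /=.
have -> : x.2 - (j.+1%:R / (gridN n)%:R - 2^-1) = (x.2 + 2^-1) - j.+1%:R / N by rewrite -/N; ring.
by apply: dist h6; rewrite ltr_norml; apply/andP; clear -k5 k6; split; lra.
Unshelve. all: by end_near. Qed.

Lemma ip_quasi_cvg f g : L2 f -> good g -> (fun n => ip f (quasi n g)) @ \oo --> ip f g.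
Proof.
move=> Lf [mg [M [M0 hM]] cg].
have iM : intg (fun x => M * `|f x|).
  apply: (@intg_le _ _ (fun x => M * (1 + f x ^+ 2))).
  - by apply: msrZ; apply: msr_norm; exact: L2_msr.
  - move=> x _; rewrite normrM normr_id (ger0_norm M0); apply: ler_wpM2l => //.
    rewrite -[f x ^+ 2]real_normK ?num_real //; have := sqr_ge0 (`|f x| - 1); nra.
  - by apply: intgZ; apply: intgD; [exact: intg_cst|case: Lf].
apply: (int2_dominated (g := fun x => M * `|f x|)) => //.
- by move=> n; apply: msrM; [exact: L2_msr|exact: (L2_msr (quasi_L2 n g))].
- by apply: msrM => //; exact: L2_msr.
- by move=> x Sx; apply: cvgM; [exact: cvg_cst|apply: quasi_cvg => //; exact: cg].
- by move=> n x Sx; rewrite normrM mulrC; apply: ler_wpM2r => //; exact: quasi_bounded.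
Qed.

(** By duality it is enough to bound [ip f g - int2 g * int2 f], a limit of covariances between the
    samples of [f] and the node values of [g]. A covariance ignores constants, so [c] may depend on
    [n] without any control. *)
Lemma nrm_le_samples f (K : R) : L2 f -> 0 <= K ->
  (forall n, (1 < n)%N -> exists c,
    sq2 (2 * n) (2 * n) (fun i j => samp Hs (gridN n) f 1 1 i j - c) <= (K / (gridN n)%:R) ^+ 2) ->
  nrm (fun x => f x - int2 f) <= K.
Proof.
move=> Lf K0 h; have L1 := L2_cst (1 : R).
apply: nrm_le_dual => //; first by apply: L2B => //; exact: L2_cst.
move=> g gg; have Lg := good_L2 gg; have g1 := good_cst (1 : R); have g2 := goodM gg gg.
have -> : ip (fun x => f x - int2 f) g = ip f g - int2 g * int2 f.
  rewrite ipBl //; last exact: L2_cst.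
  have -> : ip (fun _ : R * R => int2 f) g = int2 g * int2 f.
    by rewrite mulrC; exact: (int2Z (int2 f) (L2_intg Lg)).
  by [].
rewrite -(@ler_pXn2r _ 2) ?nnegrE ?mulr_ge0 ?nrm_ge0 // real_normK ?num_real // exprMn nrm_sqr.
pose o : R * R -> R := fun=> 1.
have mean (u : R * R -> R) : ip o u = int2 u by apply: int2_eq => x _; rewrite mul1r.
have fo : ip f o = int2 f by rewrite ipC mean.
have c1 := ip_quasi_cvg Lf gg; have c2 := ip_quasi_cvg L1 gg; have c3 := ip_quasi_cvg L1 g1.
have c4 := ip_quasi_cvg Lf g1; have c5 := ip_quasi_cvg L1 g2.
rewrite -/o in c2 c3 c4 c5; rewrite fo in c4; rewrite !mean in c2 c3 c5.
rewrite int2_cst in c3; rewrite -/(ip g g) in c5.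
have n1 : (1 : R) != 0 by rewrite oner_eq0.
(* The quotient is the arithmetic mean [r] of the node values of [g], because all kernels have the
   same integral. With this normalization [w n] is an exact covariance for each [n], not just in the
   limit. *)
pose w n := ip f (quasi n g) - ip o (quasi n g) / ip o (quasi n o) * ip f (quasi n o).
have cw : w @ \oo --> ip f g - int2 g * int2 f.
  rewrite -[X in _ - X * _]divr1; apply: cvgB => //; apply: cvgM => //.
  by apply: cvgM => //; apply: cvgV.
have cu : (fun n => w n * w n) @ \oo --> (ip f g - int2 g * int2 f) ^+ 2.
  by rewrite expr2; apply: cvgM.
have cv : (fun n => K ^+ 2 * ip o (quasi n (fun x => g x * g x))) @ \oo --> K ^+ 2 * ip g g.
  by apply: cvgM => //; exact: cvg_cst.
apply: ler_cvg_to cu cv _; near=> n; rewrite -expr2 /w.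
have n2 : (1 < n)%N by near: n; exact: nbhs_infty_gt.
have [c hc] := h n n2.
set N : R := (gridN n)%:R in hc; have Np : 0 < N := NR n.
pose y i j := g (node n i j); pose x i j := samp Hs (gridN n) f 1 1 i j.
pose SS (F : nat -> nat -> R) := \sum_(i < 2 * n) \sum_(j < 2 * n) F i j.
have SD F G : SS (fun i j => F i j + G i j) = SS F + SS G.
  by rewrite /SS -big_split; apply: eq_bigr => i _; rewrite -big_split.
have SZ a F : SS (fun i j => a * F i j) = a * SS F.
  by rewrite /SS mulr_sumr; apply: eq_bigr => i _; rewrite mulr_sumr.
have eS F G : (forall i j, F i j = G i j) -> SS F = SS G.
  by move=> e; apply: eq_bigr => i _; apply: eq_bigr => j _.
have e1 : ip f (quasi n g) = SS (fun i j => y i j * x i j) by rewrite ip_quasi.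
have e2 : ip f (quasi n o) = SS x.
  by rewrite ip_quasi //; apply: eq_bigr => i _; apply: eq_bigr => j _; rewrite /o mul1r.
have eo u : ip o (quasi n u) = N^-1 ^+ 2 * SS (fun i j => u (node n i j)).
  rewrite ip_quasi // -SZ; apply: eq_bigr => i _; apply: eq_bigr => j _; rewrite mulrC /samp mean.
  by rewrite int2_ker //; have := ltn_ord i; have := ltn_ord j; rewrite /gridN; lia.
pose m : R := (2 * n)%:R ^+ 2.
have m0 : 0 < m by rewrite exprn_gt0 // ltr0n; lia.
have e3 : SS (fun _ _ => 1) = m.
  rewrite /SS !sumr_const !card_ord -mulrnA /m -natrX; congr (_%:R); lia.
rewrite e1 e2 !eo e3.
set q := N^-1 ^+ 2; have q0 : 0 < q by rewrite exprn_gt0 // invr_gt0.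
set Y := SS (fun i j => g (node n i j)).
have -> : q * Y / (q * m) = Y / m by field; rewrite !gt_eqF.
set r := Y / m.
have rm : r * m = Y by rewrite /r divfK // gt_eqF.
have -> : SS (fun i j => y i j * x i j) - r * SS x = SS (fun i j => (x i j - c) * (y i j - r)).
  rewrite [RHS](eS _ (fun i j => (y i j * x i j + (- r) * x i j) + ((- c) * y i j + (c * r) * 1))); last by move=> i j; ring.
  rewrite !SD !SZ e3 (_ : SS (fun i j => y i j) = Y) //.
  have crm : c * r * m = c * Y by rewrite -mulrA rm.
  by rewrite crm; ring.
apply: (le_trans (cauchy_schwarz_sum2 (2 * n) (fun i j => x i j - c) (fun i j => y i j - r))).
apply: (@le_trans _ _ ((K / N) ^+ 2 * sq2 (2 * n) (2 * n) (fun i j => y i j - r))).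
  by apply: ler_wpM2r => //; exact: sq2_ge0.
rewrite expr_div_n -mulrA; apply: ler_wpM2l; first exact: sqr_ge0.
rewrite /q exprVn; apply: ler_wpM2l; first by rewrite invr_ge0 exprn_ge0 // ltW.
have -> : sq2 (2 * n) (2 * n) (fun i j => y i j - r) = SS (fun i j => (y i j - r) ^+ 2) by [].
rewrite (eS _ (fun i j => (y i j * y i j + (- 2 * r) * y i j) + r ^+ 2 * 1)); last by move=> i j; ring.
rewrite !SD !SZ e3 (_ : SS (fun i j => y i j) = Y) // -rm.
have := mulr_ge0 (sqr_ge0 r) (ltW m0).
rewrite -/(SS (fun i j => g (node n i j) * g (node n i j))) /y; lra.
Unshelve. all: by end_near. Qed.

End Limit.

(** * Poincare's inequality, and Korn's inequality in a curved frame *)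

Section KornPoincare.
Variable R : realType.
Notation S := (@Sdom R).
Implicit Types f g h : R * R -> R.

Lemma sq2Z M N a (F : nat -> nat -> R) : sq2 M N (fun i j => a * F i j) = a ^+ 2 * sq2 M N F.
Proof.
by rewrite /sq2 mulr_sumr; apply: eq_bigr => i _; rewrite mulr_sumr; apply: eq_bigr => j _; rewrite exprMn.
Qed.

Lemma sq2D_le M N (F G : nat -> nat -> R) :
  sq2 M N (fun i j => F i j + G i j) <= 2 * sq2 M N F + 2 * sq2 M N G.
Proof.
apply: (@le_trans _ _ (2 * sq2 M N F + 2 * sq2 M N G + 0 * sq2 M N F)); last by rewrite mul0r addr0.
apply: sq2_le3 => i j _ _; have := sqr_ge0 (F i j - G i j); lra.
Qed.

Variable Hs : nat -> R -> R.
Hypothesis hs : forall k, is_step k.+1 (Hs k).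
Hypothesis hd : forall k x, is_derive x (1 : R) (Hs k.+1) (Hs k x - Hs k (x - 1)).

Let N0 n : (0 < gridN n)%N. Proof. by rewrite /gridN addnS. Qed.
Let NR n : 0 < (gridN n)%:R :> R. Proof. by rewrite ltr0n. Qed.
Local Notation smp n := (samp Hs (gridN n)).

Lemma gridN_node n k i : (k <= 2)%N -> (i < 2 * n + 2)%N -> (k + i + 3 < gridN n)%N.
Proof. by rewrite /gridN; lia. Qed.
Lemma gridN_support n k : (k <= 2)%N -> (k + (2 * n + 2) + 2 < gridN n)%N.
Proof. by rewrite /gridN; lia. Qed.

Lemma sampD n f g k l i j : L2 f -> L2 g ->
  smp n (fun x => f x + g x) k l i j = smp n f k l i j + smp n g k l i j.
Proof. by move=> Lf Lg; rewrite /samp ipDl //; exact: ker_L2. Qed.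

Lemma sampZ n a f k l i j : L2 f -> smp n (fun x => a * f x) k l i j = a * smp n f k l i j.
Proof. by move=> Lf; rewrite /samp ipZl //; exact: ker_L2. Qed.

(** The bottom row of samples acts as a trace: replacing a function by its values there costs only
    its t-derivative. *)
Lemma samp_vertical n f ft k l : L2 f -> L2 ft -> weak_t f ft -> (k <= 2)%N -> (l <= 1)%N ->
  sq2 (2 * n + 2) (2 * n + 2) (fun i j => smp n f k l i j - smp n f k l i 0)
  <= (gridN n)%:R^-1 ^+ 2 * nrm ft ^+ 2.
Proof.
move=> Lf Lft w hk hl; set L := (2 * n + 2)%N; set N : R := (gridN n)%:R.
have Np : 0 < N := NR n.
have LN : L%:R <= N :> R by rewrite ler_nat /gridN /L; lia.
have hb : sq2 L L (smp n ft k l.+1) <= N^-1 ^+ 2 * nrm ft ^+ 2.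
  by apply: samp_bessel => //; rewrite /gridN /L; lia.
apply: le_trans hb.
apply: (@le_trans _ _ (L%:R ^+ 2 * (N^-1 ^+ 2 * sq2 L L (smp n ft k l.+1)))); last first.
  rewrite mulrA -exprMn -[leRHS]mul1r; apply: ler_wpM2r; first exact: sq2_ge0.
  rewrite expr_le1 // ?mulr_ge0 ?invr_ge0 ?(ltW Np) //.
  by rewrite ler_pdivrMr // mul1r.
have -> : N^-1 ^+ 2 * sq2 L L (smp n ft k l.+1) = sq2 L L (dt (smp n f k l)).
  rewrite -sq2Z; apply: eq_sq2 => i j hi hj.
  by rewrite (samp_dt hs hd (N0 n) Lf w) //; rewrite /gridN /L in hi hj *; lia.
rewrite /sq2 mulr_sumr; apply: ler_sum => i _.
apply: (@le_trans _ _ (\sum_(j < L) L%:R * \sum_(j < L) dt (smp n f k l) i j ^+ 2)); last first.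
  by rewrite sumr_const card_ord -(mulr_natl (_ * _)) mulrA expr2.
apply: ler_sum => j _.
by apply: (variation_le (fun j => smp n f k l i j)) => //; rewrite /L; lia.
Qed.

Lemma nrm_sub_mean_grad f fs ft : L2 f -> L2 fs -> L2 ft -> weak_s f fs -> weak_t f ft ->
  nrm (fun x => f x - int2 f) <= 2 * (nrm fs + nrm ft).
Proof.
move=> Lf Lfs Lft ws wt; have f1 := nrm_ge0 fs; have f2 := nrm_ge0 ft.
apply: (nrm_le_samples hs hd Lf); first by rewrite mulr_ge0 ?addr_ge0.
move=> n n1; have L0 : (0 < 2 * n)%N by lia.
have [c hc] := discrete_poincare (smp n f 1 1) L0; exists c.
apply: (le_trans hc); set N : R := (gridN n)%:R; have Np : 0 < N := NR n.
have LN : (2 * n)%:R <= N :> R by rewrite ler_nat /gridN; lia.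
have hb1 : sq2 (2 * n) (2 * n) (smp n fs 2 1) <= N^-1 ^+ 2 * nrm fs ^+ 2.
  by apply: samp_bessel => //; rewrite /gridN; lia.
have hb2 : sq2 (2 * n) (2 * n) (smp n ft 1 2) <= N^-1 ^+ 2 * nrm ft ^+ 2.
  by apply: samp_bessel => //; rewrite /gridN; lia.
have -> : sq2 (2 * n) (2 * n) (ds (smp n f 1 1)) = N^-1 ^+ 2 * sq2 (2 * n) (2 * n) (smp n fs 2 1).
  rewrite -sq2Z; apply: eq_sq2 => i j hi hj.
  by rewrite (samp_ds hs hd (N0 n) Lf ws) //; rewrite /gridN; lia.
have -> : sq2 (2 * n) (2 * n) (dt (smp n f 1 1)) = N^-1 ^+ 2 * sq2 (2 * n) (2 * n) (smp n ft 1 2).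
  rewrite -sq2Z; apply: eq_sq2 => i j hi hj.
  by rewrite (samp_dt hs hd (N0 n) Lf wt) //; rewrite /gridN; lia.
rewrite -mulrDr; set A := sq2 _ _ _ in hb1 *; set B := sq2 _ _ _ in hb2 *.
have A0 : 0 <= A + B by rewrite addr_ge0 ?sq2_ge0.
apply: (@le_trans _ _ (2 * (A + B))).
  rewrite -mulrA ler_pM2l // mulrA -[leRHS]mul1r; apply: ler_wpM2r => //.
  rewrite -exprMn expr_le1 // ?mulr_ge0 ?invr_ge0 ?(ltW Np) //.
  by rewrite ler_pdivrMr // mul1r.
rewrite exprMn; set q := N^-1 ^+ 2 in hb1 hb2 *; have q0 : 0 <= q by exact: sqr_ge0.
have : q * (nrm fs ^+ 2 + nrm ft ^+ 2) <= q * (nrm fs + nrm ft) ^+ 2.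
  by apply: ler_wpM2l => //; have := mulr_ge0 f1 f2; lra.
have : 0 <= q * (nrm fs + nrm ft) ^+ 2 by rewrite mulr_ge0 // sqr_ge0.
lra.
Qed.

(* The functions of s alone whose discrete primitives P and Q are subtracted are the values
   on the bottom row of the grid; they absorb the curvature terms up to t-derivatives. *)
Lemma frame_korn (e : R) a b as_ at_ bs bt ka kb kat kbt : 0 < e ->
  L2 a -> L2 b -> L2 as_ -> L2 at_ -> L2 bs -> L2 bt -> L2 ka -> L2 kb -> L2 kat -> L2 kbt ->
  weak_s a as_ -> weak_t a at_ -> weak_s b bs -> weak_t b bt ->
  weak_t ka kat -> weak_t kb kbt ->
  nrm (fun x => e * at_ x - int2 (fun x => e * at_ x)) <= 10 ^+ 7 *
   (e * nrm (fun x => as_ x - kb x) + e * nrm kbt + nrm bt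
     + nrm (fun x => e * at_ x + bs x + ka x) + nrm kat).
Proof.
move=> e0 La Lb Las Lat Lbs Lbt Lka Lkb Lkat Lkbt wa wat wb wbt wka wkb.
have Lf : L2 (fun x => e * at_ x) by exact: L2Z.
have Lak : L2 (fun x => as_ x - kb x) by exact: L2B.
have Lsh : L2 (fun x => e * at_ x + bs x + ka x) by apply: L2D => //; exact: L2D.
set x1 := nrm (fun x => as_ x - kb x); set x2 := nrm kbt; set x3 := nrm bt.
set x4 := nrm (fun x => e * at_ x + bs x + ka x); set x5 := nrm kat.
have p1 : 0 <= x1 := nrm_ge0 _. have p2 : 0 <= x2 := nrm_ge0 _.
have p3 : 0 <= x3 := nrm_ge0 _. have p4 : 0 <= x4 := nrm_ge0 _. have p5 : 0 <= x5 := nrm_ge0 _.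
set X := e * x1 + e * x2 + x3 + x4 + x5.
have q1 : 0 <= e * x1 by rewrite mulr_ge0 // ltW.
have q2 : 0 <= e * x2 by rewrite mulr_ge0 // ltW.
have X0 : 0 <= X by rewrite !addr_ge0.
apply: (nrm_le_samples hs hd Lf); first by apply: mulr_ge0 => //; exact: exprn_ge0.
move=> n n1; set N : R := (gridN n)%:R; have Np : 0 < N := NR n.
set L := (2 * n + 2)%N.
pose P i := \sum_(i' < i) e * (N^-1 * smp n kb 2 0 i' 0).
pose Q i := \sum_(i' < i) N^-1 * smp n ka 1 1 i' 0.
(* The degrees are staggered: [a] is sampled with [(1, 0)] and [b] with [(0, 1)], so that
   differences in t of the former and in s of the latter both become samples of degree [(1, 1)] and
   can be added in the shear. *)
pose u1 i j := e * smp n a 1 0 i j - P i.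
pose u2 i j := smp n b 0 1 i j + Q i.
have [c hc] := discrete_korn u1 u2 n1; rewrite -/L in hc.
have PS i : P i.+1 = P i + e * (N^-1 * smp n kb 2 0 i 0) by rewrite /P big_ord_recr.
have QS i : Q i.+1 = Q i + N^-1 * smp n ka 1 1 i 0 by rewrite /Q big_ord_recr.
have idx k i := @gridN_node n k i; have bes k (l : nat) := @gridN_support n k.
have hds i j : (i < L)%N -> (j < L)%N -> ds u1 i j = (e * N^-1) *
    (smp n (fun x => as_ x - kb x) 2 0 i j + (smp n kb 2 0 i j - smp n kb 2 0 i 0)).
  move=> hi hj; have := samp_ds hs hd (N0 n) La wa (idx 2%N i isT hi) (idx 0%N j isT hj).
  rewrite /ds -/N => h; rewrite /u1 PS.
  have -> : smp n a 1 0 i.+1 j = smp n a 1 0 i j + N^-1 * smp n as_ 2 0 i j by lra.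
  have -> : smp n as_ 2 0 i j = smp n (fun x => as_ x - kb x) 2 0 i j + smp n kb 2 0 i j.
    by rewrite -sampD //; apply: ip_eq => // x _; ring.
  ring.
have hdt i j : (i < L)%N -> (j < L)%N -> dt u2 i j = N^-1 * smp n bt 0 2 i j.
  move=> hi hj; have := samp_dt hs hd (N0 n) Lb wbt (idx 0%N i isT hi) (idx 2%N j isT hj).
  by rewrite /dt -/N => h; rewrite /u2 -h; ring.
have hdt1 i j : (i < L)%N -> (j < L)%N -> dt u1 i j = N^-1 * smp n (fun x => e * at_ x) 1 1 i j.
  move=> hi hj; have := samp_dt hs hd (N0 n) La wat (idx 1%N i isT hi) (idx 1%N j isT hj).
  rewrite /dt -/N => h; rewrite /u1 sampZ // mulrCA -h; ring.
have hsh i j : (i < L)%N -> (j < L)%N -> shear u1 u2 i j = N^-1 *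
    (smp n (fun x => e * at_ x + bs x + ka x) 1 1 i j + -1 * (smp n ka 1 1 i j - smp n ka 1 1 i 0)).
  move=> hi hj; rewrite /shear hdt1 //.
  have := samp_ds hs hd (N0 n) Lb wb (idx 1%N i isT hi) (idx 1%N j isT hj).
  rewrite /ds -/N => h; rewrite /u2 QS !sampD //; last by exact: L2D.
  have -> : smp n b 0 1 i.+1 j = smp n b 0 1 i j + N^-1 * smp n bs 1 1 i j by lra.
  ring.
set q := N^-1 ^+ 2; have qp : 0 < q by rewrite exprn_gt0 // invr_gt0.
have E1 : sq2 L L (ds u1) <= e ^+ 2 * q * (2 * (q * x1 ^+ 2) + 2 * (q * x2 ^+ 2)).
  rewrite (eq_sq2 hds) sq2Z exprMn -/q; apply: ler_wpM2l; first by rewrite mulr_ge0 ?sqr_ge0 // ltW.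
  apply: (le_trans (sq2D_le _ _ _ _)); apply: lerD; rewrite ler_pM2l //.
    by apply: samp_bessel => //; exact: (bes _ 0%N).
  exact: samp_vertical.
have E2 : sq2 L L (dt u2) <= q * (q * x3 ^+ 2).
  rewrite (eq_sq2 hdt) sq2Z -/q ler_pM2l //; apply: samp_bessel => //; exact: (bes _ 0%N).
have E3 : sq2 L L (shear u1 u2) <= q * (2 * (q * x4 ^+ 2) + 2 * (q * x5 ^+ 2)).
  rewrite (eq_sq2 hsh) sq2Z -/q ler_pM2l //.
  apply: (le_trans (sq2D_le _ _ _ _)); apply: lerD; rewrite ler_pM2l //.
    by apply: samp_bessel => //; exact: (bes _ 0%N).
  rewrite sq2Z sqrrN expr1n mul1r; exact: samp_vertical.
have E : energy L L u1 u2 <= q * (q * (2 * X ^+ 2)).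
  apply: (le_trans (lerD (lerD E1 E2) E3)).
  have -> : e ^+ 2 * q * (2 * (q * x1 ^+ 2) + 2 * (q * x2 ^+ 2)) + q * (q * x3 ^+ 2)
     + q * (2 * (q * x4 ^+ 2) + 2 * (q * x5 ^+ 2)) =
     q * (q * (2 * (e * x1) ^+ 2 + 2 * (e * x2) ^+ 2 + x3 ^+ 2 + 2 * x4 ^+ 2 + 2 * x5 ^+ 2)) by ring.
  rewrite !ler_pM2l //; rewrite /X.
  move: (e * x1) (e * x2) q1 q2 => y1 y2 r1 r2.
  have h12 := mulr_ge0 r1 r2; have h13 := mulr_ge0 r1 p3; have h14 := mulr_ge0 r1 p4; have h15 := mulr_ge0 r1 p5.
  have h23 := mulr_ge0 r2 p3; have h24 := mulr_ge0 r2 p4; have h25 := mulr_ge0 r2 p5.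
  have h34 := mulr_ge0 p3 p4; have h35 := mulr_ge0 p3 p5; have h45 := mulr_ge0 p4 p5; have h33 := sqr_ge0 x3.
  clear -h12 h13 h14 h15 h23 h24 h25 h34 h35 h45 h33; lra.
(* Samples of [e * at_] are [N] times the differences of [u1], so the constant is scaled alike. *)
exists (N * c).
have -> : sq2 (2 * n) (2 * n) (fun i j => smp n (fun x => e * at_ x) 1 1 i j - N * c)
   = N ^+ 2 * sq2 (2 * n) (2 * n) (fun i j => dt u1 i j - c).
  rewrite -sq2Z; apply: eq_sq2 => i j hi hj.
  rewrite hdt1; [|exact: ltn_addr..].
  by rewrite mulrBr mulVKf // gt_eqF.
apply: (@le_trans _ _ (N ^+ 2 * (10 ^+ 13 * (q * (q * (2 * X ^+ 2)))))).
  rewrite ler_pM2l ?exprn_gt0 //; apply: (le_trans hc).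
  by apply: ler_wpM2l => //; exact: exprn_ge0.
have NQ : N ^+ 2 * q = 1 by rewrite /q exprVn divff // gt_eqF // exprn_gt0.
rewrite (_ : N ^+ 2 * _ = (N ^+ 2 * q) * (2 * 10 ^+ 13 * (q * X ^+ 2))); last by ring.
rewrite NQ mul1r expr_div_n [(_ * X) ^+ 2]exprMn -exprVn -/q.
rewrite -[leRHS]mulrA [X ^+ 2 * q]mulrC; apply: ler_wpM2r; first by rewrite mulr_ge0 ?sqr_ge0 // ltW.
(* [10 ^ 7] is a convenient bound for the square root of [2 * 10 ^ 13]. *)
rewrite -exprM (_ : (7 * 2 = 14)%N) // [10 ^+ 14]exprS; apply: ler_wpM2r; first exact: exprn_ge0.
by rewrite ler_nat.
Qed.

End KornPoincare.

(** * Classical derivatives are weak derivatives *)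

Section Classical.
Variable R : realType.
Notation S := (@Sdom R).
Notation mu := (@mu2 R).
Notation TT := (measurableTypeR R * measurableTypeR R)%type.
Notation msr f := (@measurable_fun _ _ TT R S f).
Notation intg f := (mu.-integrable S (EFin \o f)).
Implicit Types f g h phi : R * R -> R.

Lemma is_derive_fstE f (s t d : R) :
  is_derive (s, t) ((1, 0) : R * R) f d -> is_derive s (1 : R) (fun s => f (s, t)) d.
Proof.
have e : (fun h : R => h^-1 *: ((f \o shift (s, t)) (h *: ((1, 0) : R * R)) - f (s, t))) =
  (fun h : R => h^-1 *: (((fun s => f (s, t)) \o shift s) (h *: (1 : R)) - f (s, t))).
  apply/funext => h /=; congr (_ *: (f _ - f _)).
  by congr pair; rewrite /= /GRing.scale /= mulr0 add0r.
by case=> dv de; apply: DeriveDef; rewrite /derivable /derive -e.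
Qed.

Lemma is_derive_sndE f (s t d : R) :
  is_derive (s, t) ((0, 1) : R * R) f d -> is_derive t (1 : R) (fun t => f (s, t)) d.
Proof.
have e : (fun h : R => h^-1 *: ((f \o shift (s, t)) (h *: ((0, 1) : R * R)) - f (s, t))) =
  (fun h : R => h^-1 *: (((fun t => f (s, t)) \o shift t) (h *: (1 : R)) - f (s, t))).
  apply/funext => h /=; congr (_ *: (f _ - f _)).
  by congr pair; rewrite /= /GRing.scale /= mulr0 add0r.
by case=> dv de; apply: DeriveDef; rewrite /derivable /derive -e.
Qed.

(** On S a continuous function is the pointwise limit of its quasi-interpolants, finite sums of
    products of functions of one variable, which are measurable for the product structure. *)
Lemma continuous2_msr g : continuous g -> msr g.
Proof.
move=> cg; have [Hs [hs hd]] := steps_exist R.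
apply: (@measurable_fun_cvg _ TT R S (fun n => quasi Hs n g)).
  by move=> n; exact: (L2_msr (quasi_L2 hs n g)).
by move=> x Sx; apply: (quasi_cvg hs Sx); exact: cg.
Qed.

Lemma continuous2_bounded g : continuous g -> exists M, 0 <= M /\ forall x, S x -> `|g x| <= M.
Proof.
move=> cg.
have cK : compact (`[0, 1]%classic `*` `[(- 2^-1), 2^-1]%classic : set (R * R)).
  by apply: compact_setX; exact: segment_compact.
have [M [_ hM]] := compact_bounded (continuous_compact (continuous_subspaceT cg) cK).
exists (`|M| + 1); split; first by rewrite addr_ge0.
move=> x [/andP[s0 s1] /andP[t0 t1]]; apply: (hM (`|M| + 1)).
  by apply: (le_lt_trans (ler_norm M)); rewrite ltrDl.
by exists x => //; split; rewrite /= in_itv /= !ltW.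
Qed.

Lemma continuous2_L2 g : continuous g -> L2 g.
Proof.
move=> cg; have [M [_ hM]] := continuous2_bounded cg.
exact: (bounded_L2 (continuous2_msr cg) hM).
Qed.

Lemma continuous_section1 g (t : R) : continuous g -> continuous (fun s : R => g (s, t)).
Proof.
move=> cg s; apply: (@cvg_comp _ _ _ (fun s => (s, t)) g _ (nbhs (s, t))); last exact: cg.
by apply: (@cvg_pair _ _ _ (nbhs s) (nbhs s) (nbhs t) _ _ _); [exact: cvg_id|exact: cvg_cst].
Qed.

Lemma continuous_section2 g (s : R) : continuous g -> continuous (fun t : R => g (s, t)).
Proof.
move=> cg t; apply: (@cvg_comp _ _ _ (fun t => (s, t)) g _ (nbhs (s, t))); last exact: cg.
by apply: (@cvg_pair _ _ _ (nbhs t) (nbhs s) (nbhs t) _ _ _); [exact: cvg_cst|exact: cvg_id].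
Qed.

Lemma test_fun_continuous phi : test_fun phi ->
  continuous phi /\ forall j, continuous (pderiv j phi).
Proof.
move=> [sm _]; split; first by case: (sm [::]).
by move=> j; case: (sm [:: j]).
Qed.

Lemma test_fun_derive j phi x : test_fun phi -> is_derive x (dir R j) phi (pderiv j phi x).
Proof. by move=> [sm _]; apply: derivableP; case: (sm [::]) => _; apply. Qed.

Lemma int2_product_rule f g phi psi : L2 f -> L2 g -> continuous phi -> continuous psi ->
  int2 (fun x => f x * psi x + g x * phi x) = 0 ->
  int2 (fun x => f x * psi x) = - int2 (fun x => g x * phi x).
Proof.
move=> Lf Lg cphi cpsi; rewrite int2D; first by move=> h; lra.
  by apply: L2_intgM => //; exact: continuous2_L2.
by apply: L2_intgM => //; exact: continuous2_L2.
Qed.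

Lemma classical_weak_s f g : L2 f -> L2 g ->
  (forall s t : R, is_derive s (1 : R) (fun s => f (s, t)) (g (s, t))) ->
  (forall t : R, continuous (fun s : R => g (s, t))) -> weak_pderiv ord0 f g.
Proof.
move=> Lf Lg df cg phi tp; have [cp cdp] := test_fun_continuous tp.
apply: int2_product_rule => //.
have cf t : continuous (fun s : R => f (s, t)) by exact: (is_derive_continuous (fun s => df s t)).
apply: (@int2_ds _ (fun x => f x * phi x)).
- by apply: intgD; apply: L2_intgM => //; exact: continuous2_L2.
- move=> t _ s.
  have dp := is_derive_fstE (test_fun_derive ord0 (s, t) tp).
  have := @is_deriveM _ _ (fun s => f (s, t)) (fun s => phi (s, t)) s 1 _ _ (df s t) dp.
  by move=> h; apply: is_derive_eq h _; rewrite /GRing.scale /= [phi _ * _]mulrC.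
- move=> t _ s; apply: cvgD; apply: cvgM.
  + exact: cf.
  + exact: (continuous_section1 (t := t) (cdp ord0)).
  + exact: cg.
  + exact: (continuous_section1 (t := t) cp).
- move=> t _; have [_ [a [b [c [d [a0 [_ [b1 [_ [_ [_ h0]]]]]]]]]]] := tp.
  by rewrite !h0 ?mulr0 //= => -[/andP[h1 h2] _]; lra.
Qed.

Lemma classical_weak_t f g : L2 f -> L2 g ->
  (forall s t : R, is_derive t (1 : R) (fun t => f (s, t)) (g (s, t))) ->
  (forall s : R, continuous (fun t : R => g (s, t))) -> weak_pderiv (lift ord0 ord0) f g.
Proof.
move=> Lf Lg df cg phi tp; have [cp cdp] := test_fun_continuous tp.
apply: int2_product_rule => //.
have cf s : continuous (fun t : R => f (s, t)) by exact: (is_derive_continuous (fun t => df s t)).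
apply: (@int2_dt _ (fun x => f x * phi x)).
- by apply: intgD; apply: L2_intgM => //; exact: continuous2_L2.
- move=> s _ t.
  have dp := is_derive_sndE (test_fun_derive (lift ord0 ord0) (s, t) tp).
  have := @is_deriveM _ _ (fun t => f (s, t)) (fun t => phi (s, t)) t 1 _ _ (df s t) dp.
  by move=> h; apply: is_derive_eq h _; rewrite /GRing.scale /= [phi _ * _]mulrC.
- move=> s _ t; apply: cvgD; apply: cvgM.
  + exact: cf.
  + exact: (continuous_section2 (s := s) (cdp (lift ord0 ord0))).
  + exact: cg.
  + exact: (continuous_section2 (s := s) cp).
- move=> s _; have [_ [a [b [c [d [_ [_ [_ [c0 [_ [d1 h0]]]]]]]]]]] := tp.
  by rewrite !h0 ?mulr0 //= => -[_ /andP[h1 h2]]; lra.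
Qed.

(** Rigid displacements of a rod are affine along the fibres, and so are their s-derivatives; this
    puts them in [W^{1,2}]. *)
Lemma fiber_affine_weak (A A' B B' : R -> R) :
  (forall s, is_derive s (1 : R) A (A' s)) -> (forall s, is_derive s (1 : R) B (B' s)) ->
  continuous A' -> continuous B' ->
  [/\ L2 (fun x => A x.1 + x.2 * B x.1),
      L2 (fun x => A' x.1 + x.2 * B' x.1) /\
      weak_pderiv ord0 (fun x => A x.1 + x.2 * B x.1) (fun x => A' x.1 + x.2 * B' x.1) &
      L2 (fun x => B x.1) /\
      weak_pderiv (lift ord0 ord0) (fun x => A x.1 + x.2 * B x.1) (fun x => B x.1)].
Proof.
move=> dA dB cA' cB'.
have cA := is_derive_continuous dA; have cB := is_derive_continuous dB.
have L (C D : R -> R) : continuous C -> continuous D -> L2 (fun x : R * R => C x.1 + x.2 * D x.1).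
  move=> cC cD; apply: continuous2_L2 => x; apply: cvgD.
    by apply: continuous_comp; [exact: cvg_fst|exact: cC].
  apply: cvgM; first exact: cvg_snd.
  by apply: continuous_comp; [exact: cvg_fst|exact: cD].
have L0 := L _ _ cA cB; have L1 := L _ _ cA' cB'.
have L2' : L2 (fun x : R * R => B x.1).
  have := tensor_L2 cB (fun x : R => @cst_continuous R R 1 x); apply: L2_eq => x _.
  by rewrite /tensor /= mulr1.
split => //; split => //.
- apply: classical_weak_s => // [s t|t s] /=.
    have h1 : is_derive s (1 : R) (fun s => t * B s) (t * B' s) by exact: is_derive_mull.
    by have := is_deriveD (dA s) h1.
  by apply: cvgD; [exact: cA'|apply: cvgM; [exact: cvg_cst|exact: cB']].
- apply: classical_weak_t => // [s t|s t] /=; last exact: cvg_cst.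
  have h1 : is_derive t (1 : R) (fun t => t * B s) (1 * B s).
    exact: (@is_derive_mulr _ id (fun=> 1) t (B s) (is_derive_id _ _)).
  have h2 := is_deriveD (is_derive_cst (A s) t (1 : R)) h1.
  by apply: is_derive_eq h2 _; rewrite add0r mul1r.
Qed.

End Classical.

(** * Estimates in the moving frame *)
Section Rigidity.
Variable R : realType.
Notation S := (@Sdom R).
Notation TT := (measurableTypeR R * measurableTypeR R)%type.
Notation msr f := (@measurable_fun _ _ TT R S f).
Notation o0 := (ord0 : 'I_2).
Notation o1 := (lift ord0 ord0 : 'I_2).
Notation K7 := (10 ^+ 7 : R).
Implicit Types f g : R * R -> R.

Lemma sum2 (F : 'I_2 -> R) : \sum_(i < 2) F i = F o0 + F o1.
Proof. by rewrite !big_ord_recl big_ord0 addr0. Qed.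

Lemma ord2_ind (P : 'I_2 -> Prop) : P o0 -> P o1 -> forall i, P i.
Proof. by move=> h0 h1 i; have [->|->] := ord2_cases i. Qed.

Definition W12_L2 (v : 'I_2 -> R * R -> R) (Dv : 'I_2 -> 'I_2 -> R * R -> R) :=
  (forall i, L2 (v i)) /\ (forall i j, L2 (Dv i j)).

Lemma W12_W12_L2 v Dv : W12 v Dv -> W12_L2 v Dv.
Proof. by case=> h1 h2; split => // i j; case: (h2 i j). Qed.

Lemma W12_innerE v Dv w Dw : W12_L2 v Dv -> W12_L2 w Dw -> W12_inner v Dv w Dw =
  (ip (v o0) (w o0) + ip (v o1) (w o1)) +
  ((ip (Dv o0 o0) (Dw o0 o0) + ip (Dv o0 o1) (Dw o0 o1)) +
   (ip (Dv o1 o0) (Dw o1 o0) + ip (Dv o1 o1) (Dw o1 o1))).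
Proof.
move=> [Lv LDv] [Lw LDw].
have I f g : L2 f -> L2 g -> (@mu2 R).-integrable S (EFin \o (fun x => f x * g x)) := @L2_intgM _ f g.
rewrite /ip -!int2D; do ?[apply: I => // | apply: intgD].
by apply: int2_eq => x _; rewrite !sum2.
Qed.

Lemma W12_L2B v Dv w Dw : W12_L2 v Dv -> W12_L2 w Dw ->
  W12_L2 (fun i x => v i x - w i x) (fun i j x => Dv i j x - Dw i j x).
Proof. by move=> [h1 h2] [h3 h4]; split=> *; exact: L2B. Qed.

Lemma W12_innerBr u Du v Dv w Dw : W12_L2 u Du -> W12_L2 v Dv -> W12_L2 w Dw ->
  W12_inner u Du (fun i x => v i x - w i x) (fun i j x => Dv i j x - Dw i j x) =
  W12_inner u Du v Dv - W12_inner u Du w Dw.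
Proof.
move=> Hu Hv Hw; have HB := W12_L2B Hv Hw; rewrite !W12_innerE //.
case: Hu => u1 u2; case: Hv => v1 v2; case: Hw => w1 w2.
by rewrite !ipBr //; ring.
Qed.

Lemma nrm_le_of_sqr f (N : R) : 0 <= N -> ip f f <= N -> nrm f <= Num.sqrt N.
Proof. by move=> N0 h; rewrite ler_sqrt. Qed.

Lemma sum6_ge (a b c d e f : R) : 0 <= a -> 0 <= b -> 0 <= c -> 0 <= d -> 0 <= e -> 0 <= f ->
  let s := (a + b) + ((c + d) + (e + f)) in
  [/\ a <= s, b <= s, c <= s & [/\ d <= s, e <= s & f <= s]].
Proof. by move=> a0 b0 c0 d0 e0 f0 /=; split; first [lra|split; lra]. Qed.

Lemma sum6_le (K a b c d e f : R) : a <= K -> b <= K -> c <= K -> d <= K -> e <= K -> f <= K ->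
  (a + b) + ((c + d) + (e + f)) <= 6 * K.
Proof. lra. Qed.

Lemma W12_inner_le u Du w Dw K : W12_L2 u Du -> W12_L2 w Dw -> 0 <= K ->
  (forall i, nrm (w i) <= K) -> (forall i j, nrm (Dw i j) <= K) ->
  W12_inner u Du w Dw <= 6 * K * W12_norm u Du.
Proof.
move=> Hu Hw K0 h1 h2.
have N0 : 0 <= W12_inner u Du u Du by rewrite W12_innerE // !addr_ge0 ?ip_ge0.
have [[u1 u2] [w1 w2]] := (Hu, Hw).
have b f g : L2 f -> L2 g -> ip f f <= W12_inner u Du u Du -> nrm g <= K ->
    ip f g <= K * W12_norm u Du.
  move=> Lf Lg hf hg; apply: (le_trans (ler_norm _)); apply: (le_trans (ip_le_nrm Lf Lg)).
  by rewrite mulrC ler_pM ?nrm_ge0 ?nrm_le_of_sqr.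
rewrite (W12_innerE Hu Hw).
have := sum6_ge (ip_ge0 (u o0)) (ip_ge0 (u o1)) (ip_ge0 (Du o0 o0)) (ip_ge0 (Du o0 o1))
  (ip_ge0 (Du o1 o0)) (ip_ge0 (Du o1 o1)).
rewrite -(W12_innerE Hu Hu) -mulrA => -[a1 a2 a3 [a4 a5 a6]].
by apply: sum6_le; exact: b.
Qed.

(* Since [v - p] is orthogonal to [p] and to [w], its squared norm is its inner
   product with [v - w]. *)
Lemma dist_proj_le (g2 g3 : R -> R) eps v Dv p Dp w Dw K : W12 v Dv -> is_proj g2 g3 eps v Dv p Dp ->
  in_M g2 g3 eps w Dw -> 0 <= K ->
  (forall i, nrm (fun x => v i x - w i x) <= K) ->
  (forall i j, nrm (fun x => Dv i j x - Dw i j x) <= K) ->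
  W12_norm (fun i x => v i x - p i x) (fun i j x => Dv i j x - Dp i j x) <= 6 * K.
Proof.
move=> /W12_W12_L2 Hv [Mp orth] Mw K0 h1 h2.
have Hp := W12_W12_L2 Mp.1; have Hw := W12_W12_L2 Mw.1.
have Hu := W12_L2B Hv Hp.
set u := (fun i x => v i x - p i x) in Hu *; set Du := (fun i j x => Dv i j x - Dp i j x) in Hu *.
have e : W12_inner u Du u Du =
    W12_inner u Du (fun i x => v i x - w i x) (fun i j x => Dv i j x - Dw i j x).
  by rewrite !W12_innerBr // (orth _ _ Mp) (orth _ _ Mw).
have := W12_inner_le Hu (W12_L2B Hv Hw) K0 h1 h2; rewrite -e.
have N0 : 0 <= W12_inner u Du u Du by rewrite W12_innerE // !addr_ge0 ?ip_ge0.
rewrite -{1}(sqr_sqrtr N0) -/(W12_norm u Du) => h.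
have n0 : 0 <= W12_norm u Du by exact: sqrtr_ge0.
have [->|n1] := eqVneq (W12_norm u Du) 0; first by rewrite mulr_ge0.
have n2 : 0 < W12_norm u Du by rewrite lt_def n1.
by move: h; rewrite expr2 ler_pM2r.
Qed.

Lemma Ck_is_derive n (f : R -> R) m : Ck n f -> (m < n)%N ->
  forall x, is_derive x (1 : R) (derive1n m f) (derive1n m.+1 f x).
Proof.
by move=> [h _] mn x; rewrite derive1nS derive1E; apply: derivableP; exact: h.
Qed.

Lemma unit_speed_derive (p q p1 q1 : R -> R) :
  (forall x, is_derive x (1 : R) p (p1 x)) -> (forall x, is_derive x (1 : R) q (q1 x)) ->
  (forall s, 0 <= s <= 1 -> p s ^+ 2 + q s ^+ 2 = 1) ->
  forall s, 0 < s < 1 -> p s * p1 s + q s * q1 s = 0.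
Proof.
move=> dp dq h s s01.
have d : is_derive s (1 : R) (fun x => p x * p x + q x * q x) (2 * (p s * p1 s + q s * q1 s)).
  apply: is_derive_eq (is_deriveD (is_deriveM (dp s) (dp s)) (is_deriveM (dq s) (dq s))) _.
  by rewrite /GRing.scale /=; ring.
have c : is_derive s (1 : R) (fun x => p x * p x + q x * q x) 0.
  apply: near_eq_is_derive (is_derive_cst (1 : R) s (1 : R)).
  have /near_in_itvoo : s \in `]0, 1[ by rewrite in_itv.
  apply: filterS => x; rewrite in_itv /= => /andP[x0 x1].
  by rewrite -!expr2 h // !ltW.
have := @derive_val _ _ _ _ _ _ _ d; rewrite (@derive_val _ _ _ _ _ _ _ c) => e; lra.
Qed.

Lemma weak_comb (m m' m'' l l' l'' : R -> R) f fs ft g gs gt :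
  (forall x, is_derive x (1 : R) m (m' x)) -> (forall x, is_derive x (1 : R) m' (m'' x)) ->
  continuous m'' ->
  (forall x, is_derive x (1 : R) l (l' x)) -> (forall x, is_derive x (1 : R) l' (l'' x)) ->
  continuous l'' ->
  L2 f -> L2 fs -> L2 ft -> weak_s f fs -> weak_t f ft ->
  L2 g -> L2 gs -> L2 gt -> weak_s g gs -> weak_t g gt ->
  [/\ L2 (fun x => m x.1 * f x + l x.1 * g x),
      L2 (fun x => (m x.1 * fs x + m' x.1 * f x) + (l x.1 * gs x + l' x.1 * g x)),
      L2 (fun x => m x.1 * ft x + l x.1 * gt x),
      weak_s (fun x => m x.1 * f x + l x.1 * g x)
        (fun x => (m x.1 * fs x + m' x.1 * f x) + (l x.1 * gs x + l' x.1 * g x)) &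
      weak_t (fun x => m x.1 * f x + l x.1 * g x) (fun x => m x.1 * ft x + l x.1 * gt x)].
Proof.
move=> dm dm' cm'' dl dl' cl'' Lf Lfs Lft wsf wtf Lg Lgs Lgt wsg wtg.
have cm := is_derive_continuous dm; have cm' := is_derive_continuous dm'.
have cl := is_derive_continuous dl; have cl' := is_derive_continuous dl'.
have [ws1 wt1] := weak_mul dm dm' cm'' Lf Lfs Lft wsf wtf.
have [ws2 wt2] := weak_mul dl dl' cl'' Lg Lgs Lgt wsg wtg.
have A := L2_mul1 cm Lf; have B := L2_mul1 cl Lg.
have As : L2 (fun x => m x.1 * fs x + m' x.1 * f x) by apply: L2D; exact: L2_mul1.
have Bs : L2 (fun x => l x.1 * gs x + l' x.1 * g x) by apply: L2D; exact: L2_mul1.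
have At := L2_mul1 cm Lft; have Bt := L2_mul1 cl Lgt.
by split; [exact: L2D|exact: L2D|exact: L2D|exact: weak_sD|exact: weak_tD].
Qed.

Lemma K7_ge1 : 1 <= K7.
Proof. by apply: exprn_ege1; rewrite ler1n. Qed.

Lemma small_curvature (M eps : R) : 1 <= M -> 0 < eps -> 4 * K7 * M * eps <= 1 -> eps * M <= 1.
Proof.
move=> M1 e0; have := K7_ge1; move: K7 => K K1; apply: le_trans.
by rewrite [eps * M]mulrC ler_pM2r // -[leLHS]mul1r ler_pM2r; lra.
Qed.

Lemma norm_jacobian_le (y : R) : 2^-1 <= y <= 2^-1 * 3 ->
  [/\ `|y| <= 2^-1 * 3, `|y| <= 2 & `|1 + y| <= 2^-1 * 5].
Proof. by case/andP=> h1 h2; split; rewrite ger0_norm; lra. Qed.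

(** The terms with [W] on the right add up to [2 * K * M * eps * W], at most [W / 2] by the
    smallness of [eps], and move to the left. The others are multiples of [E / eps] since
    [eps <= 1]. *)
Lemma nrm_le_affine_absorb (K M eps E W m : R) : 1 <= K -> 1 <= M -> 0 < eps -> eps <= 1 ->
   4 * K * M * eps <= 1 -> 0 <= E -> 0 <= W -> W <= E + m ->
  m <= K * ((2^-1 * 3) / eps * E + M * E + eps * E + (2^-1 * 5 * E + eps * M * W) + M * eps * (E + W)) ->
  W <= (2 + 2 * K * (5 + 2 * M)) / eps * E.
Proof.
move=> K1 M1 e0 e1 small E0 W0 hW hm.
have Kp : 0 < K by lra.
have ie : 1 <= eps^-1 by rewrite invf_ge1.
have h1 : m <= K * ((5 + 2 * M) * (eps^-1 * E) + 2 * M * eps * W).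
  apply: (le_trans hm); rewrite ler_pM2l //.
  have a1 : E <= eps^-1 * E by rewrite ler_peMl.
  have a2 : eps * E <= E by rewrite ler_piMl.
  have a3 : M * eps * E <= M * E by rewrite -mulrA ler_pM2l //; lra.
  have a4 : M * E <= M * (eps^-1 * E) by rewrite ler_pM2l //; lra.
  by rewrite -(mulrA _ eps^-1 E); lra.
have h2 : 2 * (K * (2 * M * eps * W)) <= W.
  by have := ler_wpM2r W0 small; lra.
have a1 : E <= eps^-1 * E by rewrite ler_peMl.
by rewrite -(mulrA _ eps^-1 E); lra.
Qed.

(** A function of mean zero is orthogonal to the constants. *)
Lemma nrm_shift_le f c : L2 f -> int2 f = 0 -> nrm f <= nrm (fun x => f x + c).
Proof.
move=> Lf f0; rewrite ler_sqrt ?ip_ge0 //.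
have Lc := L2_cst c; have e : ip f (fun=> c) = 0.
  rewrite /ip (@int2_eq _ _ (fun x => c * f x)) => [|x _]; last exact: mulrC.
  by rewrite int2Z ?f0 ?mulr0 //; exact: L2_intg.
rewrite ipDl ?ipDr //; last exact: L2D.
by rewrite e (ipC _ f) e addr0 add0r lerDl ip_ge0.
Qed.

Lemma nrm_comb_le (m l : R -> R) f g : continuous m -> continuous l ->
  (forall x, S x -> `|m x.1| <= 1) -> (forall x, S x -> `|l x.1| <= 1) -> L2 f -> L2 g ->
  nrm (fun x => m x.1 * f x + l x.1 * g x) <= nrm f + nrm g.
Proof.
move=> cm cl m1 l1 Lf Lg.
apply: (le_trans (nrmD (L2_mul1 cm Lf) (L2_mul1 cl Lg))).
have := nrmM_le (continuous_msr1 cm) m1 ler01 Lf.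
have := nrmM_le (continuous_msr1 cl) l1 ler01 Lg.
by rewrite !mul1r => h1 h2; exact: lerD.
Qed.

Lemma unit_le1 (a b : R) : a ^+ 2 + b ^+ 2 = 1 -> `|a| <= 1 /\ `|b| <= 1.
Proof. by move=> h; split; rewrite ler_norml; apply/andP; split; nra. Qed.

Lemma collect_bounds (C Y E W s0 t0 s1 t1 m0 m1 : R) : 0 <= E -> 0 <= W -> E <= Y -> W <= C * Y ->
  s0 <= 4 * E + 2 * W -> t0 <= 2 * E + W -> s1 <= 4 * E + 2 * W -> t1 <= 2 * E + W ->
  m0 <= 2 * (s0 + t0) -> m1 <= 2 * (s1 + t1) ->
  let B := 12 * (1 + C) * Y in
  [/\ s0 <= B /\ t0 <= B, s1 <= B /\ t1 <= B, m0 <= B & m1 <= B].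
Proof.
move=> E0 W0 EY WC h0 h1 h2 h3 h4 h5 /=.
have -> : 12 * (1 + C) * Y = 12 * Y + 12 * (C * Y) by ring.
move: (C * Y) WC => Z WZ; split; try split; lra.
Qed.

Lemma le_add2 (x y E W : R) : x <= 2 * E -> y <= 2 * (E + W) -> x + y <= 4 * E + 2 * W.
Proof. lra. Qed.

Lemma le_add1 (x y E W : R) : x <= E + W -> y <= E -> x + y <= 2 * E + W.
Proof. lra. Qed.

(** The Frenet equations: a vector orthogonal to the unit tangent [(p, q)] is a multiple of the
    normal [(- q, p)]. *)
Lemma frenet_algebra (p q p1 q1 : R) : p ^+ 2 + q ^+ 2 = 1 -> p * p1 + q * q1 = 0 ->
  p1 = - ((p * q1 - q * p1) * q) /\ q1 = (p * q1 - q * p1) * p.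
Proof.
move=> u h; split.
  rewrite -[LHS]mulr1 -u; apply/eqP; rewrite -subr_eq0; apply/eqP.
  by transitivity (p * (p * p1 + q * q1)); [ring|rewrite h mulr0].
rewrite -[LHS]mulr1 -u; apply/eqP; rewrite -subr_eq0; apply/eqP.
by transitivity (q * (p * p1 + q * q1)); [ring|rewrite h mulr0].
Qed.

(** Conjugation by the frame [R0] takes the symmetric part of [R0^T A] to that of [A R0^T] and
    preserves the Frobenius norm. The left side is the norm of the strain as defined, the right side
    its expression by components along tangent and normal. *)
Lemma strain_sqr_algebra (P Q a b c d : R) :
  (P * a - Q * c) ^+ 2 + (2^-1 * (Q * a + P * c + (P * b - Q * d))) ^+ 2 +
  ((2^-1 * (Q * a + P * c + (P * b - Q * d))) ^+ 2 + (Q * b + P * d) ^+ 2) =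
  (P * a + Q * b) ^+ 2 + 2 * (2^-1 * (- Q * a + P * b + (P * c + Q * d))) ^+ 2 +
  (- Q * c + P * d) ^+ 2.
Proof.
have h1 : 2 * (2^-1 : R) = 1 by rewrite divff.
(* One half becomes a variable [h] with [2 * h = 1]; the difference of the two sides is then a
   polynomial with the factor [(2 * h) ^+ 2 - 1]. *)
apply/eqP; rewrite -subr_eq0; apply/eqP; move: 2^-1 h1 => h h1.
transitivity (2 * ((2 * h) ^+ 2 - 1) * (P * Q * (b + c) * (a - d))); first by ring.
by rewrite h1; ring.
Qed.

Lemma strain_solve (P Q a b c d j e : R) : j != 0 -> e != 0 ->
  let y := - Q * (a / j) + P * (b / j) in let z := P * (c / e) + Q * (d / e) in
  [/\ P * a + Q * b = j * (P * (a / j) + Q * (b / j)),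
      - Q * a + P * b = j * (2^-1 * (y + z) + 2^-1 * (y - z)),
      P * c + Q * d = e * (2^-1 * (y + z) - 2^-1 * (y - z)) &
      - Q * c + P * d = e * (- Q * (c / e) + P * (d / e))].
Proof.
move=> j0 e0 /=.
have h (x y : R) : 2^-1 * (x + y) + 2^-1 * (x - y) = x by lra.
have h' (x y : R) : 2^-1 * (x + y) - 2^-1 * (x - y) = y by lra.
by rewrite h h' !mulrDr !(mulrCA j) !(mulrCA e) !mulfV // !mulr1.
Qed.

Lemma is_derive_mulB (a b c d : R -> R) a1 b1 c1 d1 (s : R) :
  is_derive s (1 : R) a a1 -> is_derive s (1 : R) b b1 ->
  is_derive s (1 : R) c c1 -> is_derive s (1 : R) d d1 ->
  is_derive s (1 : R) (fun x => a x * b x - c x * d x)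
    ((a1 * b s + a s * b1) - (c1 * d s + c s * d1)).
Proof.
move=> da db dc dd; apply: is_derive_eq (is_deriveB (is_deriveM da db) (is_deriveM dc dd)) _.
by rewrite /GRing.scale /=; ring.
Qed.

Lemma is_derive_wronskian (a b a1 b1 a2 b2 : R -> R) (s : R) :
  (forall x, is_derive x (1 : R) a (a1 x)) -> (forall x, is_derive x (1 : R) b (b1 x)) ->
  (forall x, is_derive x (1 : R) a1 (a2 x)) -> (forall x, is_derive x (1 : R) b1 (b2 x)) ->
  is_derive s (1 : R) (fun x => a x * b1 x - b x * a1 x) (a s * b2 s - b s * a2 s).
Proof.
move=> da db da1 db1; apply: is_derive_eq (is_derive_mulB (da s) (db1 s) (db s) (da1 s)) _.
ring.
Qed.

Variables g2 g3 p q p1 q1 p2 q2 k k1 k2 : R -> R.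
Hypothesis pE : derive1n 1 g2 = p.
Hypothesis qE : derive1n 1 g3 = q.
Hypothesis kE : curvature g2 g3 = k.
Notation J eps := (fun x : R * R => 1 - eps * x.2 * k x.1).

Hypothesis dg2 : forall x, is_derive x (1 : R) g2 (p x).
Hypothesis dg3 : forall x, is_derive x (1 : R) g3 (q x).
Hypothesis dp : forall x, is_derive x (1 : R) p (p1 x).
Hypothesis dq : forall x, is_derive x (1 : R) q (q1 x).
Hypothesis dp1 : forall x, is_derive x (1 : R) p1 (p2 x).
Hypothesis dq1 : forall x, is_derive x (1 : R) q1 (q2 x).
Hypothesis dk : forall x, is_derive x (1 : R) k (k1 x).
Hypothesis dk1 : forall x, is_derive x (1 : R) k1 (k2 x).
Hypothesis cp2 : continuous p2.
Hypothesis cq2 : continuous q2.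
Hypothesis ck2 : continuous k2.
Hypothesis unit_speed : forall s, 0 < s < 1 -> p s ^+ 2 + q s ^+ 2 = 1.
Hypothesis frenet_p : forall s, 0 < s < 1 -> p1 s = - (k s * q s).
Hypothesis frenet_q : forall s, 0 < s < 1 -> q1 s = k s * p s.

Let cp : continuous p := is_derive_continuous dp.
Let cq : continuous q := is_derive_continuous dq.
Let cp1 : continuous p1 := is_derive_continuous dp1.
Let cq1 : continuous q1 := is_derive_continuous dq1.
Let ck : continuous k := is_derive_continuous dk.

Lemma jacobian_bounds M eps x : S x -> `|k x.1| <= M -> 0 < eps -> eps * M <= 1 ->
  `|J eps x - 1| <= eps * M /\ 2^-1 <= J eps x <= 2^-1 * 3.
Proof.
move=> [_ /andP[t0 t1]] kM e0 eM.
have h : `|x.2 * k x.1| <= 2^-1 * M.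
  rewrite normrM ler_pM // ler_norml; apply/andP; split; exact: ltW.
have h' : `|eps * (x.2 * k x.1)| <= eps * (2^-1 * M) by rewrite normrM (gtr0_norm e0) ler_pM2l.
have -> : J eps x - 1 = - (eps * (x.2 * k x.1)) by ring.
have -> : J eps x = 1 - eps * (x.2 * k x.1) by rewrite mulrA.
rewrite normrN; split; first by have := normr_ge0 (eps * (x.2 * k x.1)); lra.
by move: h'; rewrite ler_norml => /andP[h1 h2]; apply/andP; split; lra.
Qed.

Lemma jacobian_msr eps : msr (J eps).
Proof.
have mt := continuous_msr2 (fun x : R => @cvg_id _ (nbhs x)).
have := msrD (msr_cst 1) (msrZ (- eps) (msrM mt (continuous_msr1 ck))).
by apply: msr_eq => x _ /=; ring.
Qed.

Lemma curvature_bound : exists M, 1 <= M /\ forall x, S x -> `|k x.1| <= M.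
Proof.
have [M [M0 hM]] := continuous_bounded1 ck.
(* A bound [M >= 1] lets a smallness condition on [eps * M] bound [eps] as well. *)
exists (M + 1); split; first by rewrite lerDr.
by move=> x Sx; apply: (le_trans (hM x Sx)); rewrite lerDl.
Qed.

Notation cst M := (12 * (1 + (2 + 2 * K7 * (5 + 2 * M)))).

(** Here [a_t / eps] is [e12 - om], so Korn's inequality in the frame, with [e = 1 / eps], bounds
    the oscillation of [om], which has mean zero. On the right, [om] occurs only with a factor
    [eps * M]. *)
Lemma rotation_estimate M eps E (v0 v0s v0t v1 v1s v1t e11 e12 e22 om : R * R -> R) :
  1 <= M -> (forall x, S x -> `|k x.1| <= M) -> 0 < eps -> eps <= 1 -> 4 * K7 * M * eps <= 1 ->
  L2 v0 -> L2 v0s -> L2 v0t -> L2 v1 -> L2 v1s -> L2 v1t ->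
  weak_s v0 v0s -> weak_t v0 v0t -> weak_s v1 v1s -> weak_t v1 v1t ->
  L2 e11 -> L2 e12 -> L2 e22 -> L2 om ->
  nrm e11 <= E -> nrm e12 <= E -> nrm e22 <= E -> int2 om = 0 ->
  (forall x, S x -> p x.1 * v0s x + q x.1 * v1s x = J eps x * e11 x) ->
  (forall x, S x -> - q x.1 * v0s x + p x.1 * v1s x = J eps x * (e12 x + om x)) ->
  (forall x, S x -> p x.1 * v0t x + q x.1 * v1t x = eps * (e12 x - om x)) ->
  (forall x, S x -> - q x.1 * v0t x + p x.1 * v1t x = eps * e22 x) ->
  nrm om <= (2 + 2 * K7 * (5 + 2 * M)) / eps * E.
Proof.
move=> M1 kM e0 e1 small Lv0 Lv0s Lv0t Lv1 Lv1s Lv1t w0s w0t w1s w1t.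
move=> L11 L12 L22 Lo n11 n12 n22 om0 h11 h21 h12 h22.
have eM := small_curvature M1 e0 small; have M0 := le_trans ler01 M1.
have [c3 c5] : 0 <= 2^-1 * 3 :> R /\ 0 <= 2^-1 * 5 :> R by split; rewrite mulr_ge0 ?invr_ge0.
have E0 : 0 <= E := le_trans (nrm_ge0 _) n11.
pose nq x := - q x; pose nq1 x := - q1 x; pose nq2 x := - q2 x.
have dnq x : is_derive x (1 : R) nq (nq1 x) by exact: is_deriveN.
have dnq1 x : is_derive x (1 : R) nq1 (nq2 x) by exact: is_deriveN.
have cnq2 : continuous nq2 by move=> x; apply: cvgN; exact: cq2.
have [La Las Lat wsa wta] := weak_comb dp dp1 cp2 dq dq1 cq2 Lv0 Lv0s Lv0t w0s w0t Lv1 Lv1s Lv1t w1s w1t.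
have [Lb Lbs Lbt wsb wtb] := weak_comb dnq dnq1 cnq2 dp dp1 cp2 Lv0 Lv0s Lv0t w0s w0t Lv1 Lv1s Lv1t w1s w1t.
(* [a] and [b] are the components of the displacement along tangent and normal. *)
set a := (fun x : R * R => p x.1 * v0 x + q x.1 * v1 x) in La wsa wta *.
set b := (fun x : R * R => nq x.1 * v0 x + p x.1 * v1 x) in Lb wsb wtb *.
set as_ := (fun x : R * R => (p x.1 * v0s x + _) + _) in Las wsa.
set bs := (fun x : R * R => (nq x.1 * v0s x + _) + _) in Lbs wsb.
set at_ := (fun x : R * R => p x.1 * v0t x + _) in Lat wta.
set bt := (fun x : R * R => nq x.1 * v0t x + _) in Lbt wtb.
have [_ wka] := weak_mul dk dk1 ck2 La Las Lat wsa wta.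
have [_ wkb] := weak_mul dk dk1 ck2 Lb Lbs Lbt wsb wtb.
have Lka := L2_mul1 ck La; have Lkb := L2_mul1 ck Lb.
have Lkat := L2_mul1 ck Lat; have Lkbt := L2_mul1 ck Lbt.
have [Hs [hs hd]] := steps_exist R.
have ie : 0 < eps^-1 by rewrite invr_gt0.
have := frame_korn hs hd ie La Lb Las Lat Lbs Lbt Lka Lkb Lkat Lkbt wsa wta wsb wtb wka wkb.
set m := nrm _ => hm.
have S01 x : S x -> 0 < x.1 < 1 by case.
have mJ := jacobian_msr eps.
have JE x : S x -> `|J eps x| <= 2^-1 * 3.
  by move=> Sx; have [_ /norm_jacobian_le[]] := jacobian_bounds Sx (kM x Sx) e0 eM.
(* By the Frenet equations the curvature term cancels the derivative of the frame and leaves the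
   tangential component of the s-derivative. *)
have x1 : nrm (fun x => as_ x - k x.1 * b x) <= 2^-1 * 3 * E.
  rewrite (@nrm_eq _ _ (fun x => J eps x * e11 x)); last first.
    move=> x Sx; rewrite -h11 // /as_ /b /nq (frenet_p (S01 x Sx)) (frenet_q (S01 x Sx)); ring.
  by apply: (le_trans (nrmM_le mJ JE c3 L11)); exact: ler_wpM2l.
have x3 : nrm bt <= eps * E.
  rewrite (@nrm_eq _ _ (fun x => eps * e22 x)); last by move=> x Sx; rewrite -h22.
  by rewrite nrmZ // gtr0_norm // ler_pM2l.
have x2 : nrm (fun x => k x.1 * bt x) <= M * (eps * E).
  by apply: (le_trans (nrmM_le (continuous_msr1 ck) kM M0 Lbt)); exact: ler_wpM2l.
(* The rotation would cancel between the two halves of the shear if the Jacobian were 1; what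
   remains is [(J - 1) * om], of order [eps]. *)
have x4 : nrm (fun x => eps^-1 * at_ x + bs x + k x.1 * a x) <= 2^-1 * 5 * E + eps * M * nrm om.
  rewrite (@nrm_eq _ _ (fun x => (1 + J eps x) * e12 x + (J eps x - 1) * om x)); last first.
    move=> x Sx; rewrite /bs /nq1 (frenet_p (S01 x Sx)) (frenet_q (S01 x Sx)).
    rewrite /at_ h12 // mulKf ?gt_eqF //.
    have := h21 x Sx; rewrite /nq /a => h.
    transitivity (e12 x - om x + (- q x.1 * v0s x + p x.1 * v1s x)); first ring.
    by rewrite h; ring.
  have m1J : msr (fun x => 1 + J eps x) by apply: msrD => //; exact: msr_cst.
  have mJ1 : msr (fun x => J eps x - 1) by apply: msrD => //; exact: msr_cst.
  have b1 x : S x -> `|1 + J eps x| <= 2^-1 * 5.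
    by move=> Sx; have [_ /norm_jacobian_le[]] := jacobian_bounds Sx (kM x Sx) e0 eM.
  have b2 x : S x -> `|J eps x - 1| <= eps * M.
    by move=> Sx; have [] := jacobian_bounds Sx (kM x Sx) e0 eM.
  apply: (le_trans (nrmD (bounded_L2M m1J b1 L12) (bounded_L2M mJ1 b2 Lo))); apply: lerD.
    by apply: (le_trans (nrmM_le m1J b1 c5 L12)); exact: ler_wpM2l.
  by apply: nrmM_le => //; rewrite mulr_ge0 // ltW.
(* The second place where [om] itself appears: the t-derivative of [k a] contains it with the factor
   [eps]. *)
have x5 : nrm (fun x => k x.1 * at_ x) <= M * (eps * (E + nrm om)).
  apply: (le_trans (nrmM_le (continuous_msr1 ck) kM M0 Lat)); apply: ler_wpM2l => //.
  rewrite (@nrm_eq _ _ (fun x => eps * (e12 x - om x))); last by move=> x Sx; rewrite -h12.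
  rewrite nrmZ; last exact: L2B.
  by rewrite gtr0_norm // ler_pM2l //; apply: (le_trans (nrmB L12 Lo)); rewrite lerD2r.
(* Adding the mean of [a_t / eps] can only increase the norm of [om], and the sum is [e12] minus the
   oscillation of [a_t / eps]. *)
have hom : nrm om <= E + m.
  set c := int2 (fun x => eps^-1 * at_ x) in m hm *.
  apply: (le_trans (nrm_shift_le c Lo om0)).
  have Lm : L2 (fun x => eps^-1 * at_ x - c) by apply: L2B; [exact: L2Z|exact: L2_cst].
  rewrite (@nrm_eq _ _ (fun x => e12 x - (eps^-1 * at_ x - c))).
    by apply: (le_trans (nrmB L12 Lm)); rewrite lerD2r.
  move=> x Sx; rewrite /at_ h12 // mulKf ?gt_eqF //; ring.
apply: (nrm_le_affine_absorb K7_ge1 M1 e0 e1 small E0 (nrm_ge0 _) hom).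
apply: (le_trans hm); rewrite ler_pM2l; last by apply: lt_le_trans K7_ge1.
have y1 := ler_wpM2l (ltW ie) x1; have y2 := ler_wpM2l (ltW ie) x2.
rewrite mulrCA mulKf ?gt_eqF // in y2.
have -> : 2^-1 * 3 / eps * E = eps^-1 * (2^-1 * 3 * E) by ring.
have -> : M * eps * (E + nrm om) = M * (eps * (E + nrm om)) by ring.
by repeat apply: lerD.
Qed.

(** With [om] under control, all entries of the gradient in the frame are known; rotating back by
    the unit vectors [(p, q)] and [(- q, p)] bounds the derivatives, and Poincare's inequality the
    displacement up to its mean. *)
Lemma displacement_estimate M eps E (v0 v0s v0t v1 v1s v1t e11 e12 e22 om : R * R -> R) :
  1 <= M -> (forall x, S x -> `|k x.1| <= M) -> 0 < eps -> eps <= 1 -> 4 * K7 * M * eps <= 1 ->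
  L2 v0 -> L2 v0s -> L2 v0t -> L2 v1 -> L2 v1s -> L2 v1t ->
  weak_s v0 v0s -> weak_t v0 v0t -> weak_s v1 v1s -> weak_t v1 v1t ->
  L2 e11 -> L2 e12 -> L2 e22 -> L2 om ->
  nrm e11 <= E -> nrm e12 <= E -> nrm e22 <= E -> int2 om = 0 ->
  (forall x, S x -> p x.1 * v0s x + q x.1 * v1s x = J eps x * e11 x) ->
  (forall x, S x -> - q x.1 * v0s x + p x.1 * v1s x = J eps x * (e12 x + om x)) ->
  (forall x, S x -> p x.1 * v0t x + q x.1 * v1t x = eps * (e12 x - om x)) ->
  (forall x, S x -> - q x.1 * v0t x + p x.1 * v1t x = eps * e22 x) ->
  [/\ nrm v0s <= cst M / eps * E /\ nrm v0t <= cst M / eps * E,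
      nrm v1s <= cst M / eps * E /\ nrm v1t <= cst M / eps * E,
      nrm (fun x => v0 x - int2 v0) <= cst M / eps * E &
      nrm (fun x => v1 x - int2 v1) <= cst M / eps * E].
Proof.
move=> M1 kM e0 e1 small Lv0 Lv0s Lv0t Lv1 Lv1s Lv1t w0s w0t w1s w1t.
move=> L11 L12 L22 Lo n11 n12 n22 om0 h11 h21 h12 h22.
have := rotation_estimate M1 kM e0 e1 small
  Lv0 Lv0s Lv0t Lv1 Lv1s Lv1t w0s w0t w1s w1t L11 L12 L22 Lo n11 n12 n22 om0 h11 h21 h12 h22.
set W := nrm om; move: (2 + _) => C1 hW.
have S01 x : S x -> 0 < x.1 < 1 by case.
have p_1 x : S x -> `|p x.1| <= 1 by move=> /S01 /unit_speed /unit_le1 [].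
have q_1 x : S x -> `|q x.1| <= 1 by move=> /S01 /unit_speed /unit_le1 [].
pose nq x := - q x; have cnq : continuous nq by move=> x; apply: cvgN; exact: cq.
have nq_1 x : S x -> `|nq x.1| <= 1 by rewrite normrN; exact: q_1.
have E0 : 0 <= E := le_trans (nrm_ge0 _) n11.
have W0 : 0 <= W := nrm_ge0 _.
have eE : E <= eps^-1 * E by rewrite ler_peMl // invf_ge1.
have eM := small_curvature M1 e0 small.
have mJ := jacobian_msr eps.
have JE x : S x -> `|J eps x| <= 2.
  by move=> Sx; have [_ /norm_jacobian_le[]] := jacobian_bounds Sx (kM x Sx) e0 eM.
have mulJ f : L2 f -> nrm (fun x => J eps x * f x) <= 2 * nrm f.
  by move=> Lf; apply: nrmM_le.
have LX f g h : (forall x, S x -> h x = p x.1 * f x + q x.1 * g x) -> L2 f -> L2 g -> L2 h.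
  move=> e Lf Lg; apply: (L2_eq (f := fun x => p x.1 * f x + q x.1 * g x)).
    by move=> x Sx; rewrite e.
  by apply: L2D; exact: L2_mul1.
have LJ f : L2 f -> L2 (fun x => J eps x * f x) by move=> Lf; exact: bounded_L2M JE Lf.
have Lp : L2 (fun x => e12 x + om x) by exact: L2D.
have Lm : L2 (fun x => eps * (e12 x - om x)) by apply: L2Z; exact: L2B.
have Ln : L2 (fun x => eps * e22 x) by exact: L2Z.
have n1 : nrm (fun x => J eps x * e11 x) <= 2 * E by apply: (le_trans (mulJ _ L11)); rewrite ler_pM2l.
have n2 : nrm (fun x => J eps x * (e12 x + om x)) <= 2 * (E + W).
  apply: (le_trans (mulJ _ Lp)); rewrite ler_pM2l //; apply: (le_trans (nrmD L12 Lo)).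
  by rewrite lerD2r.
have n3 : nrm (fun x => eps * (e12 x - om x)) <= E + W.
  rewrite nrmZ; last exact: L2B.
  rewrite gtr0_norm //; apply: (@le_trans _ _ (1 * (E + W))); last by rewrite mul1r.
  apply: ler_pM => //; [exact: ltW|exact: nrm_ge0|].
  by apply: (le_trans (nrmB L12 Lo)); rewrite lerD2r.
have n4 : nrm (fun x => eps * e22 x) <= E.
  rewrite nrmZ // gtr0_norm //; apply: (@le_trans _ _ (1 * E)); last by rewrite mul1r.
  by apply: ler_pM => //; [exact: ltW|exact: nrm_ge0].
have b0s : nrm v0s <= 4 * E + 2 * W.
  rewrite (@nrm_eq _ _ (fun x => p x.1 * (J eps x * e11 x) + nq x.1 * (J eps x * (e12 x + om x)))).
    apply: (le_trans (nrm_comb_le cp cnq p_1 nq_1 (LJ _ L11) (LJ _ Lp))).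
    exact: le_add2.
  move=> x Sx; rewrite -h11 // -h21 // /nq -[LHS]mulr1 -(unit_speed (S01 x Sx)); ring.
have b1s : nrm v1s <= 4 * E + 2 * W.
  rewrite (@nrm_eq _ _ (fun x => q x.1 * (J eps x * e11 x) + p x.1 * (J eps x * (e12 x + om x)))).
    apply: (le_trans (nrm_comb_le cq cp q_1 p_1 (LJ _ L11) (LJ _ Lp))).
    exact: le_add2.
  move=> x Sx; rewrite -h11 // -h21 // -[LHS]mulr1 -(unit_speed (S01 x Sx)); ring.
have b0t : nrm v0t <= 2 * E + W.
  rewrite (@nrm_eq _ _ (fun x => p x.1 * (eps * (e12 x - om x)) + nq x.1 * (eps * e22 x))).
    apply: (le_trans (nrm_comb_le cp cnq p_1 nq_1 Lm Ln)).
    exact: le_add1.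
  move=> x Sx; rewrite -h12 // -h22 // /nq -[LHS]mulr1 -(unit_speed (S01 x Sx)); ring.
have b1t : nrm v1t <= 2 * E + W.
  rewrite (@nrm_eq _ _ (fun x => q x.1 * (eps * (e12 x - om x)) + p x.1 * (eps * e22 x))).
    apply: (le_trans (nrm_comb_le cq cp q_1 p_1 Lm Ln)).
    exact: le_add1.
  move=> x Sx; rewrite -h12 // -h22 // -[LHS]mulr1 -(unit_speed (S01 x Sx)); ring.
have [Hs [hs hd]] := steps_exist R.
have m0 := nrm_sub_mean_grad hs hd Lv0 Lv0s Lv0t w0s w0t.
have m1 := nrm_sub_mean_grad hs hd Lv1 Lv1s Lv1t w1s w1t.
have hW' : W <= C1 * (eps^-1 * E) by rewrite mulrA.
have := collect_bounds E0 W0 eE hW' b0s b0t b1s b1t m0 m1.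
by rewrite (mulrA _ eps^-1 E).
Qed.

Lemma strain_entries eps Dv x :
  let a := Dv o0 o0 x / J eps x in let b := Dv o1 o0 x / J eps x in
  let c := Dv o0 o1 x / eps in let d := Dv o1 o1 x / eps in
  [/\ strain g2 g3 eps Dv x o0 o0 = p x.1 * a - q x.1 * c,
      strain g2 g3 eps Dv x o0 o1 = 2^-1 * (q x.1 * a + p x.1 * c + (p x.1 * b - q x.1 * d)),
      strain g2 g3 eps Dv x o1 o0 = 2^-1 * (q x.1 * a + p x.1 * c + (p x.1 * b - q x.1 * d)) &
      strain g2 g3 eps Dv x o1 o1 = q x.1 * b + p x.1 * d].
Proof.
rewrite /strain /symmx !mxE !sum2 !mxE pE qE kE; move: (Dv _ _ _ / _) (Dv _ _ _ / _) (Dv _ _ _ / _) (Dv _ _ _ / _).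
move: (p x.1) (q x.1) => P Q a b c d; split; rewrite /=; lra.
Qed.

Lemma strain_sqr eps Dv x :
  let a := Dv o0 o0 x / J eps x in let b := Dv o1 o0 x / J eps x in
  let c := Dv o0 o1 x / eps in let d := Dv o1 o1 x / eps in
  \sum_(i < 2) \sum_(j < 2) strain g2 g3 eps Dv x i j ^+ 2 =
  (p x.1 * a + q x.1 * b) ^+ 2
  + 2 * (2^-1 * ((- q x.1 * a + p x.1 * b) + (p x.1 * c + q x.1 * d))) ^+ 2
  + (- q x.1 * c + p x.1 * d) ^+ 2.
Proof.
move=> a b c d; rewrite !sum2; have [-> -> -> ->] := strain_entries eps Dv x.
exact: strain_sqr_algebra.
Qed.

(* The infinitesimal rotation [c * (-y, x)] of the plane, evaluated at the point
   [gamma + eps t n] of the thin rod, plus the translation [d]. *)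
Definition rigid (eps c : R) (d : 'I_2 -> R) (i : 'I_2) (x : R * R) : R :=
  if i == o0 then (- c * g3 x.1 + d i) + x.2 * (- (c * eps) * p x.1)
  else (c * g2 x.1 + d i) + x.2 * (- (c * eps) * q x.1).

Definition rigid_grad (eps c : R) (i j : 'I_2) (x : R * R) : R :=
  if j == o0 then
    if i == o0 then - c * q x.1 + x.2 * (- (c * eps) * p1 x.1)
    else c * p x.1 + x.2 * (- (c * eps) * q1 x.1)
  else if i == o0 then - (c * eps) * p x.1 else - (c * eps) * q x.1.

Lemma rigid_W12 eps c d : W12 (rigid eps c d) (rigid_grad eps c).
Proof.
have dZ (f : R -> R) (f' : R) a s : is_derive s (1 : R) f f' -> is_derive s (1 : R) (fun x => a * f x) (a * f').
  by move=> h; have := is_deriveZ a h.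
have dA (f : R -> R) (f' : R) a b s : is_derive s (1 : R) f f' ->
    is_derive s (1 : R) (fun x => a * f x + b) (a * f').
  move=> h; have := is_deriveD (dZ _ _ a s h) (is_derive_cst b s (1 : R)).
  by rewrite addr0.
have cZ (f : R -> R) a : continuous f -> continuous (fun x => a * f x).
  by move=> cf x; apply: cvgM; [exact: cvg_cst|exact: cf].
have [a1 [a2 a3] [a4 a5]] := fiber_affine_weak
  (fun s => dA _ _ (- c) (d o0) s (dg3 s))
  (fun s => dZ _ _ (- (c * eps)) s (dp s))
  (cZ _ (- c) cq) (cZ _ (- (c * eps)) cp1).
have [b1 [b2 b3] [b4 b5]] := fiber_affine_weak
  (fun s => dA _ _ c (d o1) s (dg2 s))
  (fun s => dZ _ _ (- (c * eps)) s (dq s))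
  (cZ _ c cp) (cZ _ (- (c * eps)) cq1).
split; first by apply: ord2_ind.
by apply: ord2_ind; apply: ord2_ind.
Qed.

(** The Frenet equations produce the Jacobian, which cancels in the scaled gradient. What is left is
    [c] times the frame turned by a right angle, and its product with the transposed frame is skew:
    the strain of a rigid field vanishes. *)
Lemma rigid_gradE eps c x : S x ->
  [/\ rigid_grad eps c o0 o0 x = - c * q x.1 * J eps x,
      rigid_grad eps c o1 o0 x = c * p x.1 * J eps x,
      rigid_grad eps c o0 o1 x = - c * eps * p x.1 &
      rigid_grad eps c o1 o1 x = - c * eps * q x.1].
Proof.
move=> [s01 _]; rewrite /rigid_grad /= (frenet_p s01) (frenet_q s01).
by move: (p x.1) (q x.1) (k x.1) => P Q K; split; ring.
Qed.

Lemma rigid_in_M eps c d : 0 < eps -> (forall x, S x -> J eps x != 0) ->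
  in_M g2 g3 eps (rigid eps c d) (rigid_grad eps c).
Proof.
move=> e0 J0; split; first exact: rigid_W12.
apply: aeW => x Sx; have [h00 h10 h01 h11] := rigid_gradE eps c Sx.
have j0 := J0 x Sx; have en0 : eps != 0 by rewrite gt_eqF.
have [s00 s01 s10 s11] := strain_entries eps (rigid_grad eps c) x.
have ac y : - c * eps * y / eps = - c * y by rewrite mulrAC mulfK.
have e00 : strain g2 g3 eps (rigid_grad eps c) x o0 o0 = 0.
  rewrite s00 h00 h01 mulfK // ac; move: (p x.1) (q x.1) => P Q; ring.
have e11 : strain g2 g3 eps (rigid_grad eps c) x o1 o1 = 0.
  rewrite s11 h10 h11 mulfK // ac; move: (p x.1) (q x.1) => P Q; ring.
have e01 : strain g2 g3 eps (rigid_grad eps c) x o0 o1 = 0.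
  rewrite s01 h00 h10 h01 h11 !mulfK // !ac; move: (p x.1) (q x.1) => P Q; ring.
apply/matrixP; apply: ord2_ind; apply: ord2_ind; rewrite [RHS]mxE //.
by rewrite s10 -s01.
Qed.

(** In the frame, the scaled gradient [R0^T grad_eps] splits into its symmetric part, with entries
    [e11], [e12], [e22], and the antisymmetric part [om]. The symmetric part has the Frobenius norm
    of the strain. *)
Lemma strain_components (M eps : R) Dv : 1 <= M -> (forall x, S x -> `|k x.1| <= M) ->
  0 < eps -> eps * M <= 1 -> (forall i j, L2 (Dv i j)) ->
  let E := L2_norm_mx (strain g2 g3 eps Dv) in
  exists e11 e12 e22 om : R * R -> R,
  [/\ [/\ L2 e11, L2 e12, L2 e22 & L2 om], [/\ nrm e11 <= E, nrm e12 <= E & nrm e22 <= E] &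
  forall x, S x -> [/\ p x.1 * Dv o0 o0 x + q x.1 * Dv o1 o0 x = J eps x * e11 x,
    - q x.1 * Dv o0 o0 x + p x.1 * Dv o1 o0 x = J eps x * (e12 x + om x),
    p x.1 * Dv o0 o1 x + q x.1 * Dv o1 o1 x = eps * (e12 x - om x) &
    - q x.1 * Dv o0 o1 x + p x.1 * Dv o1 o1 x = eps * e22 x]].
Proof.
move=> M1 kM e0 eM LD E.
have Jb x (Sx : S x) := jacobian_bounds Sx (kM x Sx) e0 eM.
have J0 x : S x -> 2^-1 <= J eps x by move=> Sx; have [_ /andP[]] := Jb x Sx.
have Jn0 x : S x -> J eps x != 0 by move=> Sx; rewrite gt_eqF // (lt_le_trans _ (J0 x Sx)).
have en0 : eps != 0 by rewrite gt_eqF.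
have mJ := jacobian_msr eps.
have mJi : msr (fun x => (J eps x)^-1).
  (* The inverse is obtained as a power with exponent -1, legitimate because the Jacobian is
     positive on S. *)
  have := measurableT_comp (@measurable_powR R (-1)) mJ; apply: msr_eq => x Sx /=.
  by rewrite powR_inv1 // (le_trans _ (J0 x Sx)).
have Jib x : S x -> `|(J eps x)^-1| <= 2.
  move=> Sx; have h := J0 x Sx; rewrite normfV ger0_norm; last by rewrite (le_trans _ h).
  by rewrite -[leRHS]invrK lef_pV2 ?posrE // (lt_le_trans _ h).
have LJ f : L2 f -> L2 (fun x => f x / J eps x).
  by move=> Lf; apply: L2_eq (bounded_L2M mJi Jib Lf) => x _; rewrite mulrC.
have Le f : L2 f -> L2 (fun x => f x / eps).
  by move=> Lf; apply: L2_eq (L2Z eps^-1 Lf) => x _; rewrite mulrC.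
have cnq : continuous (fun x => - q x) by move=> x; apply: cvgN; exact: cq.
have LC f g : L2 f -> L2 g -> L2 (fun x => p x.1 * f x + q x.1 * g x).
  by move=> Lf Lg; apply: L2D; exact: L2_mul1.
have LC' f g : L2 f -> L2 g -> L2 (fun x => - q x.1 * f x + p x.1 * g x).
  by move=> Lf Lg; apply: L2D; [exact: (L2_mul1 cnq)|exact: L2_mul1].
pose e11 x := p x.1 * (Dv o0 o0 x / J eps x) + q x.1 * (Dv o1 o0 x / J eps x).
pose y x := - q x.1 * (Dv o0 o0 x / J eps x) + p x.1 * (Dv o1 o0 x / J eps x).
pose z x := p x.1 * (Dv o0 o1 x / eps) + q x.1 * (Dv o1 o1 x / eps).
pose e22 x := - q x.1 * (Dv o0 o1 x / eps) + p x.1 * (Dv o1 o1 x / eps).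
have L11 : L2 e11 by apply: LC; exact: LJ.
have L22 : L2 e22 by apply: LC'; exact: Le.
have Ly : L2 y by apply: LC'; exact: LJ.
have Lz : L2 z by apply: LC; exact: Le.
have L12 : L2 (fun x => 2^-1 * (y x + z x)) by apply: L2Z; exact: L2D.
have Lo : L2 (fun x => 2^-1 * (y x - z x)) by apply: L2Z; exact: L2B.
exists e11, (fun x => 2^-1 * (y x + z x)), e22, (fun x => 2^-1 * (y x - z x)).
have EE : E = Num.sqrt (ip e11 e11 + 2 * ip (fun x => 2^-1 * (y x + z x)) (fun x => 2^-1 * (y x + z x))
    + ip e22 e22).
  rewrite /E /L2_norm_mx; congr Num.sqrt.
  rewrite /ip -int2Z; last exact: L2_intgM.
  rewrite -!int2D; do ?[exact: L2_intgM | apply: intgZ; exact: L2_intgM | apply: intgD].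
  by apply: int2_eq => x Sx; rewrite strain_sqr /=; rewrite !expr2.
have N1 := ip_ge0 e11; have N3 := ip_ge0 e22.
have N2 := ip_ge0 (fun x => 2^-1 * (y x + z x)).
split => //.
  rewrite EE; split; apply: nrm_le_of_sqr; first [exact: addr_ge0|lra].
move=> x Sx; have jn0 : 1 - eps * x.2 * k x.1 != 0 := Jn0 x Sx; rewrite /e11 /e22 /y /z.
exact: strain_solve.
Qed.

Lemma rigidity_estimate : exists eps0 C : R, 0 < eps0 /\ 0 < C /\
  forall eps v Dv p Dp, 0 < eps < eps0 -> W12 v Dv -> is_proj g2 g3 eps v Dv p Dp ->
    W12_norm (fun i x => v i x - p i x) (fun i j x => Dv i j x - Dp i j x)
      <= C / eps * L2_norm_mx (strain g2 g3 eps Dv).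
Proof.
have [M [M1 kM]] := curvature_bound.
have K71 := K7_ge1.
pose B := 12 * (1 + (2 + 2 * K7 * (5 + 2 * M))).
have B0 : 0 < B by rewrite /B; nra.
have KM0 : 0 < 4 * K7 * M by nra.
(* Below this threshold the term [eps |omega|] can be absorbed; 6 is the number of terms in the
   [W^{1,2}] inner product. *)
exists (4 * K7 * M)^-1, (6 * B); split; first by rewrite invr_gt0.
split; first by rewrite mulr_gt0.
move=> eps v Dv pr Dpr /andP[e0 eS] Wv Hp.
have small : 4 * K7 * M * eps <= 1.
  by rewrite mulrC -ler_pdivlMr // div1r ltW.
have eM := small_curvature M1 e0 small.
have e1 : eps <= 1 by nra.
have LD i j : L2 (Dv i j) by case: (Wv.2 i j).
set E := L2_norm_mx _.
have [e11 [e12 [e22 [om [[L11 L12 L22 Lo] [n11 n12 n22] h]]]]] :=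
  strain_components M1 kM e0 eM LD.
(* The rotation of the rigid field is the mean of [om]; its translation [z] is zero until the mean
   of the remaining displacement is available. *)
pose c := int2 om; pose z (i : 'I_2) : R := 0.
have [Wr1 Wr2] := rigid_W12 eps (- c) z.
have Jn0 x : S x -> J eps x != 0.
  move=> Sx; have [_ /andP[j0 _]] := jacobian_bounds Sx (kM x Sx) e0 eM.
  by rewrite gt_eqF // (lt_le_trans _ j0).
pose v' i x := v i x + rigid eps (- c) z i x.
pose Dv' i j x := Dv i j x + rigid_grad eps (- c) i j x.
have Lv' i : L2 (v' i) by apply: L2D; [exact: Wv.1|exact: Wr1].
have LDv' i j : L2 (Dv' i j) by apply: L2D; [exact: LD|case: (Wr2 i j)].
have ws i : weak_s (v' i) (Dv' i o0).
  apply: weak_sD; [exact: Wv.1|exact: Wr1|exact: LD|by case: (Wr2 i o0)| |].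
    by apply: weak_pderiv_s; case: (Wv.2 i o0).
  by apply: weak_pderiv_s; case: (Wr2 i o0).
have wt i : weak_t (v' i) (Dv' i o1).
  apply: weak_tD; [exact: Wv.1|exact: Wr1|exact: LD|by case: (Wr2 i o1)| |].
    by apply: weak_pderiv_t; case: (Wv.2 i o1).
  by apply: weak_pderiv_t; case: (Wr2 i o1).
have Loc : L2 (fun x => om x - c) by apply: L2B => //; exact: L2_cst.
have oc0 : int2 (fun x => om x - c) = 0.
  rewrite int2D ?int2_cst ?subrr //; first exact: L2_intg.
  exact: intg_cst.
have S01 x (Sx : S x) := unit_speed Sx.1.
have := displacement_estimate M1 kM e0 e1 small (Lv' o0) (LDv' o0 o0) (LDv' o0 o1)
  (Lv' o1) (LDv' o1 o0) (LDv' o1 o1) (ws o0) (wt o0) (ws o1) (wt o1)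
  L11 L12 L22 Loc n11 n12 n22 oc0.
case.
- move=> x Sx; have [a _ _ _] := h x Sx; have [r0 r1 _ _] := rigid_gradE eps (- c) Sx.
  by rewrite -a /Dv' r0 r1; ring.
- move=> x Sx; have [_ a _ _] := h x Sx; have [r0 r1 _ _] := rigid_gradE eps (- c) Sx.
  transitivity (J eps x * (e12 x + om x) - c * (p x.1 ^+ 2 + q x.1 ^+ 2) * J eps x).
    by rewrite -a /Dv' r0 r1; ring.
  by rewrite (S01 x Sx); ring.
- move=> x Sx; have [_ _ a _] := h x Sx; have [_ _ r0 r1] := rigid_gradE eps (- c) Sx.
  transitivity (eps * (e12 x - om x) + c * eps * (p x.1 ^+ 2 + q x.1 ^+ 2)).
    by rewrite -a /Dv' r0 r1; ring.
  by rewrite (S01 x Sx); ring.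
- move=> x Sx; have [_ _ _ a] := h x Sx; have [_ _ r0 r1] := rigid_gradE eps (- c) Sx.
  by rewrite -a /Dv' r0 r1; ring.
rewrite -/B; set K := B / eps * E => -[b00 b01] [b10 b11] bv0 bv1.
(* The translation is the mean that Poincare's inequality leaves undetermined. *)
pose d i := int2 (v' i).
have K0 : 0 <= K by exact: le_trans (nrm_ge0 _) b00.
have -> : 6 * B / eps * E = 6 * K by rewrite /K !mulrA.
move: K K0 b00 b01 b10 b11 bv0 bv1 => K K0 b00 b01 b10 b11 bv0 bv1.
apply: (dist_proj_le Wv Hp (rigid_in_M c d e0 Jn0) K0).
- have e i : nrm (fun x => v i x - rigid eps c d i x) = nrm (fun x => v' i x - int2 (v' i)).
    apply: nrm_eq => x _; rewrite -/(d i) /v' /rigid /z; move: (d i) (v i x) => D V.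
    move: (p x.1) (q x.1) (g2 x.1) (g3 x.1) => P Q G H.
    by case: ifP => _; ring.
  by apply: ord2_ind; rewrite e; [exact: bv0|exact: bv1].
- have e i j : nrm (fun x => Dv i j x - rigid_grad eps c i j x) = nrm (Dv' i j).
    apply: nrm_eq => x _; rewrite /Dv' /rigid_grad; move: (Dv i j x) => V.
    move: (p x.1) (q x.1) (p1 x.1) (q1 x.1) => P Q G H.
    by case: ifP => _; case: ifP => _; ring.
  by apply: ord2_ind; apply: ord2_ind; rewrite e; [exact: b00|exact: b01|exact: b10|exact: b11].
Qed.

End Rigidity.

Theorem mainTheorem2 (R : realType) (g2 g3 : R -> R)
  (hC6_2 : Ck 6 g2) (hC6_3 : Ck 6 g3)
  (harc : forall s, 0 <= s <= 1 -> derive1n 1 g2 s ^+ 2 + derive1n 1 g3 s ^+ 2 = 1)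
  (hsimple : forall s1 s2, 0 <= s1 <= 1 -> 0 <= s2 <= 1 ->
     g2 s1 = g2 s2 -> g3 s1 = g3 s2 -> s1 = s2)
  (hk : exists s, 0 <= s <= 1 /\ curvature g2 g3 s != 0) :
  exists eps0 C : R, 0 < eps0 /\ 0 < C /\
    forall (eps : R) (v : 'I_2 -> R * R -> R) (Dv : 'I_2 -> 'I_2 -> R * R -> R)
           (p : 'I_2 -> R * R -> R) (Dp : 'I_2 -> 'I_2 -> R * R -> R),
      0 < eps < eps0 -> W12 v Dv -> is_proj g2 g3 eps v Dv p Dp ->
      W12_norm (fun i x => v i x - p i x) (fun i j x => Dv i j x - Dp i j x)
        <= C / eps * L2_norm_mx (strain g2 g3 eps Dv).
Proof.
have d2 m (h : (m < 6)%N) := Ck_is_derive hC6_2 h.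
have d3 m (h : (m < 6)%N) := Ck_is_derive hC6_3 h.
have c2 m (h : (m < 6)%N) := is_derive_continuous (d2 m h).
have c3 m (h : (m < 6)%N) := is_derive_continuous (d3 m h).
have frenet s (s01 : 0 < s < 1) :
    derive1n 1 g2 s ^+ 2 + derive1n 1 g3 s ^+ 2 = 1 /\
    derive1n 2 g2 s = - (curvature g2 g3 s * derive1n 1 g3 s) /\
    derive1n 2 g3 s = curvature g2 g3 s * derive1n 1 g2 s.
  have u : derive1n 1 g2 s ^+ 2 + derive1n 1 g3 s ^+ 2 = 1.
    by case/andP: s01 => s0 s1; rewrite harc // !ltW.
  split => //.
  exact: frenet_algebra u (unit_speed_derive (d2 1 isT) (d3 1 isT) harc s01).
(* The curvature is a Wronskian of the first derivatives, so the products of second derivatives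
   cancel when it is differentiated. *)
have dk s := is_derive_wronskian s (d2 1 isT) (d3 1 isT) (d2 2 isT) (d3 2 isT).
have dk1 s := is_derive_mulB (d2 1 isT s) (d3 3 isT s) (d3 1 isT s) (d2 3 isT s).
apply: (rigidity_estimate erefl erefl erefl (d2 0 isT) (d3 0 isT) (d2 1 isT) (d3 1 isT)
  (d2 2 isT) (d3 2 isT) dk dk1 (c2 3 isT) (c3 3 isT) _
  (fun s h => (frenet s h).1) (fun s h => (frenet s h).2.1) (fun s h => (frenet s h).2.2)).
by move=> s; apply: cvgB; apply: cvgD; apply: cvgM;
  [exact: (c2 2)|exact: (c3 3)|exact: (c2 1)|exact: (c3 4)
  |exact: (c3 2)|exact: (c2 3)|exact: (c3 1)|exact: (c2 4)].
Qed.
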